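(* For every continuous proper function $F:X_3\to[0,\infty)$ there is a constant $T>0$ such that $(T,\infty)\subset\{\limsup_{t\to\infty}F(g_th_x\mathbb{Z}^3):x\in\mathbb{R}^2\}$ and such that, for every $A>T$, the set $$\Big\{x\in\mathbb{R}^2:\limsup_{t\to\infty}F(g_th_x\mathbb{Z}^3)=A\Big\}$$ is uncountable. Consequently, for every norm $\|\cdot\|_{\mathbb{R}^2}$ on $\mathbb{R}^2$ there is $\rho_0>0$ such that, for every $\rho\in(0,\rho_0)$, there are uncountably many $x\in\mathbb{R}^2\setminus\mathbb{Q}^2$ with $\liminf_{q\to\infty}q^{1/2}\|qx\|_{\mathbb{T}^2}=\rho$.
   Context: $X_3=\mathrm{SL}_3(\mathbb{R})/\mathrm{SL}_3(\mathbb{Z})$ is the space of unimodular lattices in $\mathbb{R}^3$ (the class of $g$ is identified with $g\mathbb{Z}^3$). The flow $g_t=\operatorname{diag}(e^{-2t},e^t,e^t)$ acts on $X_3$ by left multiplication. For a column vector $x\in\mathbb{R}^2$, $h_x=\begin{pmatrix}1&0\\-x&I_2\end{pmatrix}$ (in $1+2$ block form). For a norm $\|\cdot\|_{\mathbb{R}^2}$, $\|x\|_{\mathbb{T}^2}=\min_{p\in\mathbb{Z}^2}\|x-p\|_{\mathbb{R}^2}$, and $q$ ranges over positive integers. *)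

(* Defs.v *)
From HB Require Import structures.
From mathcomp Require Import all_boot all_order all_algebra generic_quotient.
From mathcomp Require Import all_classical all_reals all_analysis.
Import Order.TTheory GRing.Theory Num.Theory.
Import numFieldNormedType.Exports.

Set Implicit Arguments.
Unset Strict Implicit.
Unset Printing Implicit Defensive.

Local Open Scope classical_set_scope.
Local Open Scope ring_scope.
Local Open Scope quotient_scope.

(* As a [set_type], SL3 R carries the topology induced from 'M[R]_3. *)
Definition SL3 (R : realType) : set 'M[R]_3 := [set g | \det g = 1].
Arguments SL3 R : clear implicits.

Section SpaceOfLattices.
Variable R : realType.
Implicit Types g h k : SL3 R.

Lemma det_SL3 g : \det (val g) = 1.
Proof. by case: g => g /= /set_mem. Qed.

Lemma SL3_mul_subproof g h : val g *m val h \in SL3 R.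
Proof. by apply/mem_set; rewrite /SL3 /= det_mulmx !det_SL3 mulr1. Qed.

Definition SL3_mul g h : SL3 R := SigSub (SL3_mul_subproof g h).

(* g and h lie in the same coset of SL_3(Z), i.e. g Z^3 = h Z^3. *)
Definition SL3_rel g h : bool :=
  `[< exists2 c : 'M[int]_3,
        \det c = 1 & val h = val g *m map_mx intr c >].

Lemma SL3_rel_refl : reflexive SL3_rel.
Proof.
move=> g; apply/asboolP; exists 1%:M; first exact: det1.
by rewrite map_mx1 mulmx1.
Qed.

Lemma SL3_rel_trans : transitive SL3_rel.
Proof.
move=> h g k /asboolP[c c1 hE] /asboolP[d d1 kE]; apply/asboolP.
exists (c *m d); first by rewrite det_mulmx c1 d1 mulr1.
by rewrite map_mxM mulmxA -hE.
Qed.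

Lemma SL3_rel_sym : symmetric SL3_rel.
Proof.
suff S g h : SL3_rel g h -> SL3_rel h g by move=> g h; apply/idP/idP; exact: S.
move=> /asboolP[c c1 hE]; apply/asboolP.
have uc : c \in unitmx by rewrite unitmxE c1 unitr1.
exists (invmx c); first by rewrite det_inv c1 invr1.
by rewrite hE -mulmxA -map_mxM mulmxV // map_mx1 mulmx1.
Qed.

Canonical SL3_equiv : equiv_rel (SL3 R) :=
  EquivRel SL3_rel SL3_rel_refl SL3_rel_sym SL3_rel_trans.

Definition X3 : topologicalType := quotient_topology {eq_quot SL3_equiv}.

Definition lattice g : X3 := \pi_{eq_quot SL3_equiv} g.

Definition SL3_act g (L : X3) : X3 :=
  lattice (SL3_mul g (repr (L : {eq_quot SL3_equiv}))).

Lemma SL3_actE g h : SL3_act g (lattice h) = lattice (SL3_mul g h).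
Proof.
have /eqmodP/asboolP[c c1 hE] :
    repr (\pi_{eq_quot SL3_equiv} h) = h %[mod {eq_quot SL3_equiv}].
  by rewrite reprK.
by apply/eqmodP/asboolP; exists c; rewrite //= hE mulmxA.
Qed.

Definition flow_mx (t : R) : 'M[R]_3 :=
  diag_mx (\row_(i < 3) if i == ord0 then expR (- (2 * t)) else expR t).

Lemma flow_mx_subproof t : flow_mx t \in SL3 R.
Proof.
apply/mem_set; rewrite /SL3 /= det_diag !big_ord_recl big_ord0 !mxE /= mulr1.
rewrite -!expRD (_ : _ + _ = 0) ?expR0 //.
by rewrite mulr2n mulrDl mul1r addNr.
Qed.

Definition flow (t : R) : SL3 R := SigSub (flow_mx_subproof t).

Definition horo_mx (x : 'cV[R]_2) : 'M[R]_3 :=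
  block_mx (1%:M : 'M[R]_1) 0 (- x) (1%:M : 'M[R]_2).

Lemma horo_mx_subproof x : horo_mx x \in SL3 R.
Proof.
apply/mem_set; rewrite /SL3 /= /horo_mx.
rewrite (@det_lblock R 1 2 1%:M (- x) 1%:M).
by rewrite !det1 mulr1.
Qed.

Definition horo (x : 'cV[R]_2) : SL3 R := SigSub (horo_mx_subproof x).

(* For F >= 0 and K compact in R, K `&` [0, +oo[ is compact, so this is
   properness of F as a map into [0, +oo[. *)
Definition proper_map (F : X3 -> R) : Prop :=
  forall K : set R, compact K -> compact (F @^-1` K).

Definition limsup_orbit (F : X3 -> R) (x : 'cV[R]_2) : \bar R :=
  limf_esup (fun t : R => (F (SL3_act (flow t) (lattice (horo x))))%:E)
            (pinfty_nbhs R).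

End SpaceOfLattices.

Section Diophantine.
Variable R : realType.

Definition is_norm (N : 'cV[R]_2 -> R) : Prop :=
  [/\ forall x, 0 <= N x,
      forall x, N x = 0 -> x = 0,
      forall (a : R) x, N (a *: x) = `|a| * N x
    & forall x y, N (x + y) <= N x + N y].

(* The infimum is a minimum, as only finitely many integer points lie in any
   bounded set. *)
Definition torus_norm (N : 'cV[R]_2 -> R) (x : 'cV[R]_2) : R :=
  inf (range (fun p : 'cV[int]_2 => N (x - map_mx intr p))).

Definition rational_points : set 'cV[R]_2 :=
  range (fun r : 'cV[rat]_2 => map_mx ratr r).

(* The term at q = 0 does not affect the lower limit. *)
Definition liminf_approx (N : 'cV[R]_2 -> R) (x : 'cV[R]_2) : \bar R :=
  limn_einf (fun q : nat => (Num.sqrt q%:R * torus_norm N (q%:R *: x))%:E).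

End Diophantine.

(* Main.v *)
Require Import Defs.
From mathcomp Require Import all_boot all_order all_algebra.
From mathcomp Require Import all_classical all_reals all_analysis.
From mathcomp Require Import ring lra zify.
Import Order.TTheory GRing.Theory Num.Theory.
Import numFieldNormedType.Exports.

Local Open Scope classical_set_scope.
Local Open Scope ring_scope.

Set Implicit Arguments.
Unset Strict Implicit.
Unset Printing Implicit Defensive.

(** The observable F is a continuous function of a basis, invariant under SL_3(Z).
    An explicit x with upper limit A is built by prescribing the orbit of the lattice
    of x under the flow in successive stages.

    The flow is centralized by GL_2 acting on the two expanded coordinates.  A frame
    is a lattice with an automorphism that acts as a time of the flow composed with a
    rotation of infinite order of the expanded plane; the lattice of
    the cubic field of the plastic number is one ([frame_exists]).  Its images under
    the flow and the rotations fill a compact torus, and every element m of SL_2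
    gives another compact torus.  Modulo rotations m is a point of the hyperbolic
    plane.  A second automorphism of the frame gives orbits which leave the torus of
    m and are asymptotic to the torus of another point, at a fixed distance from m in
    an arbitrary direction ([renewal]): the powers of the rotation of infinite order
    are dense ([rot_dense]), so the direction can be chosen by waiting.  Inserting one
    such move is an arbitrarily small change of x, which takes effect arbitrarily late
    and after which the same situation is found again ([renewal_step]).

    Let Psi(m) be the supremum of F over the moves that start from or lead to m.  It
    is finite, because these orbits are bounded ([tracking]); it is continuous in m,
    and it is unbounded since F is proper and m can be taken to shorten a given vector
    of a lattice.  By connectedness it takes every large value A.  If Psi(m) = A,
    going from m along a nearly optimal move and back, infinitely often, produces
    upper limit A.  Each move introduces an error in the position; but two circles of
    equal radius with close centers meet ([circles_meet]), so an error is removed by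
    moving onto the circle about m and then to its center ([loop_leads]).  Errors and
    changes tend to 0, and the points x converge ([leads_limit]).  At stage j the j-th
    point of any given sequence is avoided, so the set of solutions is uncountable.

    For Diophantine approximation take for F the inverse of the shortest length of
    a vector, measured by the maximum of the first coordinate and of the norm of the
    other two.  The vector attached to the approximation p / q is shortest along the
    orbit when its two parts have equal size, and has then the length
    (q N(q x - p)^2)^(1/3).  Hence upper limit A for F means lower limit rho for
    q^(1/2) N(q x - p), where A^3 rho^2 = 1 ([approx_lower], [approx_upper]). *)

(** * An entrywise norm on rectangular matrices *)

Section EntrySumNorm.
Variable R : realType.

(** Summing all entries gives a norm that is submultiplicative, without constants,
    for rectangular matrices of all sizes and additive over blocks. *)
Definition nrm m n (A : 'M[R]_(m, n)) : R := \sum_i \sum_j `|A i j|.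

Lemma nrm_ge0 m n (A : 'M[R]_(m, n)) : 0 <= nrm A.
Proof. by apply: sumr_ge0 => i _; apply: sumr_ge0. Qed.

Lemma entry_le_nrm m n (A : 'M[R]_(m, n)) i j : `|A i j| <= nrm A.
Proof.
rewrite /nrm (bigD1 i) //= (bigD1 j) //= -addrA lerDl addr_ge0 //.
  exact: sumr_ge0.
by apply: sumr_ge0 => k _; apply: sumr_ge0.
Qed.

Lemma entry_dist_le_nrm m n (A B : 'M[R]_(m, n)) i j :
  `|A i j - B i j| <= nrm (A - B).
Proof. by have := entry_le_nrm (A - B) i j; rewrite !mxE. Qed.

Lemma nrm_eq0 m n (A : 'M[R]_(m, n)) : (nrm A == 0) = (A == 0).
Proof.
apply/eqP/eqP => [A0|->]; last first.
  by rewrite /nrm big1 // => i _; rewrite big1 // => j _; rewrite mxE normr0.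
apply/matrixP => i j; rewrite mxE; apply/eqP; rewrite -normr_le0 -A0.
exact: entry_le_nrm.
Qed.

Lemma nrm0 m n : nrm (0 : 'M[R]_(m, n)) = 0.
Proof. by apply/eqP; rewrite nrm_eq0. Qed.

Lemma nrm_gt0 m n (A : 'M[R]_(m, n)) : (0 < nrm A) = (A != 0).
Proof. by rewrite lt_def nrm_eq0 nrm_ge0 andbT. Qed.

Lemma nrmD m n (A B : 'M[R]_(m, n)) : nrm (A + B) <= nrm A + nrm B.
Proof.
rewrite /nrm -big_split ler_sum // => i _.
by rewrite -big_split ler_sum // => j _; rewrite mxE ler_normD.
Qed.

Lemma nrmZ m n (a : R) (A : 'M[R]_(m, n)) : nrm (a *: A) = `|a| * nrm A.
Proof.
rewrite /nrm mulr_sumr; apply: eq_bigr => i _; rewrite mulr_sumr.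
by apply: eq_bigr => j _; rewrite mxE normrM.
Qed.

Lemma nrmN m n (A : 'M[R]_(m, n)) : nrm (- A) = nrm A.
Proof. by rewrite -scaleN1r nrmZ normrN1 mul1r. Qed.

Lemma nrmB m n (A B : 'M[R]_(m, n)) : nrm (A - B) <= nrm A + nrm B.
Proof. by rewrite -(nrmN B) nrmD. Qed.

Lemma nrmBC m n (A B : 'M[R]_(m, n)) : nrm (A - B) = nrm (B - A).
Proof. by rewrite -nrmN opprB. Qed.

Lemma nrmM m n p (A : 'M[R]_(m, n)) (B : 'M[R]_(n, p)) :
  nrm (A *m B) <= nrm A * nrm B.
Proof.
have rB k : \sum_j `|B k j| <= nrm B.
  rewrite /nrm [leRHS](bigD1 k) //= lerDl.
  by apply: sumr_ge0 => i _; apply: sumr_ge0.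
rewrite {2}/nrm mulr_suml ler_sum // => i _.
have -> : (\sum_j `|A i j|) * nrm B = \sum_k (`|A i k| * nrm B).
  by rewrite mulr_suml.
have : \sum_k ((`|A i k|) * (\sum_j `|B k j|)) <= \sum_k (`|A i k| * nrm B).
  by apply: ler_sum => k _; rewrite ler_wpM2l.
apply: le_trans; under [leRHS]eq_bigr do rewrite mulr_sumr.
rewrite exchange_big ler_sum // => j _; rewrite mxE.
apply: le_trans (ler_norm_sum _ _ _) _.
by apply: ler_sum => k _; rewrite normrM.
Qed.

Lemma nrm_block m1 m2 n1 n2 (A : 'M[R]_(m1, n1)) (B : 'M[R]_(m1, n2))
    (C : 'M[R]_(m2, n1)) (D : 'M[R]_(m2, n2)) :
  nrm (block_mx A B C D) = nrm A + nrm B + (nrm C + nrm D).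
Proof.
rewrite /nrm big_split_ord /= -!big_split /=.
congr (_ + _); apply: eq_bigr => i _; rewrite big_split_ord /=;
  congr (_ + _); apply: eq_bigr => j _;
  by rewrite ?block_mxEul ?block_mxEur ?block_mxEdl ?block_mxEdr.
Qed.

Lemma nrm_col m1 m2 n (A : 'M[R]_(m1, n)) (B : 'M[R]_(m2, n)) :
  nrm (col_mx A B) = nrm A + nrm B.
Proof.
rewrite /nrm big_split_ord /=; congr (_ + _); apply: eq_bigr => i _;
  by apply: eq_bigr => j _; rewrite ?col_mxEu ?col_mxEd.
Qed.

Lemma nrm_scalar n (a : R) : nrm (a%:M : 'M[R]_n) = `|a| * n%:R.
Proof.
rewrite /nrm (eq_bigr (fun=> `|a|)) => [|i _]; last first.
  rewrite (bigD1 i) //= big1 => [|j ji]; first by rewrite mxE eqxx addr0.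
  by rewrite mxE eq_sym (negPf ji) normr0.
by rewrite sumr_const card_ord mulr_natr.
Qed.

Lemma nrm_le_entries m n (A : 'M[R]_(m, n)) c :
  (forall i j, `|A i j| <= c) -> nrm A <= c * (m * n)%:R.
Proof.
move=> Ac; rewrite (@le_trans _ _ (\sum_(i < m) \sum_(j < n) c)) //.
  by apply: ler_sum => i _; apply: ler_sum.
by rewrite !sumr_const !card_ord -mulrnA mulr_natr mulnC.
Qed.

Lemma nrm2 (A : 'M[R]_2) :
  nrm A = `|A 0%R 0%R| + `|A 0%R 1%R| + (`|A 1%R 0%R| + `|A 1%R 1%R|).
Proof.
rewrite /nrm !big_ord_recl !big_ord0 !addr0.
by have -> : lift ord0 ord0 = 1 :> 'I_2 by apply: val_inj.
Qed.

End EntrySumNorm.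

(** * Block matrices and the subgroups attached to the flow *)

Section Blocks.
Variable R : realType.
Implicit Types (a b c d : R) (u : 'rV[R]_2) (v w : 'cV[R]_2) (A B C : 'M[R]_2).

Definition mx2 a b c d : 'M[R]_2 :=
  \matrix_(i, j) if i == 0 then (if j == 0 then a else b)
                 else (if j == 0 then c else d).

Lemma ord2P (i : 'I_2) : i = 0 \/ i = 1.
Proof. by case: i => [[|[|//]] p]; [left|right]; apply: val_inj. Qed.

Lemma eq_mx2 A B : A 0 0 = B 0 0 -> A 0 1 = B 0 1 -> A 1 0 = B 1 0 ->
  A 1 1 = B 1 1 -> A = B.
Proof.
move=> *; apply/matrixP => i j.
by case: (ord2P i) => ->; case: (ord2P j) => ->.
Qed.

Lemma mx2E A : A = mx2 (A 0 0) (A 0 1) (A 1 0) (A 1 1).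
Proof. by apply: eq_mx2; rewrite mxE. Qed.

Lemma sum2E (F : 'I_2 -> R) : \sum_i F i = F 0 + F 1.
Proof.
rewrite !big_ord_recl big_ord0 addr0.
by have -> : lift ord0 ord0 = 1 :> 'I_2 by apply: val_inj.
Qed.

Lemma mx2M a b c d a' b' c' d' : mx2 a b c d *m mx2 a' b' c' d' =
  mx2 (a * a' + b * c') (a * b' + b * d') (c * a' + d * c') (c * b' + d * d').
Proof. by apply: eq_mx2; rewrite !mxE sum2E !mxE. Qed.

Lemma mx2Z a b c d e : e *: mx2 a b c d = mx2 (e * a) (e * b) (e * c) (e * d).
Proof. by apply: eq_mx2; rewrite !mxE. Qed.

Lemma mx2_1 : 1%:M = mx2 1 0 0 1.
Proof. by apply: eq_mx2; rewrite !mxE. Qed.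

Lemma mx2_scalar a : a%:M = mx2 a 0 0 a.
Proof. by apply: eq_mx2; rewrite !mxE. Qed.

Lemma mx2D a b c d a' b' c' d' : mx2 a b c d + mx2 a' b' c' d' =
  mx2 (a + a') (b + b') (c + c') (d + d').
Proof. by apply: eq_mx2; rewrite !mxE. Qed.

Lemma mx2N a b c d : - mx2 a b c d = mx2 (- a) (- b) (- c) (- d).
Proof. by apply: eq_mx2; rewrite !mxE. Qed.

Lemma det_mx2 a b c d : \det (mx2 a b c d) = a * d - b * c.
Proof.
rewrite (expand_det_row _ 0) sum2E /cofactor !det_mx11 !mxE /=.
by rewrite expr0 expr1 mul1r mulN1r mulrN.
Qed.

Lemma nrm_mx2 a b c d : nrm (mx2 a b c d) = `|a| + `|b| + (`|c| + `|d|).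
Proof. by rewrite nrm2 !mxE. Qed.

(** In dimension two the adjugate has the same entries up to sign and place,
    so a unimodular matrix and its inverse have the same size. *)
Lemma nrm_invmx2 B : \det B = 1 -> nrm (invmx B) = nrm B.
Proof.
rewrite [B]mx2E; move: (B 0 0) (B 0 1) (B 1 0) (B 1 1) => a b c d.
rewrite det_mx2 => dB.
have -> : invmx (mx2 a b c d) = mx2 d (- b) (- c) a.
  have uB : mx2 a b c d \in unitmx by rewrite unitmxE det_mx2 dB unitr1.
  rewrite -[RHS]mul1mx -(mulVmx uB) -mulmxA mx2M.
  rewrite [X in _ *m X](_ : _ = 1%:M) ?mulmx1 // mx2_1.
  by congr mx2; rewrite -?dB; ring.
by rewrite !nrm_mx2 !normrN; ring.
Qed.

(** The block decomposition 1 + 2 that separates the contracted coordinate of the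
    flow from the two expanded ones. *)
Definition bk a u v B : 'M[R]_3 := block_mx (a%:M : 'M[R]_1) u v B.

Lemma bkM a u v B a' u' v' B' : bk a u v B *m bk a' u' v' B' =
  bk (a * a' + (u *m v') 0 0) (a *: u' + u *m B') (a' *: v + B *m v')
     (v *m u' + B *m B').
Proof.
rewrite /bk; etransitivity; first exact: (@mulmx_block _ 1 2 1 2 1 2).
apply: (f_equal4 (@block_mx R 1 2 1 2)); rewrite ?mul_scalar_mx ?mul_mx_scalar //.
rewrite [LHS]mx11_scalar; congr (_%:M).
rewrite mxE; congr (_ + _); by rewrite !mxE eqxx !mulr1n.
Qed.

Lemma bkD a u v B a' u' v' B' : bk a u v B + bk a' u' v' B' =
  bk (a + a') (u + u') (v + v') (B + B').
Proof.
rewrite /bk; etransitivity; first exact: (@add_block_mx _ 1 2 1 2).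
by apply: (f_equal4 (@block_mx R 1 2 1 2)); rewrite ?raddfD.
Qed.

Lemma bkB a u v B a' u' v' B' : bk a u v B - bk a' u' v' B' =
  bk (a - a') (u - u') (v - v') (B - B').
Proof. by apply/eqP; rewrite subr_eq bkD !subrK. Qed.

Lemma nrm_bk a u v B : nrm (bk a u v B) = `|a| + nrm u + (nrm v + nrm B).
Proof.
rewrite /bk; etransitivity; first exact: (@nrm_block _ 1 2 1 2).
by rewrite nrm_scalar mulr1.
Qed.

Lemma bk1 : 1%:M = bk 1 0 0 1%:M.
Proof. exact: (scalar_mx_block 1 2 1). Qed.

Lemma bkP (A : 'M[R]_3) : exists a u v B, A = bk a u v B.
Proof.
exists (@ulsubmx _ 1 2 1 2 A 0 0), (@ursubmx _ 1 2 1 2 A),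
  (@dlsubmx _ 1 2 1 2 A), (@drsubmx _ 1 2 1 2 A).
by rewrite /bk -mx11_scalar; symmetry; exact: (@submxK _ 1 2 1 2 A).
Qed.

Lemma bk_inj a u v B a' u' v' B' :
  bk a u v B = bk a' u' v' B' -> [/\ a = a', u = u', v = v' & B = B'].
Proof.
move=> /(@eq_block_mx _ 1 2 1 2)[e1 -> -> ->]; split=> //.
by have := congr1 (fun M : 'M[R]_1 => M 0 0) e1; rewrite !mxE.
Qed.

Lemma det_bk_ub a u B : \det (bk a u 0 B) = a * \det B.
Proof.
rewrite /bk; etransitivity; first exact: (@det_ublock _ 1 2).
by rewrite det_scalar.
Qed.

Lemma det_bk_lb a v B : \det (bk a 0 v B) = a * \det B.
Proof.
rewrite /bk; etransitivity; first exact: (@det_lblock _ 1 2).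
by rewrite det_scalar.
Qed.

(** [Dg] is the part with positive determinant of the centralizer of the flow; the
    flow contracts [Ur] and expands the group of the matrices [horo_mx]. *)
Definition Dg B : 'M[R]_3 := bk (\det B)^-1 0 0 B.
Definition Ur u : 'M[R]_3 := bk 1 u 0 1%:M.
Notation Hr := (@horo_mx R).

Lemma HrE w : Hr w = bk 1 0 (- w) 1%:M.
Proof. by []. Qed.

Lemma Dg1 : Dg 1%:M = 1%:M.
Proof. by rewrite /Dg det1 invr1 bk1. Qed.

Lemma DgM B C : Dg (B *m C) = Dg B *m Dg C.
Proof.
rewrite /Dg bkM det_mulmx invfM !mulmx0 !mul0mx mxE !scaler0 !addr0.
by rewrite add0r.
Qed.

Lemma det_Dg B : 0 < \det B -> \det (Dg B) = 1.
Proof. by move=> dB; rewrite det_bk_ub mulVf // gt_eqF. Qed.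

Lemma det_Ur u : \det (Ur u) = 1.
Proof. by rewrite det_bk_ub det1 mulr1. Qed.

Lemma det_Hr w : \det (Hr w) = 1.
Proof. by rewrite HrE det_bk_lb det1 mulr1. Qed.

Lemma HrD v w : Hr (v + w) = Hr v *m Hr w.
Proof.
rewrite !HrE bkM !mul0mx !mulmx0 mxE !addr0 !scaler0 !add0r mulr1 mul1mx.
by rewrite scale1r opprD mul1mx.
Qed.

Lemma Ur0 : Ur 0 = 1%:M.
Proof. by rewrite /Ur bk1. Qed.

Lemma Dg_Hr B w : \det B != 0 ->
  Dg B *m Hr w = Hr (\det B *: (B *m w)) *m Dg B.
Proof.
move=> dB; rewrite /Dg !HrE !bkM !mul0mx !mulmx0 !mxE !scaler0 !addr0 !add0r.
by rewrite mulr1 mul1r mul1mx mulmx1 mulmxN scalerN scalerA mulVf // scale1r.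
Qed.

Lemma Ur_Dg B u : \det B != 0 ->
  Ur u *m Dg B = Dg B *m Ur (\det B *: (u *m B)).
Proof.
move=> dB; rewrite /Dg /Ur !bkM !mul0mx !mulmx0 !mxE !scaler0 !addr0 !add0r.
by rewrite mulr1 mul1r mul1mx mulmx1 scalerA mulVf // scale1r.
Qed.

Lemma Dg_Ur B u : \det B != 0 ->
  Dg B *m Ur u = Ur ((\det B)^-1 *: (u *m invmx B)) *m Dg B.
Proof.
move=> dB; rewrite Ur_Dg // -scalemxAl -mulmxA mulVmx ?unitmxE ?unitfE //.
by rewrite mulmx1 scalerA divff // scale1r.
Qed.

Lemma flow_mxE t : flow_mx t = Dg (expR t)%:M.
Proof.
rewrite /Dg det_scalar; apply/matrixP => i j.
have E0 : (lshift 2 0 : 'I_(1 + 2)) = ord0 by apply: val_inj.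
have E1 k : (@rshift 1 2 k == ord0) = false by apply/eqP => /(congr1 val).
have E2 k l : ((@lshift 1 2 k : 'I_3) == @rshift 1 2 l) = false.
  by apply/eqP => /(congr1 val) /=; case: k => [[]].
have E2' k l : ((@rshift 1 2 l : 'I_3) == @lshift 1 2 k) = false.
  by rewrite eq_sym E2.
have E3 k l : ((@rshift 1 2 k : 'I_3) == @rshift 1 2 l) = (k == l).
  by apply/eqP/eqP => [/(congr1 val) [/val_inj]|->].
case: (@split_ordP 1 2 i) => k ->; case: (@split_ordP 1 2 j) => l ->.
- rewrite [RHS](@block_mxEul _ 1 2 1 2) !mxE !ord1 !E0 !eqxx !mulr1n.
  by rewrite expRN mulr_natl mulr2n expRD -expr2.
- by rewrite [RHS](@block_mxEur _ 1 2 1 2) !mxE ?E2 ?E2' mulr0n.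
- by rewrite [RHS](@block_mxEdl _ 1 2 1 2) !mxE ?E2 ?E2' mulr0n.
- by rewrite [RHS](@block_mxEdr _ 1 2 1 2) !mxE E3 E1.
Qed.

End Blocks.
Local Notation Hr := (@horo_mx _).

(** * Rotations of the plane *)

Section Rotations.
Variable R : realType.
Implicit Types (a b c d x y phi psi : R).

Definition rot phi : 'M[R]_2 := mx2 (cos phi) (- sin phi) (sin phi) (cos phi).

Lemma rot0 : rot 0 = 1%:M.
Proof. by rewrite /rot cos0 sin0 oppr0 mx2_1. Qed.

Lemma rotD phi psi : rot (phi + psi) = rot phi *m rot psi.
Proof. by rewrite /rot mx2M cosD sinD; congr mx2; ring. Qed.

Lemma rotC phi psi : rot phi *m rot psi = rot psi *m rot phi.
Proof. by rewrite -!rotD addrC. Qed.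

Lemma rotNK phi : rot (- phi) *m rot phi = 1%:M.
Proof. by rewrite -rotD addNr rot0. Qed.

Lemma rotKN phi : rot phi *m rot (- phi) = 1%:M.
Proof. by rewrite rotC rotNK. Qed.

Lemma det_rot phi : \det (rot phi) = 1.
Proof. by rewrite det_mx2 -(cos2Dsin2 phi); ring. Qed.

Lemma rotDpi phi : rot (phi + pi) = - rot phi.
Proof. by rewrite /rot mx2N sinDpi cosDpi. Qed.

Lemma nrm_rot phi : nrm (rot phi) <= 4.
Proof.
have c1 : `|cos phi| <= 1 by rewrite ler_norml cos_geN1 cos_le1.
have s1 : `|sin phi| <= 1 by rewrite ler_norml sin_geN1 sin_le1.
by rewrite nrm_mx2 normrN; lra.
Qed.

Lemma rot_small e : 0 < e ->
  exists2 d, 0 < d & forall x, `|x| <= d -> nrm (rot x - 1%:M) <= e.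
Proof.
move=> e0; have e4 : 0 < e / 4 by rewrite divr_gt0.
have /cvgrPdist_le/(_ _ e4) : cos x @[x --> 0] --> cos (0 : R).
  exact: continuous_cos.
have /cvgrPdist_le/(_ _ e4) : sin x @[x --> 0] --> sin (0 : R).
  exact: continuous_sin.
move=> /nbhs_ballP[d1 /= d10 H1] /nbhs_ballP[d2 /= d20 H2].
exists (Num.min d1 d2 / 2) => [|x]; first by rewrite divr_gt0 // lt_min d10.
rewrite ler_pdivlMr // => xd.
have [x0|x0] := eqVneq x 0.
  by rewrite x0 rot0 subrr nrm0 ltW.
have {}xd : `|x| < Num.min d1 d2.
  by apply: lt_le_trans xd; rewrite ltr_pMr ?normr_gt0 // ltr1n.
move: xd; rewrite lt_min => /andP[xd1 xd2].
have := H1 x; rewrite /ball /= sub0r normrN => /(_ xd1).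
have := H2 x; rewrite /ball /= sub0r normrN => /(_ xd2).
rewrite cos0 sin0 sub0r normrN distrC => h1 h2.
by rewrite mx2_1 mx2N mx2D nrm_mx2 oppr0 !addr0 normrN; lra.
Qed.

Lemma rot_near e : 0 < e -> exists2 d, 0 < d &
  forall x y, `|x - y| <= d -> nrm (rot x - rot y) <= e.
Proof.
move=> e0; have [d d0 H] := @rot_small (e / 4) (divr_gt0 e0 (ltr0n _ 4)).
exists d => // x y /H xy; rewrite -[x](subrK y) rotD.
rewrite -{2}[rot y]mul1mx -mulmxBl.
apply: le_trans (nrmM _ _) _; rewrite -[e](@divfK _ 4) //.
by rewrite ler_pM ?nrm_ge0 ?nrm_rot.
Qed.

Lemma rotD2pin phi n : rot (phi + (pi *+ 2) *+ n) = rot phi.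
Proof.
elim: n => [|n IH]; first by rewrite mulr0n addr0.
by rewrite mulrSr addrA /rot cosD2pi sinD2pi -/(rot _) IH.
Qed.

Lemma rotD2pi phi (z : int) : rot (phi + (pi *+ 2) *~ z) = rot phi.
Proof.
case: (intP z) => [|n|n]; first by rewrite mulr0z addr0.
  by rewrite -pmulrn rotD2pin.
by rewrite mulrNz -pmulrn -(rotD2pin _ n.+1) subrK.
Qed.

(** The bound on the angle puts the unit circle in the image of a compact interval,
    where continuous functions attain their minimum. *)
Lemma principal_angle_ex a b : a ^+ 2 + b ^+ 2 = 1 ->
  exists2 phi, - pi <= phi <= pi & cos phi = a /\ sin phi = b.
Proof.
move=> ab; have a1 : -1 <= a <= 1 by apply/andP; split; nra.
have Ca : cos (acos a) = a by rewrite acosK // in_itv.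
have Sa : sin (acos a) = `|b|.
  by rewrite sin_acos // -sqrtr_sqr; congr Num.sqrt; rewrite -ab; ring.
have := acos_ge0 a1; have := acos_lepi a1; have := pi_ge0 R => p0 ap a0.
have [b0|b0] := ger0P b.
  by exists (acos a); [apply/andP; split; lra|rewrite Sa ger0_norm].
exists (- acos a); first by apply/andP; split; lra.
by rewrite cosN sinN Sa ltr0_norm // opprK.
Qed.

Lemma angle_ex a b : a ^+ 2 + b ^+ 2 = 1 ->
  exists phi, cos phi = a /\ sin phi = b.
Proof. by move=> /principal_angle_ex[phi _ ?]; exists phi. Qed.

End Rotations.

(** * Orbits of rotations on the circle and on matrices *)

Section RotationOrbits.
Variable R : realType.
Implicit Types (phi psi theta a b c d e : R) (A B : 'M[R]_2).

(** Kronecker's theorem on the circle: by the pigeonhole principle some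
    positive power of the rotation is arbitrarily close to, but distinct from,
    the identity, and its powers march around the circle in small steps. *)
Lemma rot_dense theta phi e N0 :
  (forall n, (0 < n)%N -> rot (n%:R * theta) <> 1%:M) -> 0 < e ->
  exists2 N, (N0 <= N)%N & nrm (rot (N%:R * theta) - rot phi) <= e.
Proof.
move=> irr /(@rot_near R)[d d0 Hd].
pose L : R := pi *+ 2.
have L0 : 0 < L by rewrite mulrn_wgt0 ?pi_gt0.
pose z n := Num.floor (n%:R * theta / L).
pose x n : R := n%:R * theta / L - (z n)%:~R.
have x0 n : 0 <= x n by rewrite subr_ge0 floor_le.
have x1 n : x n < 1.
  by rewrite ltrBlDr addrC; have := floorD1_gt (n%:R * theta / L); rewrite intrD.
have rx n : rot (L * x n) = rot (n%:R * theta).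
  rewrite -(rotD2pi (n%:R * theta) (- z n)); congr rot.
  by rewrite /x mulrBr mulrCA divff ?gt_eqF // mulr1 mulrNz mulrzr.
pose M := (Num.trunc (L / d)).+1.
have M0 : 0 < M%:R :> R by rewrite ltr0n.
have LM : L / M%:R < d.
  by rewrite ltr_pdivrMr // mulrC -ltr_pdivrMr // truncnS_gt.
have binP n : (Num.trunc (x n * M%:R) < M)%N.
  rewrite truncn_lt_nat //.
    by rewrite gtr_pMl.
  by rewrite mulr_ge0 // ltW.
pose bin (n : 'I_M.+1) : 'I_M := Ordinal (binP n).
have [n1 [n2 [n12 bin12]]] : exists n1 n2 : 'I_M.+1, (n1 < n2)%N /\ bin n1 = bin n2.
  have /injectivePn[n1 [n2 n12 b12]] : ~~ injectiveb bin.
    apply/injectiveP => /leq_card; by rewrite !card_ord ltnn.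
  case: (ltngtP n1 n2) => h; first by exists n1, n2.
    by exists n2, n1.
  by move: n12; rewrite (val_inj h) eqxx.
pose n := (n2 - n1)%N; pose y := L * (x n2 - x n1).
have n0 : (0 < n)%N by rewrite subn_gt0.
have yd : `|y| < d.
  apply: le_lt_trans LM; rewrite normrM gtr0_norm // ler_pM2l //.
  rewrite -(ler_pM2r M0) mulVf ?gt_eqF // -[M%:R in leLHS]gtr0_norm //.
  rewrite -normrM mulrBl.
  have /(congr1 val) /= b := bin12.
  have := truncn_itv (mulr_ge0 (x0 n1) (ltW M0)).
  have := truncn_itv (mulr_ge0 (x0 n2) (ltW M0)).
  rewrite b -natr1 => /andP[h1 h2] /andP[h3 h4].
  by rewrite ler_norml; apply/andP; split; lra.
have ry j : rot (j%:R * y) = rot ((j * n)%:R * theta).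
  rewrite natrM -(rotD2pi _ ((z n2 - z n1) * j%:Z)); congr rot.
  rewrite /y /x /n natrB ?(ltnW n12) // -/L -[L *~ _]mulrzr intrM intrB -[j%:~R]/(j%:R).
  by move: L0; generalize L => L' L'0; field; rewrite gt_eqF.
have y0 : y != 0.
  by apply/eqP => y0; apply: (irr n n0); rewrite -[n]mul1n -ry y0 mulr0 rot0.
have [t tN rt] : exists2 t, N0%:R <= t / y & rot t = rot phi.
  pose q := (N0%:R * y - phi) / L.
  have qL : N0%:R * y = phi + L * q by rewrite [L * q]mulrC divfK ?gt_eqF //; ring.
  have [yp|yn] := ltrP 0 y.
    exists (phi + L *~ (Num.floor q + 1)); last exact: rotD2pi.
    by rewrite ler_pdivlMr // qL -mulrzr lerD2l ler_pM2l // ltW ?floorD1_gt.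
  exists (phi + L *~ Num.floor q); last exact: rotD2pi.
  rewrite ler_ndivlMr ?lt_neqAle ?y0 //.
  by rewrite qL -mulrzr lerD2l ler_pM2l ?floor_le.
have t0 : 0 <= t / y by apply: le_trans tN.
pose j := Num.trunc (t / y).
have N0j : (N0 <= j)%N by rewrite truncn_ge_nat.
exists (j * n)%N; first by rewrite (leq_trans N0j) // leq_pmulr.
rewrite -ry -rt; apply: Hd; apply: le_trans (ltW yd).
rewrite -[t](divfK y0) -mulrBl normrM ler_piMl //.
have /andP[] := truncn_itv t0; rewrite -/j -natr1 => h1 h2.
by rewrite ler_norml; apply/andP; split; lra.
Qed.

(** The square of the Hilbert-Schmidt norm.  On SL_2 it is 2 cosh(d), where d is
    the distance by which the base point of the hyperbolic plane is moved. *)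
Definition hs (A : 'M[R]_2) : R :=
  A 0 0 ^+ 2 + A 0 1 ^+ 2 + (A 1 0 ^+ 2 + A 1 1 ^+ 2).

Lemma hs_mx2 a b c d : hs (mx2 a b c d) = a ^+ 2 + b ^+ 2 + (c ^+ 2 + d ^+ 2).
Proof. by rewrite /hs !mxE. Qed.

Lemma hs_rot A phi : hs (A *m rot phi) = hs A.
Proof.
rewrite [A]mx2E /rot mx2M !hs_mx2.
move: (A 0 0) (A 0 1) (A 1 0) (A 1 1) (cos2Dsin2 phi) => a b c d.
move: (cos phi) (sin phi) => x y xy.
transitivity ((a ^+ 2 + b ^+ 2 + (c ^+ 2 + d ^+ 2)) * (x ^+ 2 + y ^+ 2)).
  ring.
by rewrite xy mulr1.
Qed.

Lemma hsZ c A : hs (c *: A) = c ^+ 2 * hs A.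
Proof. by rewrite /hs !mxE; ring. Qed.

Lemma hs_ge_det A : 2 * \det A <= hs A.
Proof.
rewrite [A]mx2E det_mx2 hs_mx2 -subr_ge0.
move: (A 0 0) (A 0 1) (A 1 0) (A 1 1) => a b c d.
have -> : a ^+ 2 + b ^+ 2 + (c ^+ 2 + d ^+ 2) - 2 * (a * d - b * c) =
          (a - d) ^+ 2 + (b + c) ^+ 2 by ring.
by rewrite addr_ge0 ?sqr_ge0.
Qed.

Lemma rotate_vector (a b c d : R) : a ^+ 2 + b ^+ 2 = c ^+ 2 + d ^+ 2 ->
  exists phi, a = cos phi * c - sin phi * d /\ b = cos phi * d + sin phi * c.
Proof.
move=> abcd; have [cd0|cd0] := eqVneq (c ^+ 2 + d ^+ 2) 0.
  move: abcd; rewrite cd0 => /eqP; move/eqP: cd0.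
  rewrite !paddr_eq0 ?sqr_ge0 // !sqrf_eq0.
  move=> /andP[/eqP-> /eqP->] /andP[/eqP-> /eqP->].
  by exists 0; rewrite !mulr0 subrr addr0.
have [phi [Hc Hs]] : exists phi, cos phi = (a * c + b * d) / (c ^+ 2 + d ^+ 2)
    /\ sin phi = (b * c - a * d) / (c ^+ 2 + d ^+ 2).
  apply: angle_ex; rewrite !expr_div_n -mulrDl.
  have -> : (a * c + b * d) ^+ 2 + (b * c - a * d) ^+ 2 =
            (a ^+ 2 + b ^+ 2) * (c ^+ 2 + d ^+ 2) by ring.
  by rewrite abcd -expr2 divff // expf_neq0.
by exists phi; rewrite Hc Hs; split; field.
Qed.

(** Splitting a matrix into its conformal part z and anticonformal part zeta,
    left and right rotations act on z by the sum and on zeta by the difference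
    of the angles; the determinant and [hs] determine |z| and |zeta|. *)
Lemma rotation_double_coset A B : \det A = \det B -> hs A = hs B ->
  exists phi psi, A = rot phi *m B *m rot psi.
Proof.
rewrite [A]mx2E [B]mx2E !det_mx2 !hs_mx2.
move: (A 0 0) (A 0 1) (A 1 0) (A 1 1) => a b c d.
move: (B 0 0) (B 0 1) (B 1 0) (B 1 1) => a' b' c' d' dd hh.
have [p [pE1 pE2]] : exists phi,
    a + d = cos phi * (a' + d') - sin phi * (c' - b') /\
    c - b = cos phi * (c' - b') + sin phi * (a' + d').
  by apply: rotate_vector; lra.
have [q [qE1 qE2]] : exists phi,
    a - d = cos phi * (a' - d') - sin phi * (c' + b') /\
    c + b = cos phi * (c' + b') + sin phi * (a' - d').
  by apply: rotate_vector; lra.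
have [x [y [xp yq]]] : exists x y, p = x + y /\ q = x - y.
  by exists ((p + q) / 2), ((p - q) / 2); split; field.
rewrite {}xp {}yq in pE1 pE2 qE1 qE2; exists x, y; move: pE1 pE2 qE1 qE2.
rewrite !(cosD, sinD, cosN, sinN) /rot !mx2M => e1 e2 e3 e4.
apply: eq_mx2; rewrite !mxE /=; lra.
Qed.

End RotationOrbits.

(** * Half-turns of the hyperbolic plane *)

Section Circles.
Variable R : realType.
Implicit Types (g tau : 'M[R]_2).

(** The elements of SL_2 of trace zero are those acting on the hyperbolic plane
    as half-turns. *)
Definition half_turn tau := \det tau = 1 /\ tau 1 1 = - tau 0 0.

Lemma half_turnK tau : half_turn tau -> tau *m tau = - 1%:M.
Proof.
rewrite [tau]mx2E => -[]; rewrite det_mx2 !mxE /= mx2M mx2_1 mx2N.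
move: (tau 0 0) (tau 0 1) (tau 1 0) (tau 1 1) => a b c d dt td.
by rewrite td in dt *; congr mx2; rewrite -?dt; ring.
Qed.

(** In the hyperbolic plane SL_2 / SO_2 the two sides run over the circles about
    the image of the base point by [g] and about the base point, with a common
    radius; such circles meet when their centers are not too far apart.  The bound
    [q] comes from the largest distance between centers that two applications of
    [tau], with a turn in between, can realize. *)
Lemma circles_meet tau : half_turn tau -> 2 < hs tau ->
  exists2 q, 2 < q & forall g, \det g = 1 -> hs g <= q ->
    exists phi psi chi, g *m rot phi *m tau *m rot psi = rot chi *m tau.
Proof.
move=> ht; have [dt tt] := ht => ts.
(* [- tau *m rot k *m tau] joins the identity, at k = 0, to [- X], at a right
   angle. *)
pose X := tau *m mx2 0 (-1) 1 0 *m tau.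
have trX : X 1 1 = - X 0 0 /\ 2 < hs X.
  rewrite /X; move: dt tt ts.
  rewrite [tau]mx2E det_mx2 !hs_mx2 !mx2M hs_mx2 !mxE /=.
  move: (tau 0 0) (tau 0 1) (tau 1 0) (tau 1 1) => a b c d dt td.
  rewrite {}td in dt * => ts; split; first by ring.
  have bc : 0 < (b - c) ^+ 2 * ((b + c) ^+ 2 + 4 * a ^+ 2).
    apply: mulr_gt0.
      have -> : (b - c) ^+ 2 = (b + c) ^+ 2 + 4 * (a * a) + 4 by nra.
      by rewrite -expr2 ltr_wpDl // addr_ge0 ?sqr_ge0 // mulr_ge0 ?sqr_ge0.
    have -> : (b + c) ^+ 2 + 4 * a ^+ 2 = a ^+ 2 + b ^+ 2 + (c ^+ 2 + (- a) ^+ 2)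
       - 2 * (a * - a - b * c) by ring.
    by rewrite dt mulr1 subr_gt0.
  rewrite -subr_gt0; apply: (lt_le_trans bc); rewrite le_eqVlt; apply/orP; left.
  apply/eqP.
  have -> : (b - c) ^+ 2 * ((b + c) ^+ 2 + 4 * a ^+ 2) =
    ((a ^+ 2 + b ^+ 2) - (a ^+ 2 + c ^+ 2)) ^+ 2 + 4 * a ^+ 2 * (b - c) ^+ 2
    by ring.
  have E : (a ^+ 2 + b ^+ 2) * (a ^+ 2 + c ^+ 2) - a ^+ 2 * (b - c) ^+ 2 = 1.
    by transitivity ((a * - a - b * c) ^+ 2); [ring|rewrite dt expr1n].
  lra.
case: trX => trX X2; exists (hs X) => // g dg gX.
have X20 : 0 < hs X - 2 by rewrite subr_gt0.
have g2 : 2 <= hs g by have := hs_ge_det g; rewrite dg mulr1.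
pose s := Num.sqrt ((hs g - 2) / (hs X - 2)).
have s2 : s ^+ 2 * (hs X - 2) = hs g - 2.
  by rewrite sqr_sqrtr ?divfK ?gt_eqF // divr_ge0 ?subr_ge0 // ltW.
have s1 : s ^+ 2 <= 1.
  by rewrite -(ler_pM2r X20) mul1r s2 lerB.
have [k [Ck Sk]] : exists k, cos k = Num.sqrt (1 - s ^+ 2) /\ sin k = s.
  by apply: angle_ex; rewrite sqr_sqrtr ?subr_ge0 // subrK.
have tk : tau *m rot k *m (- tau) = (cos k)%:M - sin k *: X.
  have -> : rot k = (cos k)%:M + sin k *: mx2 0 (-1) 1 0.
    by rewrite mx2_scalar mx2Z mx2D; congr mx2; ring.
  rewrite mulmxN mulmxDr mulmxDl mul_mx_scalar -scalemxAl (half_turnK ht).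
  by rewrite -scalemxAr -scalemxAl -/X opprD scalerN opprK scalemx1.
(* The angle k was chosen to give [g] and this product the same [hs]. *)
have [phi [psi E]] : exists phi psi, g = rot phi *m (tau *m rot k *m (- tau)) *m rot psi.
  apply: rotation_double_coset.
    by rewrite mulmxN -scaleN1r detZ !det_mulmx !det_rot dt dg; ring.
  clearbody X; rewrite tk; move: trX s2; rewrite -Sk; move: (cos2Dsin2 k).
  rewrite [X]mx2E mx2_scalar mx2Z mx2N mx2D !hs_mx2 !mxE /=.
  move: (X 0 0) (X 0 1) (X 1 0) (X 1 1) (cos k) (sin k) (hs g) => a b c d x y h.
  move=> xy -> e.
  have -> : h = 2 * (x ^+ 2 + y ^+ 2) +
    y ^+ 2 * (a ^+ 2 + b ^+ 2 + (c ^+ 2 + (- a) ^+ 2) - 2) by rewrite e xy; ring.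
  ring.
exists (- psi), (- k), phi; rewrite E -!mulmxA; congr (_ *m _).
rewrite [rot psi *m _]mulmxA rotKN mul1mx [- tau *m _]mulmxA mulNmx.
by rewrite (half_turnK ht) opprK mul1mx rotKN mulmx1.
Qed.

(** The trace of [S *m rot beta] is a sinusoid in [beta], so it vanishes somewhere;
    the normalized matrix then has trace zero and determinant one. *)
Lemma half_turn_ex (S : 'M[R]_2) : 0 < \det S -> 2 * \det S < hs S ->
  exists2 beta, half_turn ((Num.sqrt (\det S))^-1 *: (S *m rot beta)) &
    2 < hs ((Num.sqrt (\det S))^-1 *: (S *m rot beta)).
Proof.
move=> dS hS; pose p := S 0 0 + S 1 1; pose r := S 1 0 - S 0 1.
have pr0 : 0 < p ^+ 2 + r ^+ 2.
  have -> : p ^+ 2 + r ^+ 2 = hs S + 2 * \det S.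
    by rewrite /p /r [S]mx2E det_mx2 hs_mx2 !mxE /=; ring.
  by rewrite addr_gt0 ?mulr_gt0 // (lt_trans _ hS) // mulr_gt0.
pose n := Num.sqrt (p ^+ 2 + r ^+ 2).
have n2 : n ^+ 2 = p ^+ 2 + r ^+ 2 by rewrite sqr_sqrtr // ltW.
have n0 : n != 0 by rewrite gt_eqF // sqrtr_gt0.
have [beta [Cb Sb]] : exists beta, cos beta = r / n /\ sin beta = p / n.
  by apply: angle_ex; rewrite !expr_div_n -mulrDl addrC -n2 divff // expf_neq0.
exists beta; last first.
  rewrite hsZ hs_rot exprVn sqr_sqrtr ?(ltW dS) // mulrC ltr_pdivlMr //.
split.
  rewrite detZ det_mulmx det_rot mulr1 exprVn sqr_sqrtr ?(ltW dS) //.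
  by rewrite mulVf // gt_eqF.
rewrite [LHS]mxE [X in - X]mxE -mulrN; congr (_ * _).
by rewrite !mxE !sum2E !mxE /= Cb Sb /p /r; field.
Qed.
End Circles.

(** * Continuous functions on the space of lattices *)

Section UniformContinuity.
Variable R : realType.
Implicit Types (A B g : 'M[R]_3) (f h : 'M[R]_3 -> R).

(** Functions on the space of lattices, seen as functions of a basis. *)
Definition lattice_function f :=
  (forall g (W : 'M[int]_3), \det g = 1 -> \det W = 1 ->
     f (g *m map_mx intr W) = f g) /\
  (forall g e, \det g = 1 -> 0 < e -> exists2 d, 0 < d &
     forall g', \det g' = 1 -> nrm (g' - g) <= d -> `|f g' - f g| <= e).

Let mcont h := forall A e, 0 < e -> exists2 d, 0 < d &
  forall B, nrm (B - A) <= d -> `|h B - h A| <= e.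

Let mcont_cst c : mcont (fun=> c).
Proof. by move=> A e e0; exists 1 => // B _; rewrite subrr normr0 ltW. Qed.

Let mcontD h1 h2 : mcont h1 -> mcont h2 -> mcont (fun A => h1 A + h2 A).
Proof.
move=> c1 c2 A e e0; have e20 : 0 < e / 2 by rewrite divr_gt0.
have [d1 d10 H1] := c1 A _ e20; have [d2 d20 H2] := c2 A _ e20.
exists (Num.min d1 d2) => [|B]; first by rewrite lt_min d10.
rewrite le_min => /andP[/H1 h1B /H2 h2B].
rewrite opprD addrACA; apply: le_trans (ler_normD _ _) _.
by rewrite [e]splitr lerD.
Qed.

Let mcontM h1 h2 : mcont h1 -> mcont h2 -> mcont (fun A => h1 A * h2 A).
Proof.
move=> c1 c2 A e e0.
pose M := `|h1 A| + `|h2 A| + 1; have M0 : 0 < M by rewrite ltr_wpDl.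
pose e1 := Num.min 1 (e / (2 * M)).
have e10 : 0 < e1 by rewrite lt_min ltr01 divr_gt0 // mulr_gt0.
have [d1 d10 H1] := c1 A _ e10; have [d2 d20 H2] := c2 A _ e10.
exists (Num.min d1 d2) => [|B]; first by rewrite lt_min d10.
rewrite le_min => /andP[/H1 h1B /H2 h2B].
have -> : h1 B * h2 B - h1 A * h2 A =
    (h1 B - h1 A) * h2 B + h1 A * (h2 B - h2 A) by ring.
apply: le_trans (ler_normD _ _) _; rewrite !normrM.
have h2M : `|h2 B| <= M.
  rewrite -[h2 B](subrK (h2 A)); apply: le_trans (ler_normD _ _) _.
  have : `|h2 B - h2 A| <= 1 by apply: le_trans h2B _; rewrite ge_min lexx.
  by have := normr_ge0 (h1 A); rewrite /M; lra.
have h1M : `|h1 A| <= M by rewrite /M -addrA lerDl addr_ge0.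
have -> : e = e / (2 * M) * M + M * (e / (2 * M)) by field; rewrite gt_eqF.
have E : e1 <= e / (2 * M) by rewrite ge_min lexx orbT.
by rewrite lerD // ler_pM // (le_trans _ E).
Qed.

Lemma det_cont : mcont determinant.
Proof.
have msum (I : Type) (s : seq I) (F : I -> 'M[R]_3 -> R) :
    (forall i, mcont (F i)) -> mcont (fun A => \sum_(i <- s) F i A).
  move=> cF; elim: s => [|i s IH].
    by under eq_fun do rewrite big_nil; exact: mcont_cst.
  by under eq_fun do rewrite big_cons; exact: mcontD.
have mprod (I : Type) (s : seq I) (F : I -> 'M[R]_3 -> R) :
    (forall i, mcont (F i)) -> mcont (fun A => \prod_(i <- s) F i A).
  move=> cF; elim: s => [|i s IH].
    by under eq_fun do rewrite big_nil; exact: mcont_cst.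
  by under eq_fun do rewrite big_cons; exact: mcontM.
apply: msum => s; apply: mcontM; first exact: mcont_cst.
apply: mprod => i A e e0; exists e => // B; apply: le_trans.
exact: entry_dist_le_nrm.
Qed.

(** Compactness of the bounded closed subsets of SL_3(R), in the form: a scale
    that can be chosen locally can be chosen uniformly. *)
Lemma SL3_local_uniform (Q : R -> 'M[R]_3 -> Prop) :
  (forall g, \det g = 1 -> exists2 d, 0 < d & forall x g', 0 < x <= d ->
     \det g' = 1 -> nrm (g' - g) <= d -> Q x g') ->
  forall rho, exists2 d, 0 < d & forall g, \det g = 1 -> nrm g <= rho -> Q d g.
Proof.
move=> locQ rho.
pose box := [set v : 'rV[R]_(3 * 3) | forall i, `[- rho, rho]%classic (v ord0 i)].
have cbox : compact box.
  apply: (@rV_compact R (3 * 3) (fun=> `[- rho, rho]%classic)) => _.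
  exact: segment_compact.
pose P d (v : 'rV[R]_(3 * 3)) :=
  \det (vec_mx v : 'M[R]_3) = 1 -> Q d (vec_mx v).
have nvec (v : 'rV[R]_(3 * 3)) : nrm (vec_mx v : 'M[R]_3) <= `|v| * 9.
  apply: nrm_le_entries => i j; rewrite mxE.
  rewrite [leRHS]mx_normrE.
  by apply: le_trans (le_bigmax _ _ (0, mxvec_index i j)).
have locP v : box v -> \forall v' \near v & d \near 0^'+, P d v'.
  move=> _; have [dv|dv] := eqVneq (\det (vec_mx v : 'M[R]_3)) 1.
    have [d d0 H] := locQ _ dv.
    exists (ball v (d / 9), [set d' | 0 < d' <= d]) => /=.
      split; first by apply: nbhsx_ballx; rewrite divr_gt0.
      near=> d'; apply/andP; split; first by near: d'; exact: nbhs_right_gt.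
      by near: d'; apply: nbhs_right_le.
    move=> [v' d'] /= [vv' dd'] dv'; apply: H => //.
    rewrite -raddfB; apply: le_trans (nvec _) _.
    by rewrite -ler_pdivlMr // distrC ltW //; move: vv'; rewrite -ball_normE.
  have dd : 0 < `|\det (vec_mx v : 'M[R]_3) - 1| / 2.
    by rewrite divr_gt0 // normr_gt0 subr_eq0.
  have [d d0 H] := @det_cont (vec_mx v) _ dd.
  exists (ball v (d / 9), setT) => /=.
    by split; [apply: nbhsx_ballx; rewrite divr_gt0|exact: filterT].
  move=> [v' d'] /= [vv' _] dv'; exfalso.
  have /H : nrm (vec_mx v' - vec_mx v : 'M[R]_3) <= d.
    rewrite -raddfB; apply: le_trans (nvec _) _.
    by rewrite -ler_pdivlMr // distrC ltW //; move: vv'; rewrite -ball_normE.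
  rewrite dv' distrC; apply/negP; rewrite -ltNge.
  by rewrite ltr_pdivrMr // ltr_pMr ?ltr1n // normr_gt0 subr_eq0.
have /compact_near_coveringP cov := cbox.
have H := cov _ _ _ _ locP.
have [d d0 Hd] : exists2 d, 0 < d & box `<=` P d.
  near (0 : R)^'+ => d; exists d; first by near: d; exact: nbhs_right_gt.
  by near: d; exact: H.
exists d => // g dg gr; rewrite -(mxvecK g).
apply: Hd => //; rewrite ?mxvecK // => k /=.
case/mxvec_indexP: k => i j; rewrite mxvecE in_itv /= -ler_norml.
exact: le_trans (entry_le_nrm _ _ _) gr.
Unshelve. all: by end_near.
Qed.

Lemma lattice_function_unif f : lattice_function f -> forall rho e, 0 < e ->
  exists2 d, 0 < d & forall g g', \det g = 1 -> \det g' = 1 ->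
    nrm g <= rho -> nrm (g' - g) <= d -> `|f g' - f g| <= e.
Proof.
move=> [_ fc] rho e e0.
have [|d d0 H] := @SL3_local_uniform (fun d g => forall g', \det g' = 1 ->
    nrm (g' - g) <= d -> `|f g' - f g| <= e) _ rho; last first.
  by exists d => // g g' *; apply: H.
move=> g dg; have [d d0 H] := fc _ _ dg (divr_gt0 e0 (ltr0n _ 2)).
exists (d / 2) => [|x g' /andP[x0 xd] dg' gg' g'' dg'' g'g''].
  by rewrite divr_gt0.
rewrite (splitr e) -(subrKA (f g)); apply: le_trans (ler_normD _ _) _.
apply: lerD; last by rewrite distrC H // (le_trans gg') // ler_pdivrMr // ler_pMr // ler1n.
apply: H => //; rewrite -(subrKA g'); apply: le_trans (nrmD _ _) _.
by rewrite (splitr d) lerD // (le_trans g'g'').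
Qed.

Lemma lattice_function_bounded f : lattice_function f -> forall rho,
  exists M, forall g, \det g = 1 -> nrm g <= rho -> `|f g| <= M.
Proof.
move=> [_ fc] rho.
have [|d d0 H] := @SL3_local_uniform (fun d g => `|f g| <= d^-1) _ rho; last first.
  by exists d^-1.
move=> g dg; have [d d0 H] := fc _ _ dg ltr01.
exists (Num.min d (`|f g| + 1)^-1) => [|x g' /andP[x0]].
  by rewrite lt_min d0 invr_gt0 ltr_wpDl.
rewrite !le_min => /andP[_ xf] dg' /andP[/(H _ dg') h _].
have {}xf : `|f g| + 1 <= x^-1.
  by rewrite -[leLHS]invrK lef_pV2 ?posrE ?invr_gt0 // ltr_wpDl.
apply: le_trans xf; rewrite -[f g'](subrK (f g)) addrC.
by apply: le_trans (ler_normD _ _) _; rewrite lerD2l.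
Qed.

End UniformContinuity.

(** * Limits of successive changes of a point *)

Section Steering.
Variables (R : realType) (f : 'M[R]_3 -> R).
Hypothesis f_lat : lattice_function f.
Implicit Types (x y z : 'cV[R]_2) (t d e A lo hi : R).

Definition orbit_fun x t := f (flow_mx t *m Hr x).

Lemma det_flow t : \det (flow_mx t : 'M[R]_3) = 1.
Proof. by rewrite flow_mxE det_Dg // det_scalar exprn_gt0 ?expR_gt0. Qed.

Lemma nrm_flow t T : 0 <= t <= T -> nrm (flow_mx t : 'M[R]_3) <= 1 + expR T * 2.
Proof.
move=> /andP[t0 tT]; rewrite flow_mxE nrm_bk !nrm0 addr0 add0r det_scalar.
rewrite nrm_scalar !ger0_norm ?invr_ge0 ?exprn_ge0 ?expR_ge0 //.
apply: lerD; last by rewrite ler_wpM2r // ler_expR.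
rewrite invf_le1 ?exprn_gt0 ?expR_gt0 // exprn_ege1 //.
by rewrite -expR0 ler_expR.
Qed.

(** Over a bounded time a small change of the starting point is invisible, which
    is what allows infinitely many changes to be superposed. *)
Lemma orbit_fun_near x T e : 0 < e -> exists2 d, 0 < d &
  forall x', nrm (x' - x) <= d -> forall t, 0 <= t <= T ->
    `|orbit_fun x' t - orbit_fun x t| <= e.
Proof.
move=> e0; set M := 1 + expR T * 2.
have M0 : 0 < M by rewrite addr_gt0 // mulr_gt0 ?expR_gt0.
have [d d0 H] := lattice_function_unif f_lat (M * nrm (Hr x)) e0.
exists (d / M) => [|x' xx' t tT]; first by rewrite divr_gt0.
apply: H; rewrite ?det_mulmx ?det_flow ?det_Hr ?mulr1 //.
  by apply: le_trans (nrmM _ _) _; rewrite ler_wpM2r ?nrm_ge0 ?nrm_flow.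
rewrite -mulmxBr; apply: le_trans (nrmM _ _) _.
rewrite !HrE bkB !subrr nrm_bk !nrm0 normr0 !add0r addr0 opprK addrC nrmBC.
rewrite mulrC; move: xx'; rewrite ler_pdivlMr //; apply: le_trans.
by rewrite ler_wpM2l ?nrm_ge0 ?nrm_flow.
Qed.

(** Arbitrarily small changes of a point of [P] lead to a point of [P'], so
    that the observable along the new orbit stays below [hi] from a time on that
    does not depend on the size of the change, and later exceeds [lo].  The
    target [z] to avoid makes the set of limits uncountable. *)
Definition leads (P P' : 'cV[R]_2 -> Prop) lo hi := forall x, P x ->
  exists2 t0, 0 <= t0 & forall d t1 z, 0 < d -> exists x',
    [/\ P' x', nrm (x' - x) <= d, x' != z,
        forall t, t0 <= t -> orbit_fun x' t <= hi
      & exists2 t, t1 <= t & lo <= orbit_fun x' t].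

(** The second change is made so small, after the first has been fixed, that it
    affects neither the peak found by the first nor the time before the bound of the
    second takes over; each costs at most [e]. *)
Lemma leads_comp P P' P'' lo lo' hi e : 0 < e -> leads P P' lo hi ->
  leads P' P'' lo' hi -> leads P P'' (Num.max lo lo' - e) (hi + e).
Proof.
move=> e0 L L' x /L[t0 t00 {}L]; exists t0 => // d t1 z d0.
have [x1 [/L'[t0' t0'0 {}L'] x1x x1z x1hi [t t1t xlo]]] :=
  L (d / 2) (Num.max t1 0) z (divr_gt0 d0 (ltr0n _ 2)).
have [d' d'0 near_x1] := @orbit_fun_near x1 (Num.max t t0') e e0.
have dm0 : 0 < Num.min (Num.min d' (d / 2)) (nrm (x1 - z) / 2).
  by rewrite !lt_min d'0 !divr_gt0 // nrm_gt0 subr_eq0.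
have [x2 [P2 x2x1 _ x2hi [t' t1t' x2lo]]] := L' _ t1 z dm0.
move: x2x1; rewrite !le_min => /andP[/andP[x2d' x2d] x2z].
have t_ge0 : 0 <= t by apply: le_trans t1t; rewrite le_max lexx orbT.
exists x2; split=> //.
- rewrite -(subrKA x1) (splitr d).
  by apply: le_trans (nrmD _ _) _; rewrite lerD.
- apply/eqP => x2E; move: x2z; rewrite x2E nrmBC; apply/negP; rewrite -ltNge.
  by rewrite ltr_pdivrMr // ltr_pMr ?ltr1n // nrm_gt0 subr_eq0.
- move=> s t0s; have [sle|/ltW sge] := lerP s t0'; last first.
    by rewrite (le_trans (x2hi _ sge)) // lerDl ltW.
  have /ler_normlW : `|orbit_fun x2 s - orbit_fun x1 s| <= e.
    by apply: near_x1; rewrite // le_max sle orbT andbT (le_trans t00).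
  by have := x1hi _ t0s; lra.
- have [lolo|lolo] := lerP lo' lo; last first.
    by exists t'; rewrite // (le_trans _ x2lo) // lerBlDr lerDl ltW.
  exists t; first by move: t1t; rewrite ge_max => /andP[].
  have : `|orbit_fun x2 t - orbit_fun x1 t| <= e.
    by apply: near_x1; rewrite // t_ge0 le_max lexx.
  by rewrite ler_norml => /andP[]; lra.
Qed.

Lemma leadsW P P' Q Q' lo hi lo' hi' : (forall x, Q x -> P x) ->
  (forall x, P' x -> Q' x) -> lo' <= lo -> hi <= hi' ->
  leads P P' lo hi -> leads Q Q' lo' hi'.
Proof.
move=> QP P'Q' lol hih L x /QP/L[t0 t00 {}L]; exists t0 => // d t1 z d0.
have [x' [Px' xx' xz xhi [t tt1 tlo]]] := L d t1 z d0.
exists x'; split=> //; first exact: P'Q'.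
- by move=> s /xhi /le_trans; apply.
- by exists t; rewrite // (le_trans lol).
Qed.

(** Successive changes are kept inside nested balls, the ball of stage [j] being
    so small that the bounds and the peaks obtained at that stage hold for all its
    points; the common point of the balls has upper limit [A] and, as stage [j]
    avoids [z j], it differs from all of these. *)
Lemma leads_limit (P : nat -> 'cV[R]_2 -> Prop) A (z : nat -> 'cV[R]_2) :
  (forall j, leads (P j) (P j.+1) (A - j.+1%:R^-1) (A + j.+1%:R^-1)) ->
  (exists x, P 0 x) ->
  exists x, [/\ forall j, x != z j,
    forall e, 0 < e -> exists t0, forall t, t0 <= t -> orbit_fun x t <= A + e
  & forall e t0, 0 < e -> exists2 t, t0 <= t & A - e <= orbit_fun x t].
Proof.
move=> L [x0 Px0].
pose e j : R := j.+1%:R^-1.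
have e0 j : 0 < e j by rewrite invr_gt0.
(* A stage records a point, the radius of the ball about it, and the time from
   which the bound of the next stage holds. *)
pose node : Type := 'cV[R]_2 * R * R.
pose Inv j (n : node) := let: (x, r, t0) := n in
  [/\ 0 < r, 0 <= t0 & forall d t1 z, 0 < d -> exists x',
    [/\ P j.+1 x', nrm (x' - x) <= d, x' != z,
        forall t, t0 <= t -> orbit_fun x' t <= A + e j
      & exists2 t, t1 <= t & A - e j <= orbit_fun x' t]].
pose Rel j (n n' : node) := let: (x, r, t0) := n in let: (x', r', t0') := n' in
  [/\ nrm (x' - x) <= r / 2, r' <= r / 2, j%:R <= t0' &
      forall y, nrm (y - x') <= r' * 2 -> [/\ y != z j,
        forall t, t0 <= t <= t0' -> orbit_fun y t <= A + e j * 2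
      & exists2 t, j%:R <= t & A - e j * 2 <= orbit_fun y t]].
have step j n : Inv j n -> {n' | Inv j.+1 n' /\ Rel j n n'}.
  move=> In; apply: cid; case: n In => [[x r] t0] [r0 t00 H].
  have [x' [Px' xx' xz xhi [t tj tlo]]] := H (r / 2) j%:R (z j) (divr_gt0 r0 (ltr0n _ 2)).
  have [t0' t0'0 H'] := L _ _ Px'.
  pose t2 := Num.max t0' j%:R.
  have [d d0 near_x'] := @orbit_fun_near x' (Num.max t t2) (e j) (e0 j).
  pose r' := Num.min (Num.min (d / 2) (r / 2)) (nrm (x' - z j) / 4).
  have r'0 : 0 < r' by rewrite !lt_min !divr_gt0 // nrm_gt0 subr_eq0.
  have [r'd r'r r'z] : [/\ r' * 2 <= d, r' <= r / 2 & r' * 4 <= nrm (x' - z j)].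
    by rewrite -!ler_pdivlMr // !ge_min !lexx !orbT.
  exists (x', r', t2); split.
    split=> // [|d' t1 z' d'0]; first by rewrite le_max t0'0.
    have [x2 [P2 x2x' x2z' x2hi x2lo]] := H' d' t1 z' d'0.
    exists x2; split=> // s; rewrite ge_max => /andP[s1 s2]; exact: x2hi.
  split=> //; first by rewrite le_max lexx orbT.
  move=> y yr; have yd := le_trans yr r'd; split.
  - apply/eqP => yz; move: yr; rewrite yz nrmBC; apply/negP; rewrite -ltNge.
    by apply: lt_le_trans r'z; rewrite ltr_pM2l // ltr_nat.
  - move=> s /andP[ts st].
    have /(near_x' _ yd)/ler_normlW : 0 <= s <= Num.max t t2.
      by rewrite (le_trans t00 ts) le_max st orbT.
    by have := xhi _ ts; lra.
  - exists t => //; have := near_x' _ yd t.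
    rewrite (le_trans _ tj) // le_max lexx => /(_ isT).
    by rewrite ler_norml => /andP[]; lra.
have [n0 In0] : {n | Inv 0%N n}.
  apply: cid; have [t0 t00 H] := L _ _ Px0; exists (x0, 1, t0); by split.
pose s := fix s j : {n | Inv j n} := match j with
  | 0 => exist _ n0 In0
  | j'.+1 => let: exist n In := s j' in
             let: exist n' (conj In' _) := step j' n In in exist _ n' In'
  end.
pose X j := (sval (s j)).1.1; pose r j := (sval (s j)).1.2.
pose T j := (sval (s j)).2.
have sE j : sval (s j) = (X j, r j, T j) by rewrite /X /r /T; case: sval => [[]].
have r0 j : 0 < r j by have := svalP (s j); rewrite sE => -[].
have RelS j : Rel j (X j, r j, T j) (X j.+1, r j.+1, T j.+1).
  rewrite -!sE /=; case: (s j) => n In /=.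
  by case: (step j n In) => n' [].
have dX j k : nrm (X (j + k)%N - X j) <= r j - r (j + k)%N.
  elim: k => [|k IH]; first by rewrite addn0 !subrr nrm0.
  rewrite addnS -(subrKA (X (j + k)%N)); apply: le_trans (nrmD _ _) _.
  by have [] := RelS (j + k)%N; have := r0 (j + k)%N; lra.
have XX j k i : X k i 0 - r k <= X j i 0 + r j.
  have h l m : nrm (X l - X m) <= r m - r l -> `|X l i 0 - X m i 0| <= r m - r l.
    exact/le_trans/entry_dist_le_nrm.
  have := r0 j; have := r0 k; have [jk|/ltnW jk] := leqP j k.
    have := dX j (k - j)%N; rewrite subnKC // => /h.
    by rewrite ler_norml => /andP[]; lra.
  have := dX k (j - k)%N; rewrite subnKC // => /h.
  by rewrite ler_norml => /andP[]; lra.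
(* The common point of the nested balls. *)
pose x : 'cV[R]_2 := \col_i sup (range (fun k => X k i 0 - r k)).
have xX j : nrm (x - X j) <= r j * 2.
  have -> : 2 = (2 * 1)%:R :> R by [].
  apply: nrm_le_entries => i l; rewrite ord1 !mxE.
  have hs : has_sup (range (fun k => X k i 0 - r k)).
    split; first by exists (X 0%N i 0 - r 0%N); exists 0%N.
    by exists (X 0%N i 0 + r 0%N) => _ [k _ <-].
  have h1 : sup (range (fun k => X k i 0 - r k)) <= X j i 0 + r j.
    by apply: ge_sup; [case: hs|move=> _ [k _ <-]].
  have h2 : X j i 0 - r j <= sup (range (fun k => X k i 0 - r k)).
    by apply: ub_le_sup; [case: hs|exists j].
  by rewrite ler_norml; apply/andP; split; lra.
have e_small d : 0 < d -> exists J, forall j, (J <= j)%N -> e j * 2 <= d.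
  move=> d0; exists (Num.trunc (2 / d)) => j Jj.
  rewrite mulrC ler_pdivrMr // -ler_pdivrMl // mulrC ltW //.
  by apply: lt_le_trans (truncnS_gt _) _; rewrite ler_nat.
exists x; split.
- by move=> j; have [_ _ _ /(_ _ (xX j.+1))[]] := RelS j.
- move=> d /e_small[J HJ]; exists (T J) => t TJt.
  have ex : exists j, t <= T (J + j).+1.
    exists (Num.trunc t).+1; have [_ _ + _] := RelS (J + (Num.trunc t).+1)%N.
    apply: le_trans; apply/ltW/(lt_le_trans (truncnS_gt _)).
    by rewrite ler_nat leq_addl.
  have [k tk kmin] := ex_minnP ex.
  have Tk : T (J + k)%N <= t.
    case: {tk} k kmin => [|k' kmin]; first by rewrite addn0.
    by rewrite leNgt addnS; apply/negP => /ltW /kmin; rewrite ltnn.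
  have [_ _ _ /(_ _ (xX _))[_ + _]] := RelS (J + k)%N.
  by move=> /(_ t); rewrite Tk tk => /(_ isT) /le_trans; apply; rewrite lerD2l HJ ?leq_addr.
- move=> d t0 /e_small[J HJ]; pose j := maxn J (Num.trunc t0).+1.
  have [_ _ _ /(_ _ (xX _))[_ _ [t jt tlo]]] := RelS j.
  exists t; last by apply: le_trans tlo; rewrite lerB // HJ // leq_maxl.
  apply: le_trans jt; apply/ltW/(lt_le_trans (truncnS_gt _)).
  by rewrite ler_nat leq_maxr.
Qed.

End Steering.

(** * Lattices with a cyclic symmetry *)

Section Frames.
Variable R : realType.

(** A power of the symmetry multiplies the basis by a scalar, that is a time of
    the flow, and by a rotation, both read off the exponent. *)
Lemma symmetry_pow (g : 'M[R]_3) (c : 'M[int]_3) (b t : R) : \det c = 1 ->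
  g *m map_mx intr c = Dg (b^-1 *: rot t) *m g -> forall N,
  exists2 C : 'M[int]_3, \det C = 1 &
    g *m map_mx intr C = Dg (b ^- N *: rot (N%:R * t)) *m g.
Proof.
move=> c1 cE; elim=> [|N [C C1 CE]].
  by exists 1%:M; rewrite ?det1 // map_mx1 mulmx1 mul0r rot0 invr1 scale1r Dg1 mul1mx.
exists (C *m c); first by rewrite det_mulmx C1 c1 mulr1.
rewrite map_mxM mulmxA CE -mulmxA cE mulmxA -DgM -scalemxAr -scalemxAl scalerA.
by rewrite -rotD -natr1 mulrDl mul1r exprS invfM.
Qed.

(** A lattice [g0 Z^3] with an automorphism [cyc] that acts as a negative time of
    the flow composed with a rotation of infinite order, so that its orbit under the
    similarities of the centralizer is a compact torus.  A second automorphism [gam]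
    moves the contracted coordinate axis, whence the condition on [vv]; the last
    field makes the resulting change of centralizer coordinate a motion of the
    hyperbolic plane that does not fix the base point. *)
Record frame := Frame {
  g0 : 'M[R]_3; cyc : 'M[int]_3; beta : R; theta : R;
  gam : 'M[int]_3; dd : R; ee : 'rV[R]_2; vv : 'cV[R]_2; DD : 'M[R]_2;
  det_g0 : \det g0 = 1;
  det_cyc : \det cyc = 1;
  beta_gt1 : 1 < beta;
  theta_irr : forall n, (0 < n)%N -> rot (n%:R * theta) <> 1%:M;
  cycE : g0 *m map_mx intr cyc = Dg (beta^-1 *: rot theta) *m g0;
  det_gam : \det gam = 1;
  gamE : g0 *m map_mx intr gam = bk dd ee vv DD *m g0;
  dd_gt0 : 0 < dd;
  vv_neq0 : vv != 0;
  schur_nonconformal :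
    2 * \det (DD - dd^-1 *: (vv *m ee)) < hs (DD - dd^-1 *: (vv *m ee))
}.

Variable F : frame.
Implicit Types (u : 'rV[R]_2) (m : 'M[R]_2).

Lemma det_map_intr (W : 'M[int]_3) : \det W = 1 -> \det (map_mx intr W : 'M[R]_3) = 1.
Proof. by move=> W1; rewrite det_map_mx W1. Qed.

Lemma beta_gt0 : 0 < beta F.
Proof. exact: lt_trans ltr01 (beta_gt1 F). Qed.

Lemma beta_unbounded a : exists N0, forall N, (N0 <= N)%N -> a <= beta F ^+ N.
Proof.
have b0 : 0 < beta F - 1 by rewrite subr_gt0 beta_gt1.
exists (Num.trunc (a / (beta F - 1))).+1 => N HN.
have h : 1 + (beta F - 1) *+ N <= beta F ^+ N.
  elim: N {HN} => [|N IH]; first by rewrite mulr0n addr0 expr0.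
  rewrite exprS mulrSr addrA; apply: le_trans (_ : beta F * (1 + (beta F - 1) *+ N) <= _).
    have := mulrn_wge0 N (ltW b0); set y := _ *+ N; nra.
  by rewrite ler_pM2l ?beta_gt0.
apply: le_trans h; rewrite -[_ *+ N]mulr_natl -[leLHS](@divfK _ (beta F - 1)) ?gt_eqF //.
rewrite ler_wpDl // ler_pM2r // ltW // (lt_le_trans (truncnS_gt _)) //.
by rewrite ler_nat.
Qed.

Lemma cyc_pow N : exists2 C : 'M[int]_3, \det C = 1 &
  g0 F *m map_mx intr C = Dg (beta F ^- N *: rot (N%:R * theta F)) *m g0 F.
Proof. exact: symmetry_pow (det_cyc F) (cycE F) N. Qed.

(** Powers of the symmetry, in both directions, form a geometric progression of
    ratio [beta]; this is the compactness of the torus. *)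
Lemma cyc_scale c : 0 < c -> exists (C : 'M[int]_3) s phi,
  [/\ \det C = 1, 1 <= s <= beta F &
      g0 F *m map_mx intr C = Dg ((s / c) *: rot phi) *m g0 F].
Proof.
move=> c0; have b0 := beta_gt0; have bn N : 0 < beta F ^+ N by rewrite exprn_gt0.
have inv (C : 'M[int]_3) a phi : 0 < a -> \det C = 1 ->
    g0 F *m map_mx intr C = Dg (a *: rot phi) *m g0 F ->
    \det (invmx C) = 1 /\
    g0 F *m map_mx intr (invmx C) = Dg (a^-1 *: rot (- phi)) *m g0 F.
  move=> a0 C1 CE; have uC : C \in unitmx by rewrite unitmxE C1 unitr1.
  split; first by rewrite det_inv C1 invr1.
  pose P := Dg (a *: rot phi); pose Q := Dg (a^-1 *: rot (- phi)).
  have QP : Q *m P = 1%:M.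
    by rewrite -DgM -scalemxAl -scalemxAr scalerA mulVf ?gt_eqF // rotNK scale1r Dg1.
  rewrite -[g0 F in LHS]mul1mx -QP -!mulmxA [P *m (_ *m _)]mulmxA -CE -mulmxA.
  by rewrite -map_mxM mulmxV // map_mx1 mulmx1.
have pick a : 1 <= a -> exists N, beta F ^+ N <= a < beta F ^+ N.+1.
  move=> a1; have ex : exists N, a < beta F ^+ N.+1.
    have [N /(_ N (leqnn N)) aN] := beta_unbounded (a + 1); exists N.
    apply: (@lt_le_trans _ _ (a + 1)); first by rewrite ltrDl.
    by apply: le_trans aN _; rewrite ler_eXn2l ?beta_gt1.
  have [N aN Nmin] := ex_minnP ex; exists N; rewrite aN andbT.
  case: N {aN} Nmin => [|N] Nmin; first by rewrite expr0.
  by rewrite leNgt; apply/negP => /Nmin; rewrite ltnn.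
have [c1|/ltW c1] := lerP c 1.
  have c1' : 1 <= c^-1 by rewrite invf_ge1.
  have [N /andP[N1 N2]] := pick _ c1'; have [C C1 CE] := cyc_pow N.+1.
  have [|Ci1 CiE] := inv _ _ _ _ C1 CE; first by rewrite invr_gt0.
  exists (invmx C), (c * beta F ^+ N.+1), (- (N.+1%:R * theta F)); split=> //.
    rewrite mulrC -ler_pdivrMr // div1r (ltW N2) exprS mulrC mulrCA.
    by rewrite ler_piMr ?(ltW b0) // mulrC -ler_pdivlMr // div1r.
  by rewrite CiE invrK mulrAC divff ?gt_eqF // mul1r.
have [N /andP[N1 N2]] := pick _ c1; have [C C1 CE] := cyc_pow N.
exists C, (c / beta F ^+ N), (N%:R * theta F); split=> //.
  by rewrite ler_pdivlMr // mul1r N1 ler_pdivrMr // -exprS ltW.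
by rewrite CE mulrAC divff ?gt_eqF // mul1r.
Qed.

End Frames.

(** * Renewals *)

Section Perturbation.
Variables (R : realType) (F : frame R).
Implicit Types (u : 'rV[R]_2) (m : 'M[R]_2).

(** The blocks of [gam] seen after a translation by [Ur u]: [au u] and [eu u] form
    its first row, [Hr (wu u)] clears the rest of its first column, and the Schur
    complement [Su u] is what is left on the expanded plane. *)
Definition au u := dd F + (u *m vv F) 0 0.
Definition wu u := (au u)^-1 *: vv F.
Definition eu u := ee F + u *m DD F.
Definition Su u := DD F - wu u *m eu u.

Lemma au0 : au 0 = dd F. Proof. by rewrite /au mul0mx mxE addr0. Qed.
Lemma eu0 : eu 0 = ee F. Proof. by rewrite /eu mul0mx addr0. Qed.

(** The Gauss elimination behind the construction: a translate of the lattice by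
    [Hr] is, in another basis, the image of the same lattice by the centralizer
    element with lower block [Su u], up to contracted terms. *)
Lemma renewal u : au u != 0 ->
  Hr (wu u) *m Ur u *m g0 F *m map_mx intr (gam F) =
  bk (au u) (eu u) 0 (Su u) *m g0 F.
Proof.
move=> a0; rewrite -[LHS]mulmxA gamE mulmxA; congr (_ *m _).
have z00 : (0 : 'M[R]_1) 0 0 = 0 by rewrite mxE.
rewrite -mulmxA /Ur bkM HrE bkM !mul0mx !mul1mx z00 addr0 !mul1r !scale1r -/(au u).
rewrite -/(eu u) ?mulmx1 ?scale0r ?scaler0 ?add0r ?addr0.
congr bk => //.
  by rewrite scalerN scalerA divff // scale1r addNr.
by rewrite mulNmx addrC.
Qed.

Lemma det_Su u : au u != 0 -> \det (Su u) = (au u)^-1.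
Proof.
move=> a0; have := congr1 determinant (renewal a0).
rewrite !det_mulmx det_Hr det_Ur det_g0 det_bk_ub (det_map_intr R (det_gam F)) !mulr1.
by move=> E; apply: (mulfI a0); rewrite -E divff.
Qed.

Lemma nrm_entry11 (A : 'M[R]_1) : `|A 0 0| = nrm A.
Proof. by rewrite /nrm !big_ord1. Qed.

(** The data of a renewal depend on [u] in a Lipschitz way near 0.  The constants are
    explicit because all the later error estimates are linear in [u]. *)
Lemma perturbation_lipschitz : exists2 K, 1 <= K & exists2 eta, 0 < eta &
  forall u, nrm u <= eta -> dd F / 2 <= au u /\
    [/\ `|au u - dd F| <= K * nrm u, nrm (eu u - ee F) <= K * nrm u,
        nrm (wu u - wu 0) <= K * nrm u, nrm (Su u - Su 0) <= K * nrm u &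
        nrm (Num.sqrt (au u) *: Su u - Num.sqrt (dd F) *: Su 0) <= K * nrm u].
Proof.
have d0 := dd_gt0 F; set d := dd F in d0 *.
pose V := nrm (vv F); pose E := nrm (ee F); pose D := nrm (DD F).
have V0 : 0 <= V := nrm_ge0 _; have E0 : 0 <= E := nrm_ge0 _.
have D0 : 0 <= D := nrm_ge0 _; pose S0 := nrm (Su 0).
have S00 : 0 <= S0 := nrm_ge0 _.
have sd0 : 0 < Num.sqrt d by rewrite sqrtr_gt0.
pose C1 := 2 / (d * d) * V * V.
have C10 : 0 <= C1 by rewrite !mulr_ge0 // invr_ge0 mulr_ge0 ?ltW.
pose C2 := C1 * (E + D) + V / d * D.
have C20 : 0 <= C2 by apply: addr_ge0; rewrite mulr_ge0 ?addr_ge0 ?divr_ge0 // ltW.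
pose C3 := Num.sqrt (d + d) * C2 + V / Num.sqrt d * S0.
have C30 : 0 <= C3.
  by apply: addr_ge0; rewrite mulr_ge0 ?divr_ge0 ?sqrtr_ge0.
exists (1 + V + D + C1 + C2 + C3); first by lra.
exists (Num.min 1 (d / (2 * (V + 1)))) => [|u].
  by rewrite lt_min ltr01 divr_gt0 ?mulr_gt0 ?ltr_wpDl.
rewrite le_min => /andP[u1 uV]; have u0 : 0 <= nrm u := nrm_ge0 _.
have uv : `|au u - d| <= nrm u * V.
  by rewrite /au addrC addKr nrm_entry11 nrmM.
have uvd : nrm u * V <= d / 2.
  have := ler_wpM2r (ltW (ltr_wpDl V0 ltr01)) uV.
  rewrite invfM mulrA divfK ?gt_eqF ?ltr_wpDl //; nra.
have au_ge : d / 2 <= au u.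
  by have := le_trans uv uvd; rewrite ler_norml => /andP[]; lra.
have au_gt0 : 0 < au u by apply: lt_le_trans au_ge; rewrite divr_gt0.
have au_le : au u <= d + d.
  by have := le_trans uv uvd; rewrite ler_norml => /andP[_]; lra.
have eu_le : nrm (eu u - ee F) <= nrm u * D.
  by rewrite /eu addrC addKr nrmM.
have wu_le : nrm (wu u - wu 0) <= nrm u * C1.
  rewrite /wu -scalerBl nrmZ au0 -/d -/V.
  have -> : (au u)^-1 - d^-1 = (d - au u) * (au u * d)^-1.
    by field; rewrite !gt_eqF.
  rewrite normrM distrC (ger0_norm (_ : 0 <= (au u * d)^-1)); last first.
    by rewrite invr_ge0 mulr_ge0 ?ltW.
  have h : (au u * d)^-1 <= 2 / (d * d).
    rewrite -[leLHS]div1r ler_pdivrMr ?mulr_gt0 //.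
    have -> : 2 / (d * d) * (au u * d) = au u / (d / 2) by field; rewrite gt_eqF.
    by rewrite ler_pdivlMr ?divr_gt0 // mul1r.
  rewrite /C1; apply: (@le_trans _ _ (nrm u * V * (2 / (d * d)) * V)); last first.
    by rewrite le_eqVlt; apply/orP; left; apply/eqP; ring.
  by rewrite ler_wpM2r // ler_pM // invr_ge0 mulr_ge0 ?ltW.
have w0_le : nrm (wu 0) <= V / d.
  by rewrite /wu nrmZ au0 ger0_norm ?invr_ge0 ?(ltW d0) // mulrC.
have eu_nrm : nrm (eu u) <= E + D.
  apply: le_trans (nrmD _ _) _; rewrite lerD2l; apply: le_trans (nrmM _ _) _.
  by rewrite ler_piMl.
have Su_le : nrm (Su u - Su 0) <= nrm u * C2.
  have -> : Su u - Su 0 = (wu 0 - wu u) *m eu u - wu 0 *m (eu u - ee F).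
    rewrite /Su mulmxBl mulmxBr eu0.
    move: (wu u *m eu u) (wu 0 *m ee F) (wu 0 *m eu u) => a b c.
    by apply/matrixP => k l; rewrite !mxE; ring.
  apply: le_trans (nrmB _ _) _.
  have h1 := nrmM (wu 0 - wu u) (eu u); have h2 := nrmM (wu 0) (eu u - ee F).
  rewrite nrmBC in wu_le.
  have h3 : nrm (wu 0 - wu u) * nrm (eu u) <= nrm u * C1 * (E + D).
    by rewrite ler_pM ?nrm_ge0.
  have h4 : nrm (wu 0) * nrm (eu u - ee F) <= V / d * (nrm u * D).
    by rewrite ler_pM ?nrm_ge0.
  rewrite /C2; move: (V / d) h4 => Vd h4; lra.
have sq_le : `|Num.sqrt (au u) - Num.sqrt d| <= nrm u * (V / Num.sqrt d).
  rewrite mulrA ler_pdivlMr //; apply: le_trans uv.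
  have -> : au u - d = (Num.sqrt (au u) - Num.sqrt d) * (Num.sqrt (au u) + Num.sqrt d).
    by rewrite -subr_sqr !sqr_sqrtr // ltW.
  rewrite normrM ler_wpM2l // ger0_norm ?addr_ge0 ?sqrtr_ge0 //.
  by rewrite lerDr sqrtr_ge0.
have S_le : nrm (Num.sqrt (au u) *: Su u - Num.sqrt d *: Su 0) <= nrm u * C3.
  have -> : Num.sqrt (au u) *: Su u - Num.sqrt d *: Su 0 =
      Num.sqrt (au u) *: (Su u - Su 0) + (Num.sqrt (au u) - Num.sqrt d) *: Su 0.
    move: (Su u) (Su 0) => A B.
    by apply/matrixP => k l; rewrite !mxE; ring.
  apply: le_trans (nrmD _ _) _; rewrite !nrmZ (ger0_norm (sqrtr_ge0 _)).
  have h1 : Num.sqrt (au u) * nrm (Su u - Su 0) <= Num.sqrt (d + d) * (nrm u * C2).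
    by rewrite ler_pM ?nrm_ge0 ?sqrtr_ge0 // ler_wsqrtr.
  have h2 := ler_wpM2r S00 sq_le; rewrite /C3 -/S0.
  move: (V / Num.sqrt d) h2 => Vd h2; lra.
split=> //; split.
- by apply: le_trans uv _; rewrite mulrC ler_wpM2r //; lra.
- by apply: le_trans eu_le _; rewrite mulrC ler_wpM2r //; lra.
- by apply: le_trans wu_le _; rewrite mulrC ler_wpM2r //; lra.
- by apply: le_trans Su_le _; rewrite mulrC ler_wpM2r //; lra.
- by apply: le_trans S_le _; rewrite mulrC ler_wpM2r //; lra.
Qed.

End Perturbation.

(** * Tracking of homoclinic orbits *)

Section Tracking.
Variables (R : realType) (F : frame R).
Implicit Types (u : 'rV[R]_2) (m : 'M[R]_2) (w : 'cV[R]_2).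

Lemma det_scale2 (c : R) m : \det m = 1 -> \det (c *: m) = c ^+ 2.
Proof. by move=> dm; rewrite detZ dm mulr1. Qed.

(** A basis of bounded size for times when [c <= 1]: the [Hr] part has not yet been
    expanded, and the symmetry brings the scale to [s]. *)
Lemma representative_in c s phi (C : 'M[int]_3) m w u : 0 < c -> 0 < s ->
  \det m = 1 ->
  g0 F *m map_mx intr C = Dg ((s / c) *: rot phi) *m g0 F ->
  Dg (c *: m) *m Hr w *m Ur u *m g0 F *m map_mx intr C =
  Hr (c ^+ 3 *: (m *m w)) *m Ur (c ^- 3 *: (u *m invmx m)) *m
  Dg (s *: (m *m rot phi)) *m g0 F.
Proof.
move=> c0 s0 dm CE; have c1 : c != 0 by rewrite gt_eqF.
have um : c *: m \in unitmx.
  by rewrite unitmxE det_scale2 // unitfE expf_neq0.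
rewrite -[LHS]mulmxA CE Dg_Hr ?det_scale2 ?expf_neq0 //.
rewrite -scalemxAl scalerA -exprSr -!mulmxA; congr (_ *m _); rewrite !mulmxA.
rewrite Dg_Ur ?det_scale2 ?expf_neq0 // -!mulmxA; congr (_ *m _).
  by congr Ur; rewrite invmxZ // -scalemxAr scalerA -invfM -exprSr.
rewrite mulmxA -DgM -scalemxAr -scalemxAl scalerA divfK //.
Qed.

(** A basis of bounded size for times when [c >= 1], when the [Hr] part is large:
    after the renewal it has disappeared, and the term in [eu F u] is contracted. *)
Lemma representative_out c s phi (C : 'M[int]_3) m u : 0 < c -> 0 < s ->
  \det m = 1 -> au F u != 0 ->
  g0 F *m map_mx intr C = Dg ((s / c) *: rot phi) *m g0 F ->
  Dg (c *: m) *m Hr (wu F u) *m Ur u *m g0 F *m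
    map_mx intr (gam F *m C) =
  bk (s ^- 2 * au F u) ((c ^- 3 * s) *: (eu F u *m rot phi)) 0
     (s *: (m *m Su F u *m rot phi)) *m g0 F.
Proof.
move=> c0 s0 dm a0 CE; have c1 : c != 0 by rewrite gt_eqF.
have s1 : s != 0 by rewrite gt_eqF.
have E : Dg (c *: m) *m Hr (wu F u) *m Ur u *m g0 F *m map_mx intr (gam F) =
    Dg (c *: m) *m (bk (au F u) (eu F u) 0 (Su F u) *m g0 F).
  by rewrite -renewal // !mulmxA.
rewrite map_mxM [LHS]mulmxA E -!mulmxA CE.
rewrite !mulmxA; congr (_ *m _).
rewrite /Dg !bkM !mul0mx !mulmx0 !mxE !scaler0 !addr0 !add0r det_scale2 //.
rewrite det_scale2 ?det_rot // -?scalemxAl scaler0 -!scalemxAr !scalerA.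
congr bk.
- by field; rewrite s1 c1.
- by congr (_ *: _); field; rewrite c1.
- by rewrite mulrC divfK.
Qed.

(** The two kinds of representatives stay in a bounded set at all scales, because
    the symmetry brings the scale into a compact interval, and they depend on the
    initial data in a Lipschitz way.  Hence the orbit of [Hr (wu F 0) *m g0 F] stays
    bounded in the space of lattices, with one and the same integral matrix [W] for
    that orbit and for its perturbation.  At scales below 1 the flow has not yet
    contracted the part [Ur u], whose size there is an assumption. *)
Lemma tracking rho : 0 <= rho -> exists L rho' eta0, [/\ 0 < L, 0 < eta0 &
  forall m0 m1 c u eta, \det m0 = 1 -> \det m1 = 1 -> 0 < c ->
    nrm m0 <= rho -> 0 <= eta <= eta0 -> nrm (m1 - m0) <= eta -> nrm u <= eta ->
    (c <= 1 -> nrm (c ^- 3 *: (u *m invmx m1)) <= eta) ->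
    exists2 W : 'M[int]_3, \det W = 1 &
      nrm (Dg (c *: m0) *m Hr (wu F 0) *m g0 F *m map_mx intr W) <= rho' /\
      nrm (Dg (c *: m1) *m Hr (wu F u) *m Ur u *m g0 F *m map_mx intr W -
           Dg (c *: m0) *m Hr (wu F 0) *m g0 F *m map_mx intr W) <= L * eta].
Proof.
move=> rho0; have [K K1 [eta1 eta10 lip]] := perturbation_lipschitz F.
pose b := beta F; have b1 : 1 <= b := ltW (beta_gt1 F).
have b0 : 0 <= b by apply: le_trans b1.
pose W0 := nrm (wu F 0); have W00 : 0 <= W0 := nrm_ge0 _.
pose S0 := nrm (Su F 0); have S00 : 0 <= S0 := nrm_ge0 _.
pose E0 := nrm (ee F); have E00 : 0 <= E0 := nrm_ge0 _.
pose G := nrm (g0 F); have G0 : 0 <= G := nrm_ge0 _.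
have K0 : 0 <= K by apply: le_trans K1.
pose P := 1 + b * ((rho + 1) * 4).
have P0 : 0 <= P by rewrite addr_ge0 // !mulr_ge0 // addr_ge0.
pose L1 := (3 + (rho + 1) * (W0 + 1)) * P + ((W0 + 1) + rho * K) * P
  + (3 + rho * W0) * (b * 4).
pose L2 := K + b * (K * 4) + b * (((S0 + 1) + rho * K) * 4).
have L10 : 0 <= L1 by rewrite /L1; do ?[apply: addr_ge0 => //|apply: mulr_ge0 => //].
have L20 : 0 <= L2 by rewrite /L2; do ?[apply: addr_ge0 => //|apply: mulr_ge0 => //].
pose r1 := (3 + rho * W0) * P * G.
pose r2 := (`|dd F| + b * (E0 * 4) + b * (rho * S0 * 4)) * G.
exists (1 + (L1 + L2) * G), (Num.max r1 r2), (Num.min 1 (Num.min eta1 (K^-1))); split.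
- by rewrite ltr_pwDl // mulr_ge0 // addr_ge0.
- by rewrite !lt_min ltr01 eta10 invr_gt0 (lt_le_trans ltr01).
move=> m0 m1 c u eta dm0 dm1 c0 m0r /andP[eta_ge0].
rewrite !le_min => /and3P[etale1 etale eta_K] m10 u_eta utilde.
have Keta1 : K * eta <= 1 by rewrite mulrC -ler_pdivlMr ?(lt_le_trans ltr01) // div1r.
have [|au_ge [lau leu lwu lSu _]] := lip u; first exact: le_trans etale.
have Ku : K * nrm u <= K * eta by rewrite ler_wpM2l.
have au_neq0 : au F u != 0.
  by rewrite gt_eqF // (lt_le_trans _ au_ge) // divr_gt0 ?dd_gt0.
have au0_neq0 : au F 0 != 0 by rewrite au0 gt_eqF ?dd_gt0.
have m1r : nrm m1 <= rho + 1.
  rewrite -(subrK m0 m1) addrC; apply: le_trans (nrmD _ _) _.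
  by rewrite lerD // (le_trans m10).
have wu_le : nrm (wu F u) <= W0 + 1.
  rewrite -(subrK (wu F 0) (wu F u)) addrC; apply: le_trans (nrmD _ _) _.
  by rewrite lerD // (le_trans lwu) // (le_trans Ku).
have Su_le : nrm (Su F u) <= S0 + 1.
  rewrite -(subrK (Su F 0) (Su F u)) addrC; apply: le_trans (nrmD _ _) _.
  by rewrite lerD // (le_trans lSu) // (le_trans Ku).
have [C [s [phi [C1 /andP[s1 sb] CE]]]] := cyc_scale F c0.
have s0 : 0 < s by apply: lt_le_trans s1.
have nrmHr w : nrm (Hr w) = 3 + nrm w.
  rewrite HrE nrm_bk nrm0 addr0 normr1 nrmN nrm_scalar normr1 mul1r; ring.
have s2le1 : s ^- 2 <= 1 by rewrite invf_le1 ?exprn_gt0 // exprn_ege1.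
have s20 : 0 <= s ^- 2 by rewrite invr_ge0 exprn_ge0 // ltW.
have nrot p q (A : 'M[R]_(p, 2)) k : nrm A <= k -> nrm (A *m rot q) <= k * 4.
  by move=> Ak; apply: le_trans (nrmM _ _) _; rewrite ler_pM ?nrm_ge0 ?nrm_rot.
have nrmDg m r : \det m = 1 -> nrm m <= r -> nrm (Dg (s *: (m *m rot phi))) <= 1 + b * (r * 4).
  move=> dm mr; rewrite nrm_bk !nrm0 addr0 add0r det_scale2; last first.
    by rewrite det_mulmx det_rot dm mulr1.
  rewrite ger0_norm // lerD // nrmZ gtr0_norm // ler_pM ?nrm_ge0 ?(ltW s0) //.
  exact: nrot.
have diffM k (p : nat) (A B : 'M[R]_2) (A' B' : 'M[R]_(2, p)) a1 a2 : nrm (A - B) <= eta ->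
    nrm A' <= a1 -> nrm B <= rho -> nrm (A' - B') <= a2 * eta -> k = (a1 + rho * a2) * eta ->
    nrm (A *m A' - B *m B') <= k.
  move=> h1 h2 h3 h4 ->.
  have -> : A *m A' - B *m B' = (A - B) *m A' + B *m (A' - B').
    by rewrite mulmxBl mulmxBr subrKA.
  apply: le_trans (nrmD _ _) _; rewrite mulrDl lerD //.
    by apply: le_trans (nrmM _ _) _; rewrite mulrC ler_pM ?nrm_ge0.
  by apply: le_trans (nrmM _ _) _; rewrite -mulrA ler_pM ?nrm_ge0.
have [cle1|/ltW cge1] := lerP c 1.
  exists C => //.
  have := representative_in (wu F 0) 0 c0 s0 dm0 CE.
  rewrite Ur0 mul0mx scaler0 Ur0 !mulmx1 => ->.
  rewrite (representative_in _ _ c0 s0 dm1 CE).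
  have c31 : `|c ^+ 3| <= 1.
    by rewrite ger0_norm ?exprn_ge0 ?(ltW c0) // exprn_ile1 // ltW.
  pose a0 := c ^+ 3 *: (m0 *m wu F 0); pose a1 := c ^+ 3 *: (m1 *m wu F u).
  have a0_le : nrm a0 <= rho * W0.
    rewrite nrmZ; apply: le_trans (ler_wpM2r (nrm_ge0 _) c31) _; rewrite mul1r.
    by apply: le_trans (nrmM _ _) _; rewrite ler_pM ?nrm_ge0.
  have a1_le : nrm a1 <= (rho + 1) * (W0 + 1).
    rewrite nrmZ; apply: le_trans (ler_wpM2r (nrm_ge0 _) c31) _; rewrite mul1r.
    by apply: le_trans (nrmM _ _) _; rewrite ler_pM ?nrm_ge0.
  have a10 : nrm (a1 - a0) <= ((W0 + 1) + rho * K) * eta.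
    rewrite -scalerBr nrmZ; apply: le_trans (ler_wpM2r (nrm_ge0 _) c31) _; rewrite mul1r.
    by apply: (diffM _ _ _ _ _ _ (W0 + 1) K) => //; apply: le_trans lwu _.
  set ut := c ^- 3 *: (u *m invmx m1).
  pose D0 := Dg (s *: (m0 *m rot phi)); pose D1 := Dg (s *: (m1 *m rot phi)).
  have D0_le : nrm D0 <= P.
    by apply: le_trans (nrmDg _ _ dm0 m0r) _; rewrite lerD2l ler_wpM2l // ler_wpM2r // lerDl.
  have D1_le : nrm D1 <= P := nrmDg _ _ dm1 m1r.
  have D10 : nrm (D1 - D0) <= b * 4 * eta.
    rewrite bkB !det_scale2 ?det_mulmx ?det_rot ?dm0 ?dm1 ?mulr1 // !subrr.
    rewrite nrm_bk normr0 !nrm0 !add0r -scalerBr -mulmxBl nrmZ gtr0_norm // -mulrA.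
    by rewrite ler_pM ?nrm_ge0 ?(ltW s0) // mulrC nrot.
  split.
    rewrite le_max; apply/orP; left; rewrite /r1.
    apply: le_trans (nrmM _ _) _; rewrite ler_wpM2r // (le_trans (nrmM _ _)) //.
    by rewrite ler_pM ?nrm_ge0 // nrmHr lerD2l.
  rewrite -/a0 -/a1 -/D0 -/D1 -/ut -mulmxBl.
  apply: le_trans (nrmM _ _) _; rewrite -/G.
  apply: (@le_trans _ _ (L1 * eta * G)); last first.
    by rewrite -mulrA [eta * G]mulrC mulrA ler_wpM2r //; have := mulr_ge0 L20 G0; lra.
  rewrite ler_wpM2r //.
  have -> : Hr a1 *m Ur ut *m D1 - Hr a0 *m D0 =
      Hr a1 *m (Ur ut - 1%:M) *m D1 + (Hr a1 - Hr a0) *m D1 + Hr a0 *m (D1 - D0).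
    rewrite mulmxBr mulmx1 !mulmxBl mulmxBr.
    move: (Hr a1 *m Ur ut *m D1) (Hr a1 *m D1) (Hr a0 *m D1) (Hr a0 *m D0) => x y z t.
    by apply/matrixP => i j; rewrite !mxE; ring.
  have t1 : nrm (Hr a1 *m (Ur ut - 1%:M) *m D1) <= (3 + (rho + 1) * (W0 + 1)) * eta * P.
    apply: le_trans (nrmM _ _) _; rewrite ler_pM ?nrm_ge0 //.
    apply: le_trans (nrmM _ _) _; rewrite ler_pM ?nrm_ge0 ?nrmHr ?lerD2l //.
    rewrite bk1 bkB !subrr nrm_bk normr0 !nrm0 subr0 !addr0 add0r; exact: utilde.
  have t2 : nrm ((Hr a1 - Hr a0) *m D1) <= ((W0 + 1) + rho * K) * eta * P.
    apply: le_trans (nrmM _ _) _; rewrite ler_pM ?nrm_ge0 //.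
    by rewrite !HrE bkB !subrr nrm_bk normr0 !nrm0 !add0r addr0 opprK addrC nrmBC.
  have t3 : nrm (Hr a0 *m (D1 - D0)) <= (3 + rho * W0) * (b * 4 * eta).
    by apply: le_trans (nrmM _ _) _; rewrite ler_pM ?nrm_ge0 ?nrmHr ?lerD2l.
  apply: le_trans (nrmD _ _) _; apply: le_trans (lerD (nrmD _ _) (lexx _)) _.
  apply: le_trans (lerD (lerD t1 t2) t3) _.
  by rewrite /L1 le_eqVlt; apply/orP; left; apply/eqP; ring.
exists (gam F *m C); first by rewrite det_mulmx C1 det_gam mulr1.
have := representative_out c0 s0 dm0 au0_neq0 CE; rewrite Ur0 mulmx1 => ->.
rewrite (representative_out c0 s0 dm1 au_neq0 CE) au0 eu0.
have c3 : 0 <= c ^- 3 <= 1.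
  by rewrite invr_ge0 exprn_ge0 ?(ltW c0) // invf_le1 ?exprn_gt0 // exprn_ege1.
have cs : `|c ^- 3 * s| <= b.
  case/andP: c3 => c30 c31; rewrite ger0_norm ?mulr_ge0 ?(ltW s0) //.
  by rewrite -[b]mul1r ler_pM // ltW.
split.
  rewrite le_max; apply/orP; right; rewrite /r2.
  apply: le_trans (nrmM _ _) _; rewrite ler_wpM2r // nrm_bk nrm0 add0r !nrmZ.
  rewrite normrM (ger0_norm s20) lerD // ?lerD //.
  - by rewrite -[leRHS]mul1r ler_wpM2r.
  - by rewrite ler_pM ?nrm_ge0 // nrot.
  - rewrite gtr0_norm // ler_pM ?nrm_ge0 ?(ltW s0) // nrot //.
    by apply: le_trans (nrmM _ _) _; rewrite ler_pM ?nrm_ge0.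
rewrite -mulmxBl; apply: le_trans (nrmM _ _) _; rewrite -/G.
apply: (@le_trans _ _ (L2 * eta * G)); last first.
  by rewrite -mulrA [eta * G]mulrC mulrA ler_wpM2r //; have := mulr_ge0 L10 G0; lra.
rewrite ler_wpM2r // bkB subrr nrm_bk nrm0 add0r -mulrBr -!scalerBr -!mulmxBl.
rewrite !nrmZ normrM (ger0_norm s20) (gtr0_norm s0).
have t1 : s ^- 2 * `|au F u - dd F| <= 1 * (K * eta).
  by rewrite ler_pM // (le_trans lau).
have t2 : `|c ^- 3 * s| * nrm ((eu F u - ee F) *m rot phi) <= b * (K * eta * 4).
  by rewrite ler_pM ?nrm_ge0 // nrot // (le_trans leu).
have t3 : s * nrm ((m1 *m Su F u - m0 *m Su F 0) *m rot phi) <=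
    b * (((S0 + 1) + rho * K) * eta * 4).
  rewrite ler_pM ?nrm_ge0 ?(ltW s0) // nrot //.
  by apply: (diffM _ _ _ _ _ _ (S0 + 1) K) => //; apply: le_trans lSu _.
apply: le_trans (lerD (lerD t1 t2) t3) _.
by rewrite /L2 le_eqVlt; apply/orP; left; apply/eqP; ring.
Qed.

End Tracking.

(** * One move *)

Section Step.
Variables (R : realType) (F : frame R) (f : 'M[R]_3 -> R).
Hypothesis f_lat : lattice_function f.
Implicit Types (u : 'rV[R]_2) (m : 'M[R]_2) (x y z : 'cV[R]_2).
Implicit Types (b c t k rho eps dl : R).

(** The observable on the lattices that are asymptotic, as the scale of [q] tends to
    0 and to infinity, to images of the frame by the centralizer. *)
Definition homoclinic (q : 'M[R]_2) := f (Dg q *m Hr (wu F 0) *m g0 F).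

Lemma det_homoclinic c m : 0 < c -> \det m = 1 ->
  \det (Dg (c *: m) *m Hr (wu F 0) *m g0 F) = 1.
Proof.
by move=> c0 dm; rewrite !det_mulmx det_Hr det_g0 det_Dg ?mulr1 // det_scale2 // exprn_gt0.
Qed.

Lemma homoclinic_bounded rho : exists M, forall c m, 0 < c -> \det m = 1 ->
  nrm m <= rho -> `|homoclinic (c *: m)| <= M.
Proof.
have [L [rho' [eta0 [L0 eta00 H]]]] := tracking F (normr_ge0 rho).
have [M HM] := lattice_function_bounded f_lat rho'; exists M => c m c0 dm mr.
have [||||W W1 [Wr _]] := H m m c 0 0 dm dm c0 (le_trans mr (ler_norm rho)).
- by rewrite lexx ltW.
- by rewrite subrr nrm0.
- by rewrite nrm0.
- by rewrite mul0mx scaler0 nrm0.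
rewrite /homoclinic -(f_lat.1 _ _ (det_homoclinic c0 dm) W1); apply: HM => //.
by rewrite det_mulmx det_homoclinic // det_map_intr // mulr1.
Qed.

(** The orbit of [x] is asymptotic to the image of the frame by the element
    [b *: m] of the centralizer. *)
Definition state x b m u := exists W : 'M[int]_3,
  [/\ \det W = 1, 0 < b, \det m = 1 &
      Hr x *m map_mx intr W = Dg (b *: m) *m Ur u *m g0 F].

Variables (tau : 'M[R]_2) (beta0 : R).
Hypothesis tauE : tau = Num.sqrt (dd F) *: (Su F 0 *m rot beta0).

(** Replacing [x] by [x + y] inserts, after [N] turns of the symmetry, a factor
    [Hr] of exactly the size that the renewal absorbs.  The price of waiting is a
    rotation by [N%:R * theta F], the gain that [uN] and [c] are tiny. *)
Lemma state_step x b m u : state x b m u -> forall N,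
  let uN := beta F ^- (3 * N) *: (u *m rot (N%:R * theta F)) in
  let c := b * beta F ^- N in
  let y := c ^+ 3 *: (m *m rot (N%:R * theta F) *m wu F uN) in
  0 < au F uN ->
  (exists b' u', state (x + y) b'
     (m *m rot (N%:R * theta F) *m (Num.sqrt (au F uN) *: Su F uN)) u') /\
  forall t, orbit_fun f (x + y) t =
    f (Dg ((expR t * c) *: (m *m rot (N%:R * theta F))) *m Hr (wu F uN) *m
       Ur uN *m g0 F).
Proof.
move=> [W [W1 b0 dm WE]] N; set r := rot _ => uN c y a0.
have [C C1 CE] := cyc_pow F N.
have c0 : 0 < c by rewrite mulr_gt0 // invr_gt0 exprn_gt0 // beta_gt0.
have dmr : \det (m *m r) = 1 by rewrite det_mulmx det_rot mulr1.
have dcmr : \det (c *: (m *m r)) = c ^+ 2 by rewrite det_scale2.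
have E : Hr (x + y) *m map_mx intr (W *m C) =
    Dg (c *: (m *m r)) *m Hr (wu F uN) *m Ur uN *m g0 F.
  rewrite map_mxM mulmxA addrC HrD -[Hr y *m Hr x *m _]mulmxA WE -!mulmxA CE.
  rewrite [Ur u *m _]mulmxA Ur_Dg; last first.
    by rewrite det_scale2 ?det_rot // expf_neq0 // invr_eq0 expf_neq0 // gt_eqF // beta_gt0.
  rewrite det_scale2 ?det_rot // -scalemxAr scalerA.
  have -> : (beta F ^- N) ^+ 2 * beta F ^- N = beta F ^- (3 * N).
    by rewrite -exprSr -exprVn -exprM -exprVn mulnC.
  rewrite -/uN !mulmxA -[Hr y *m _ *m _]mulmxA -DgM -scalemxAl -scalemxAr scalerA -/c.
  rewrite Dg_Hr ?dcmr ?expf_neq0 ?gt_eqF // -scalemxAl scalerA -exprSr.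
  by [].
have WC1 : \det (W *m C) = 1 by rewrite det_mulmx W1 C1 mulr1.
have det1 : \det (Dg (c *: (m *m r)) *m Hr (wu F uN) *m Ur uN *m g0 F) = 1.
  by rewrite !det_mulmx det_Hr det_Ur det_g0 det_Dg ?dcmr ?exprn_gt0 // !mulr1.
split; last first.
  move=> t; have dt : \det (flow_mx t *m Hr (x + y)) = 1.
    by rewrite det_mulmx det_flow det_Hr mulr1.
  rewrite /orbit_fun -(f_lat.1 _ _ dt WC1).
  rewrite -mulmxA E flow_mxE !mulmxA -DgM mul_scalar_mx scalerA.
  by [].
exists (c * (Num.sqrt (au F uN))^-1), ((au F uN)^-1 *: eu F uN), (W *m C *m gam F).
have a0' : au F uN != 0 by rewrite gt_eqF.
have sa0 : 0 < Num.sqrt (au F uN) by rewrite sqrtr_gt0.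
split; first by rewrite det_mulmx WC1 det_gam mulr1.
- by rewrite mulr_gt0 // invr_gt0.
- by rewrite det_mulmx dmr detZ det_Su // sqr_sqrtr ?(ltW a0) // mulfV // mulr1.
rewrite map_mxM mulmxA E.
have -> : Dg (c *: (m *m r)) *m Hr (wu F uN) *m Ur uN *m g0 F *m map_mx intr (gam F)
    = Dg (c *: (m *m r)) *m (bk (au F uN) (eu F uN) 0 (Su F uN) *m g0 F).
  by rewrite -renewal // !mulmxA.
have -> : bk (au F uN) (eu F uN) 0 (Su F uN) =
    Dg (Su F uN) *m Ur ((au F uN)^-1 *: eu F uN).
  rewrite /Dg /Ur bkM det_Su // invrK !mul0mx !mulmx0 scaler0 mxE !addr0 mulr1.
  by rewrite scalerA mulfV // scale1r mulmx1 add0r.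
rewrite !mulmxA -DgM -[m *m r *m (_ *: _)]scalemxAr scalerA divfK ?gt_eqF //.
by rewrite -scalemxAl.
Qed.

(** One renewal: wait for a power of the symmetry whose rotation part is close to
    [rot k], then leave the frame along the homoclinic orbit of [m0].  The
    centralizer coordinate is multiplied by [rot k *m tau], up to a final rotation:
    in the hyperbolic plane this is a move by a fixed distance in the direction of
    angle [k], which is free. *)
Lemma renewal_step rho eps : 0 <= rho -> 0 < eps -> exists2 nu, 0 < nu &
  forall x b m u k m0, state x b m u -> \det m0 = 1 -> nrm m0 <= rho ->
  nrm (m *m rot k - m0) <= nu -> exists2 t0, 0 <= t0 &
  forall dl z, 0 < dl -> exists x' c,
    [/\ 0 < c <= dl, nrm (x' - x) <= dl, x' != z,
        exists b' m' u', state x' b' m' u' /\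
          nrm (m' *m rot beta0 - m *m rot k *m tau) <= dl
      & forall t, t0 <= t ->
          `|orbit_fun f x' t - homoclinic ((expR t * c) *: m0)| <= eps].
Proof.
move=> rho0 eps0; have [L [rho' [eta0 [L0 eta00 track]]]] := tracking F rho0.
have [d d0 unif] := lattice_function_unif f_lat rho' eps0.
pose eta := Num.min eta0 (d / L).
have eta_gt0 : 0 < eta by rewrite lt_min eta00 divr_gt0.
have eta_le0 : eta <= eta0 by rewrite ge_min lexx.
have etaL : L * eta <= d by rewrite mulrC -ler_pdivlMr // ge_min lexx orbT.
clearbody eta; exists (eta / 2) => [|x b m u k m0 st dm0 m0r mk]; first by rewrite divr_gt0.
have [_ [_ b0 dm _]] := st.
pose M := b ^- 3 * nrm (u *m invmx m).
have M0 : 0 <= M by rewrite mulr_ge0 ?nrm_ge0 // invr_ge0 exprn_ge0 // ltW.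
(* At time t the contracted part of the state has size exp(-3t) * M, which is at
   most [eta] once t >= M / eta, because exp(3t) >= t. *)
exists (M / eta) => [|dl z dl0]; first by rewrite divr_ge0 // ltW.
have [K K1 [eta1 eta10 lip]] := perturbation_lipschitz F.
have K0 : 0 < K by apply: lt_le_trans K1.
pose W0 := nrm (wu F 0).
pose nm := nrm m + 1; have nm0 : 0 < nm by rewrite ltr_wpDl ?nrm_ge0.
pose nt := nrm tau + 1; have nt0 : 0 < nt by rewrite ltr_wpDl ?nrm_ge0.
pose du := Num.min (Num.min eta eta1) (Num.min (K^-1) (dl / 2 / (K * nm * 16))).
have du0 : 0 < du by rewrite !lt_min eta_gt0 eta10 invr_gt0 K0 !divr_gt0 // !mulr_gt0.
(* Below this size, a change [y] other than 0 cannot lead from [x] to [z]. *)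
pose dy := if z == x then dl else Num.min dl (nrm (z - x) / 2).
have dy0 : 0 < dy.
  by rewrite /dy; case: eqVneq => // zx; rewrite lt_min dl0 divr_gt0 // nrm_gt0 subr_eq0.
have small M' e' : 0 < e' -> exists N0, forall N, (N0 <= N)%N -> M' * beta F ^- N <= e'.
  move=> e'0; have [N0 HN] := beta_unbounded F (M' / e'); exists N0 => N /HN.
  by rewrite !ler_pdivrMr ?exprn_gt0 ?beta_gt0 // mulrC.
have [N1 HN1] := small b (Num.min dl 1) (ltac:(by rewrite lt_min dl0 ltr01)).
have [N2 HN2] := small (4 * nrm u) du du0.
have [N3 HN3] := small (b * (nm * 4 * (W0 + 1))) dy dy0.
pose kap := Num.min (eta / 2 / nm) (dl / 2 / (nm * nt)).
have kap0 : 0 < kap by rewrite lt_min !divr_gt0 // mulr_gt0.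
have [N N123 rotN] := rot_dense k (maxn N1 (maxn N2 N3)) (@theta_irr _ F) kap0.
move: N123; rewrite !geq_max => /and3P[/HN1 {}HN1 /HN2 {}HN2 /HN3 {}HN3].
set r := rot (N%:R * theta F) in rotN.
pose uN := beta F ^- (3 * N) *: (u *m r); pose c := b * beta F ^- N.
have bN1 : 1 <= beta F ^+ N by rewrite exprn_ege1 // ltW // beta_gt1.
have bN0 : 0 < beta F ^+ N by apply: lt_le_trans bN1.
have c0 : 0 < c by rewrite mulr_gt0 // invr_gt0.
have [cdl c1] : c <= dl /\ c <= 1 by move: HN1; rewrite le_min => /andP.
have uN_du : nrm uN <= du.
  apply: le_trans HN2; rewrite nrmZ ger0_norm ?invr_ge0 ?exprn_ge0 ?(ltW (beta_gt0 F)) //.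
  rewrite mulrC ler_pM ?nrm_ge0 ?invr_ge0 ?exprn_ge0 ?(ltW (beta_gt0 F)) //.
    by apply: le_trans (nrmM _ _) _; rewrite mulrC ler_wpM2r ?nrm_ge0 ?nrm_rot.
  rewrite lef_pV2 ?posrE ?exprn_gt0 ?beta_gt0 //.
  by rewrite ler_eXn2l ?beta_gt1 // leq_pmull.
move: (uN_du); rewrite !le_min => /andP[/andP[uN_eta uN_eta1] /andP[uN_K uN_dl]].
have [au_ge [_ _ lwu _ lS]] := lip _ uN_eta1.
have au_gt0 : 0 < au F uN by apply: lt_le_trans au_ge; rewrite divr_gt0 ?dd_gt0.
have wu_le : nrm (wu F uN) <= W0 + 1.
  rewrite -(subrK (wu F 0) (wu F uN)) addrC; apply: le_trans (nrmD _ _) _.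
  by rewrite lerD // (le_trans lwu) // mulrC -ler_pdivlMr // div1r.
have [[b' [u' st']] orbE] := state_step st au_gt0.
rewrite -/r -/uN -/c in st' orbE.
set y := c ^+ 3 *: _ in st' orbE.
have dmr : \det (m *m r) = 1 by rewrite det_mulmx dm det_rot mulr1.
have mrk : nrm (m *m r - m *m rot k) <= nm * kap.
  rewrite -mulmxBr; apply: le_trans (nrmM _ _) _.
  by rewrite ler_pM ?nrm_ge0 // lerDl.
have y_dy : nrm y <= dy.
  apply: le_trans HN3; rewrite mulrAC nrmZ ger0_norm ?exprn_ge0 ?(ltW c0) //.
  apply: ler_pM; rewrite ?exprn_ge0 ?nrm_ge0 ?(ltW c0) //.
    by rewrite -[leRHS]mulr1 exprS ler_wpM2l ?(ltW c0) // exprn_ile1 // ltW.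
  apply: le_trans (nrmM _ _) _; rewrite ler_pM ?nrm_ge0 //.
  apply: le_trans (nrmM _ _) _; rewrite ler_pM ?nrm_ge0 ?nrm_rot //.
  by rewrite lerDl.
have y0 : y != 0.
  rewrite scaler_eq0 expf_eq0 /= gt_eqF //=.
  apply/eqP => mw; have umr : m *m r \in unitmx by rewrite unitmxE dmr unitr1.
  have := mulKmx umr (wu F uN); rewrite mw mulmx0 => /esym/eqP.
  by rewrite scaler_eq0 invr_eq0 gt_eqF //= (negPf (vv_neq0 F)).
exists (x + y), c; split.
- by rewrite c0 cdl.
- rewrite addrC addKr; apply: le_trans y_dy _; rewrite /dy.
  by case: ifP => // _; rewrite ge_min lexx.
- apply/eqP => xyz; move: y_dy; rewrite /dy -xyz.
  rewrite -subr_eq0 addrC addKr (negPf y0) le_min => /andP[_].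
  apply/negP; rewrite -ltNge ltr_pdivrMr // ltr_pMr ?ltr1n //.
  by rewrite nrm_gt0.
- exists b', (m *m r *m (Num.sqrt (au F uN) *: Su F uN)), u'; split => //.
  have -> : m *m r *m (Num.sqrt (au F uN) *: Su F uN) *m rot beta0 - m *m rot k *m tau
     = m *m r *m (Num.sqrt (au F uN) *: Su F uN - Num.sqrt (dd F) *: Su F 0) *m rot beta0
       + (m *m r - m *m rot k) *m tau.
    rewrite mulmxBl mulmxBr mulmxBl -[X in _ - X + _]mulmxA -scalemxAl -tauE.
    by rewrite subrKA.
  apply: le_trans (nrmD _ _) _; rewrite (splitr dl) lerD //.
    apply: (@le_trans _ _ (nm * 4 * (K * du) * 4)).
      apply: le_trans (nrmM _ _) _; rewrite ler_pM ?nrm_ge0 ?nrm_rot //.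
      apply: le_trans (nrmM _ _) _; rewrite ler_pM ?nrm_ge0 //; last first.
        by apply: le_trans lS _; rewrite ler_wpM2l // ltW.
      apply: le_trans (nrmM _ _) _; rewrite ler_pM ?nrm_ge0 ?nrm_rot //.
      by rewrite lerDl.
    have : du <= dl / 2 / (K * nm * 16) by rewrite !ge_min lexx !orbT.
    by rewrite ler_pdivlMr ?mulr_gt0 //; lra.
  apply: le_trans (nrmM _ _) _.
  apply: (@le_trans _ _ (nm * kap * nt)).
    by rewrite ler_pM ?nrm_ge0 // lerDl.
  have : kap <= dl / 2 / (nm * nt) by rewrite ge_min lexx orbT.
  by rewrite ler_pdivlMr ?mulr_gt0 //; lra.
move=> t tM; rewrite orbE.
have ct0 : 0 < expR t * c by rewrite mulr_gt0 ?expR_gt0.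
have [||||W W1 [Wr WL]] := track m0 (m *m r) (expR t * c) uN eta dm0 dmr ct0 m0r.
- by rewrite ltW.
- rewrite -(subrKA (m *m rot k)) (splitr eta); apply: le_trans (nrmD _ _) _.
  rewrite lerD //; apply: le_trans mrk _.
  by rewrite mulrC -ler_pdivlMr // ge_min lexx.
- exact: uN_eta.
- move=> _.
  have -> : (expR t * c) ^- 3 *: (uN *m invmx (m *m r)) =
      (expR t ^+ 3)^-1 *: (b ^- 3 *: (u *m invmx m)).
    have mr_inv : invmx (m *m r) = rot (- (N%:R * theta F)) *m invmx m.
      have um : m \in unitmx by rewrite unitmxE dm unitr1.
      have umr : m *m r \in unitmx by rewrite unitmxE dmr unitr1.
      rewrite -[RHS](mulKmx umr) -[m *m r *m _]mulmxA [r *m _]mulmxA rotKN mul1mx.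
      by rewrite mulmxV // mulmx1.
    rewrite mr_inv /uN -scalemxAl -[u *m r *m _]mulmxA [r *m _]mulmxA rotKN mul1mx.
    rewrite !scalerA; congr (_ *: _).
    rewrite /c !exprMn exprVn -exprM mulnC; field.
    by rewrite !expf_neq0 ?gt_eqF ?expR_gt0 ?beta_gt0.
  rewrite !nrmZ !ger0_norm ?invr_ge0 ?exprn_ge0 ?expR_ge0 ?(ltW b0) // -/M.
  rewrite mulrC ler_pdivrMr ?exprn_gt0 ?expR_gt0 // mulrC -ler_pdivrMr //.
  apply: (le_trans tM); have t_ge0 : 0 <= t by apply: le_trans tM; rewrite divr_ge0 // ltW.
  have e1 : 1 + t <= expR t by exact: expR_ge1Dx.
  have e2 : 1 <= expR t by lra.
  apply: (@le_trans _ _ (expR t)); first by lra.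
  by rewrite ler_eXnr.
have [dH dH'] : \det (Dg ((expR t * c) *: (m *m r)) *m Hr (wu F uN) *m Ur uN *m g0 F) = 1
    /\ \det (Dg ((expR t * c) *: m0) *m Hr (wu F 0) *m g0 F) = 1.
  rewrite det_homoclinic // !det_mulmx det_Hr det_Ur det_g0 det_Dg ?mulr1 //.
  by rewrite det_scale2 // exprn_gt0.
rewrite /homoclinic -(f_lat.1 _ _ dH W1) -(f_lat.1 _ _ dH' W1).
apply: unif => //; rewrite ?[\det (_ *m map_mx _ W)]det_mulmx ?dH ?dH' ?det_map_intr ?mulr1 //.
exact: le_trans WL etaL.
Qed.

End Step.

(** * Loops *)

Section Spectrum.
Variables (R : realType) (F : frame R) (f : 'M[R]_3 -> R).
Hypothesis f_lat : lattice_function f.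
Variables (tau : 'M[R]_2) (beta0 : R).
Hypothesis tauE : tau = Num.sqrt (dd F) *: (Su F 0 *m rot beta0).
Hypotheses (tau_half : half_turn tau) (tau_hyp : 2 < hs tau).
Implicit Types (u : 'rV[R]_2) (m g : 'M[R]_2) (x y z : 'cV[R]_2).
Implicit Types (b c t phi psi rho eps nu dl lo hi A r : R).

Notation h := (homoclinic F f).

(** Uniformity over all scales is the point: the tracked orbits stay in a compact
    set, where the observable is uniformly continuous. *)
Lemma homoclinic_near rho eps : 0 <= rho -> 0 < eps -> exists2 eta, 0 < eta &
  forall m0 m1 c, \det m0 = 1 -> \det m1 = 1 -> 0 < c -> nrm m0 <= rho ->
  nrm (m1 - m0) <= eta -> `|h (c *: m1) - h (c *: m0)| <= eps.
Proof.
move=> rho0 eps0; have [L [rho' [eta0 [L0 eta00 track]]]] := tracking F rho0.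
have [d d0 unif] := lattice_function_unif f_lat rho' eps0.
exists (Num.min eta0 (d / L)) => [|m0 m1 c dm0 dm1 c0 m0r m10].
  by rewrite lt_min eta00 divr_gt0.
move: m10; rewrite le_min => /andP[m10 m10d].
have [||||W W1 [Wr WL]] := track m0 m1 c 0 (nrm (m1 - m0)) dm0 dm1 c0 m0r.
- by rewrite nrm_ge0 m10.
- by [].
- by rewrite nrm0 nrm_ge0.
- by rewrite mul0mx scaler0 nrm0 nrm_ge0.
rewrite Ur0 mulmx1 in WL.
have dH := det_homoclinic F c0 dm0; have dH' := det_homoclinic F c0 dm1.
rewrite /homoclinic -(f_lat.1 _ _ dH W1) -(f_lat.1 _ _ dH' W1).
apply: unif => //; rewrite ?[\det (_ *m map_mx _ W)]det_mulmx ?dH ?dH' ?det_map_intr ?mulr1 //.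
by apply: le_trans WL _; rewrite mulrC -ler_pdivlMr.
Qed.

Let nt := nrm tau + 1.
Let nt1 : 1 <= nt. Proof. by rewrite lerDr nrm_ge0. Qed.

Lemma det_rotr m phi : \det m = 1 -> \det (m *m rot phi) = 1.
Proof. by move=> dm; rewrite det_mulmx det_rot dm mulr1. Qed.

Lemma det_taur m : \det m = 1 -> \det (m *m tau) = 1.
Proof. by move=> dm; rewrite det_mulmx dm tau_half.1 mulr1. Qed.

Lemma nrm_rotr n (A : 'M[R]_(n, 2)) phi d : nrm A <= d -> nrm (A *m rot phi) <= d * 4.
Proof. by move=> Ad; apply: le_trans (nrmM _ _) _; rewrite ler_pM ?nrm_ge0 ?nrm_rot. Qed.

Lemma nrm_taur n (A : 'M[R]_(n, 2)) d : nrm A <= d -> nrm (A *m tau) <= d * nt.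
Proof.
by move=> Ad; apply: le_trans (nrmM _ _) _; rewrite ler_pM ?nrm_ge0 // lerDl.
Qed.

(** The coordinate is only considered up to rotations on the right, as a point of
    the hyperbolic plane, because the waiting time of the next renewal can undo any
    rotation. *)
Definition near_state m0 nu x :=
  exists b m u phi, state F x b m u /\ nrm (m *m rot phi - m0) <= nu.

Lemma near_stateW m0 nu nu' x : nu <= nu' -> near_state m0 nu x -> near_state m0 nu' x.
Proof.
move=> nn' [b [m [u [phi [st mm0]]]]]; exists b, m, u, phi; split=> //.
exact: le_trans nn'.
Qed.

Lemma near_state_rot m0 nu psi x :
  near_state m0 nu x -> near_state (m0 *m rot psi) (nu * 4) x.
Proof.
move=> [b [m [u [phi [st mm0]]]]]; exists b, m, u, (phi + psi); split=> //.
by rewrite rotD mulmxA -mulmxBl nrm_rotr.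
Qed.

Lemma near_state_shift m0 m1 nu dl x : nrm (m0 - m1) <= dl ->
  near_state m0 nu x -> near_state m1 (nu + dl) x.
Proof.
move=> m01 [b [m [u [phi [st mm0]]]]]; exists b, m, u, phi; split=> //.
by rewrite -(subrKA m0); apply: le_trans (nrmD _ _) _; rewrite lerD.
Qed.

(** The time at which the orbit passes near the point of scale [c0] of the
    homoclinic orbit is ln(c0 / c), which is as late as desired since [c] is as small
    as desired.  The direction [k] may depend on the point [x]. *)
Lemma step_leads rho eps : 0 <= rho -> 0 < eps -> exists2 nu, 0 < nu &
  forall (P P' : 'cV[R]_2 -> Prop) dl c0 lo hi, 0 < dl -> 0 < c0 ->
  (forall x, P x -> exists b m u k m0, [/\ state F x b m u,
     \det m0 = 1 /\ nrm m0 <= rho, nrm (m *m rot k - m0) <= nu,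
     (forall c, 0 < c -> h (c *: m0) <= hi - eps) &
     lo + eps <= h (c0 *: m0) /\
     (forall x', near_state (m *m rot k *m tau) dl x' -> P' x')]) ->
  leads f P P' lo hi.
Proof.
move=> rho0 eps0; have [nu nu0 step] := renewal_step f_lat tauE rho0 eps0.
exists nu => // P P' dl c0 lo hi dl0 c00 HP x /HP.
move=> [b [m [u [k [m0 [st [dm0 m0r] mk hhi [hlo HP']]]]]]].
have [t0 t00 {}step] := step _ _ _ _ _ _ st dm0 m0r mk.
exists t0 => // d t1 z d0.
pose t2 := Num.max t0 t1.
have dd0 : 0 < Num.min (Num.min d dl) (c0 / expR t2).
  by rewrite !lt_min d0 dl0 divr_gt0 ?expR_gt0.
have [x' [c [/andP[cp cle] xx' xz [b' [m' [u' [st' mm']]]] track]]] := step _ z dd0.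
have ddd : Num.min (Num.min d dl) (c0 / expR t2) <= d by rewrite !ge_min lexx.
have dddl : Num.min (Num.min d dl) (c0 / expR t2) <= dl by rewrite !ge_min lexx orbT.
exists x'; split=> //.
- by apply: HP'; exists b', m', u', beta0; split=> //; apply: le_trans dddl.
- exact: le_trans ddd.
- move=> t tt0; have := track t tt0; have := hhi (expR t * c) (mulr_gt0 (expR_gt0 _) cp).
  by rewrite ler_norml => h1 /andP[_]; lra.
- have t2c : t2 <= ln (c0 / c).
    rewrite -ler_expR lnK ?posrE ?divr_gt0 // ler_pdivlMr // mulrC -ler_pdivlMr ?expR_gt0 //.
    by rewrite (le_trans cle) // ge_min lexx orbT.
  exists (ln (c0 / c)); first by rewrite (le_trans _ t2c) // le_max lexx orbT.
  have := track (ln (c0 / c)) _; rewrite (le_trans _ t2c) ?le_max ?lexx // => /(_ isT).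
  rewrite lnK ?posrE ?divr_gt0 // divfK ?gt_eqF // ler_norml => /andP[h1 _].
  by move: hlo h1; lra.
Qed.

(** A loop at [m] consists of a move that starts from [m] and of one that leads back
    to it, so the supremum of the observable is taken over the moves of both kinds. *)
Definition peak_level m A :=
  (forall c psi, 0 < c -> h (c *: (m *m rot psi)) <= A /\
     h (c *: (m *m rot psi *m tau)) <= A) /\
  (forall eps, 0 < eps -> exists c psi, 0 < c /\
     A - eps <= Num.max (h (c *: (m *m rot psi))) (h (c *: (m *m rot psi *m tau)))).

Lemma tau_rot_tau m psi : m *m rot psi *m tau *m tau = m *m rot (psi + pi).
Proof.
by rewrite -[LHS]mulmxA (half_turnK tau_half) mulmxN mulmx1 rotDpi mulmxN.
Qed.

(** An error in the centralizer coordinate is a displacement in the hyperbolic plane.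
    It cannot be removed by one move, all of which have the same length; but the
    circle about the displaced point meets the circle about [m], so that one move
    leads exactly onto the latter, and a second one to its center. *)
Lemma correcting_angle m : \det m = 1 -> exists2 nu, 0 < nu &
  forall m1, \det m1 = 1 -> nrm (m1 - m) <= nu ->
  exists phi psi chi, m1 *m rot phi *m tau *m rot psi = m *m rot chi *m tau.
Proof.
move=> dm; have [q q2 meet] := circles_meet tau_half tau_hyp.
have um : m \in unitmx by rewrite unitmxE dm unitr1.
pose M := nrm m + 1; have M0 : 0 < M by rewrite ltr_wpDl ?nrm_ge0.
pose nu := Num.min 1 ((q - 2) / 8) / M.
have nuM0 : 0 < Num.min 1 ((q - 2) / 8) by rewrite lt_min ltr01 divr_gt0 ?subr_gt0.
exists nu => [|m1 dm1 m1m]; first by rewrite divr_gt0.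
pose g := invmx m *m m1.
have dg : \det g = 1 by rewrite det_mulmx det_inv dm dm1 invr1 mulr1.
have [phi [psi [chi E]]] : exists phi psi chi,
    g *m rot phi *m tau *m rot psi = rot chi *m tau.
  apply: meet => //.
  have : nrm (g - 1%:M) <= Num.min 1 ((q - 2) / 8).
    rewrite -(mulVmx um) -mulmxBr; apply: le_trans (nrmM _ _) _; rewrite nrm_invmx2 //.
    rewrite -[leRHS](@divfK _ M) ?gt_eqF // mulrC ler_pM ?nrm_ge0 //.
    by rewrite lerDl.
  generalize g => {dg}g.
  rewrite le_min => /andP[]; have := entry_le_nrm (g - 1%:M).
  set e := nrm _ => He; have e0 : 0 <= e := nrm_ge0 _ => e1 eq.
  have := He 0 0; have := He 0 1; have := He 1 0; have := He 1 1.
  rewrite !mxE /= !mulr1n !mulr0n !subr0 => h11 h10 h01 h00.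
  have h1 : g 0 0 ^+ 2 + g 1 1 ^+ 2 <= 2 * (1 + e) ^+ 2.
    rewrite mulr_natl mulr2n lerD // -[g _ _ ^+ 2]real_normK ?num_real //; rewrite lerXn2r ?nnegrE ?addr_ge0 //.
      by rewrite -[g 0 0](subrK 1) addrC (le_trans (ler_normD _ _)) // normr1 lerD2l.
    by rewrite -[g 1 1](subrK 1) addrC (le_trans (ler_normD _ _)) // normr1 lerD2l.
  have h2 : g 0 1 ^+ 2 <= e * e.
    by rewrite -[g _ _ ^+ 2]real_normK ?num_real // expr2 ler_pM.
  have h3 : g 1 0 ^+ 2 <= e * e.
    by rewrite -[g _ _ ^+ 2]real_normK ?num_real // expr2 ler_pM.
  have h4 : e * e <= e by rewrite ler_piMr.
  rewrite /hs; move: h1 h2 h3 h4; rewrite (expr2 (1 + e)); lra.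
exists phi, psi, chi; rewrite -[m1](mulKVmx um) -/g -!mulmxA; congr (_ *m _).
by move: E; rewrite !mulmxA.
Qed.

(** Four moves: an excursion from [m] in the direction where the observable nearly
    attains its supremum, and the return; then a move onto the circle about [m] that
    cancels the accumulated error, and the move back to its center.  The last two
    leave only the error of their own, which can be chosen at will.  Along all
    of them the observable exceeds [A] by little, since they start or end near [m]. *)
Lemma loop_leads m A eps : \det m = 1 -> peak_level m A -> 0 < eps ->
  exists2 nu, 0 < nu & forall nu', 0 < nu' ->
    leads f (near_state m nu) (near_state m nu') (A - eps) (A + eps).
Proof.
move=> dm [Ahi Alo] eps0.
pose e := eps / 8; have e0 : 0 < e by rewrite divr_gt0.
pose rho := nrm m * 4 * nt.
have nt0 : 0 < nt by apply: lt_le_trans nt1.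
have rho0 : 0 <= rho by rewrite !mulr_ge0 ?nrm_ge0 // ltW.
have [nu0 nu00 step] := step_leads rho0 e0.
have [nu1 nu10 corr] := correcting_angle dm.
have [M HM] := homoclinic_bounded F f_lat rho.
pose N := Num.min nu0 nu1; have N0 : 0 < N by rewrite lt_min nu00.
have [Nnu0 Nnu1] : N <= nu0 /\ N <= nu1 by rewrite !ge_min !lexx orbT.
clearbody N.
(* Two moves turn an error nu into at most 4 * (nu + 5 * nt^2 * nu), where nt bounds
   [tau]; another rotation multiplies this by 4, which makes at most 96 * nt^2 * nu. *)
pose nu := N / (96 * nt * nt).
have nu_gt0 : 0 < nu by rewrite divr_gt0 // !mulr_gt0.
have nuE : nu * 96 * nt * nt = N by rewrite /nu; field; rewrite gt_eqF.
clearbody nu.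
have n1 : nu <= nu * nt by rewrite ler_peMr // ltW.
have n2 : nu * nt <= nu * nt * nt by rewrite ler_peMr // mulr_ge0 // ltW.
have mr_rho psi : nrm (m *m rot psi) <= rho.
  apply: (@le_trans _ _ (nrm m * 4)); first exact: nrm_rotr.
  by rewrite /rho ler_peMr // mulr_ge0 ?nrm_ge0.
have mrt_rho psi : nrm (m *m rot psi *m tau) <= rho by apply/nrm_taur/nrm_rotr.
exists nu => // nu' nu'0.
have [c0 [psi0 [c00 Hpsi]]] := Alo e e0.
have L1 : leads f (near_state m nu)
    (near_state (m *m rot psi0 *m tau) (nu * 5 * nt))
    (h (c0 *: (m *m rot psi0)) - e) (A + e).
  apply: (step _ _ nu c0) => // x [b [m1 [u [phi [st m1m]]]]].
  have E : nrm (m1 *m rot (phi + psi0) - m *m rot psi0) <= nu * 4.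
    by rewrite rotD mulmxA -mulmxBl nrm_rotr.
  exists b, m1, u, (phi + psi0), (m *m rot psi0); split=> //.
  - by split; [exact: det_rotr|].
  - apply: le_trans E _; apply: le_trans Nnu0; rewrite -nuE; lra.
  - by move=> c cp; have [] := Ahi c psi0 cp; lra.
  split; first by lra.
  have Et : nrm (m1 *m rot (phi + psi0) *m tau - m *m rot psi0 *m tau) <= nu * 4 * nt.
    by rewrite -mulmxBl nrm_taur.
  move=> x' /(near_state_shift Et); apply: near_stateW; lra.
have ret (Q : R -> Prop) k d lo : 0 < d -> k <= nu0 ->
    (forall psi, Q psi -> lo + e <= h (c0 *: (m *m rot psi *m tau))) ->
    leads f (fun x => exists2 psi, Q psi & near_state (m *m rot psi *m tau) k x)
      (near_state m ((d + k * nt) * 4)) lo (A + e).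
  move=> d0 knu0 Qlo; apply: (step _ _ d c0) => // x [psi Qpsi [b [m1 [u [phi [st m1m]]]]]].
  exists b, m1, u, phi, (m *m rot psi *m tau); split=> //.
  - by split; [exact/det_taur/det_rotr|].
  - exact: le_trans m1m _.
  - by move=> c cp; have [_] := Ahi c psi cp; lra.
  split; first exact: Qlo.
  have Et : nrm (m1 *m rot phi *m tau - m *m rot psi *m tau *m tau) <= k * nt.
    by rewrite -mulmxBl nrm_taur.
  move=> x' /(near_state_shift Et) /(near_state_rot (- (psi + pi))).
  by rewrite tau_rot_tau -mulmxA rotKN mulmx1.
pose k2 := (nu + nu * 5 * nt * nt) * 4.
have L2 : leads f (near_state (m *m rot psi0 *m tau) (nu * 5 * nt)) (near_state m k2)
    (h (c0 *: (m *m rot psi0 *m tau)) - e) (A + e).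
  apply: leadsW (ret (fun psi => psi = psi0) (nu * 5 * nt) nu _ _ _ _) => //.
  - by move=> x nx; exists psi0.
  - by rewrite (le_trans _ Nnu0) // -nuE; lra.
  - by move=> psi ->; rewrite subrK.
have k2N : k2 * 4 <= N by rewrite /k2 -nuE; lra.
clearbody k2.
pose nu2 := Num.min nu0 (nu' / (8 * nt)).
have nu20 : 0 < nu2 by rewrite lt_min nu00 divr_gt0 // mulr_gt0.
have nu2nu' : nu2 * (8 * nt) <= nu'.
  by rewrite -ler_pdivlMr ?mulr_gt0 // ge_min lexx orbT.
have nu2nu0 : nu2 <= nu0 by rewrite ge_min lexx.
clearbody nu2.
pose lo0 := - M - e.
have hlo m0 : \det m0 = 1 -> nrm m0 <= rho -> lo0 + e <= h (c0 *: m0).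
  by move=> dm0 m0r; have := HM _ _ c00 dm0 m0r; rewrite ler_norml => /andP[]; rewrite /lo0; lra.
have k2_ge0 x : near_state m k2 x -> 0 <= k2.
  by move=> [b [m1 [u [phi [_]]]]]; apply: le_trans; rewrite nrm_ge0.
have L3 : leads f (near_state m k2)
    (fun x => exists2 psi, True & near_state (m *m rot psi *m tau) nu2 x) lo0 (A + e).
  apply: (step _ _ (nu2 / 4) c0) => [||x nx]; rewrite ?divr_gt0 //.
  have k20 := k2_ge0 _ nx; have [b [m1 [u [phi [st m1m]]]]] := nx.
  have [_ [_ _ dm1 _]] := st.
  have [|phi' [psi [chi E]]] := corr (m1 *m rot phi) (det_rotr _ dm1).
    by apply: le_trans m1m _; apply: le_trans Nnu1; lra.
  exists b, m1, u, (phi + phi'), (m *m rot phi'); split=> //.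
  - by split; [exact: det_rotr|].
  - rewrite rotD mulmxA -mulmxBl; apply: le_trans (nrm_rotr _ m1m) _.
    exact: le_trans Nnu0.
  - by move=> c cp; have [] := Ahi c phi' cp; lra.
  split; first by apply: hlo => //; exact: det_rotr.
  move=> x' /(near_state_rot psi); rewrite divfK // rotD mulmxA E => nx'.
  by exists chi.
have L4 : leads f (fun x => exists2 psi, True & near_state (m *m rot psi *m tau) nu2 x)
    (near_state m nu') lo0 (A + e).
  apply: leadsW (ret (fun=> True) nu2 (nu' / 8) lo0 _ _ _) => //.
  - by move=> x; apply: near_stateW; move: nu2nu'; lra.
  - by rewrite divr_gt0.
  - by move=> psi _; apply: hlo => //; exact/det_taur/det_rotr.
have L12 := leads_comp f_lat e0 L1 L2.
have {}L3 : leads f (near_state m k2)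
    (fun x => exists2 psi, True & near_state (m *m rot psi *m tau) nu2 x) lo0 (A + e + e).
  by apply: leadsW L3 => //; lra.
have {}L4 : leads f (fun x => exists2 psi, True & near_state (m *m rot psi *m tau) nu2 x)
    (near_state m nu') lo0 (A + e + e + e).
  by apply: leadsW L4 => //; lra.
have L1234 := leads_comp f_lat e0 (leads_comp f_lat e0 L12 L3) L4.
have e8 : eps = e * 8 by rewrite /e divfK.
apply: leadsW L1234 => //; last by lra.
move: Hpsi; set h1 := h _; set h2 := h _; rewrite le_max => Hpsi.
rewrite lerBrDr le_max; apply/orP; left.
rewrite lerBrDr le_max; apply/orP; left.
rewrite lerBrDr le_max; case/orP: Hpsi => ?; apply/orP; [left|right]; lra.
Qed.

End Spectrum.

(** * Levels of the observable *)

Section Ray.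
Variables (R : realType) (F : frame R) (f : 'M[R]_3 -> R).
Hypothesis f_lat : lattice_function f.
Variables (tau : 'M[R]_2) (beta0 : R).
Hypothesis tauE : tau = Num.sqrt (dd F) *: (Su F 0 *m rot beta0).
Hypotheses (tau_half : half_turn tau) (tau_hyp : 2 < hs tau).
Implicit Types (u : 'rV[R]_2) (m g : 'M[R]_2) (x y z : 'cV[R]_2).
Implicit Types (b c t phi psi rho eps nu dl lo hi A r : R).

Notation h := (homoclinic F f).

Let le_dist_trans (a b' p e : R) : `|a - b'| <= e -> a <= p -> b' <= p + e.
Proof. by rewrite ler_norml => /andP[]; lra. Qed.

Definition reachable m := forall nu, 0 < nu -> exists x, near_state F m nu x.

Lemma reachable_rot m psi : reachable m -> reachable (m *m rot psi).
Proof.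
move=> rm nu nu0; have [|x nx] := rm (nu / 4); first by rewrite divr_gt0.
by exists x; have := near_state_rot psi nx; rewrite divfK.
Qed.

Lemma reachable_tau m : \det m = 1 -> reachable m -> reachable (m *m tau).
Proof.
move=> dm rm nu nu0.
have [nu1 nu10 step] := renewal_step f_lat tauE (nrm_ge0 m) ltr01.
have nt0 : 0 < nrm tau + 1 by rewrite ltr_wpDl ?nrm_ge0.
have d0 : 0 < nu / 2 / (nrm tau + 1) by rewrite !divr_gt0.
have [|x [b [m1 [u [phi [st]]]]]] := rm (Num.min nu1 (nu / 2 / (nrm tau + 1))).
  by rewrite lt_min nu10.
rewrite le_min => /andP[m1m m1md].
have [t0 _ {}step] := step _ _ _ _ _ _ st dm (lexx _) m1m.
have [x' [c [_ _ _ [b' [m' [u' [st' m'm]]]] _]]] :=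
  step (nu / 2) 0 (divr_gt0 nu0 (ltr0n _ 2)).
exists x', b', m', u', beta0; split=> //.
rewrite -(subrKA (m1 *m rot phi *m tau)) (splitr nu).
apply: le_trans (nrmD _ _) _; rewrite lerD // -mulmxBl.
apply: le_trans (nrmM _ _) _.
rewrite -[leRHS](@divfK _ (nrm tau + 1)) ?gt_eqF // ler_pM ?nrm_ge0 //.
by rewrite lerDl.
Qed.

(** A path in SL_2 from the identity to infinity; together with rotations it
    generates the group. *)
Definition stretch r : 'M[R]_2 := mx2 r 0 0 r^-1.

Lemma stretchM r s : stretch (r * s) = stretch r *m stretch s.
Proof. by rewrite /stretch mx2M !mulr0 !mul0r !addr0 !add0r invfM. Qed.

Lemma det_stretch r : r != 0 -> \det (stretch r) = 1.
Proof. by move=> r0; rewrite det_mx2 mulfV // mulr0 subr0. Qed.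

(** By [circles_meet] every small element of SL_2 is a product of rotations and
    of two copies of [tau], hence of two renewals; a large stretching is a product of
    small ones. *)
Lemma reachable_stretch m r : \det m = 1 -> 1 <= r -> reachable m ->
  reachable (m *m stretch r).
Proof.
have [q q2 meet] := circles_meet tau_half tau_hyp.
have reachM g m' : \det m' = 1 -> \det g = 1 -> hs g <= q ->
    reachable m' -> reachable (m' *m g).
  move=> dm' dg gq rm'; have [phi [psi [chi E]]] := meet g dg gq.
  have -> : m' *m g = m' *m rot chi *m tau *m rot (- psi) *m tau *m rot (pi - phi).
    have -> : rot (pi - phi) = - rot (- phi) by rewrite addrC rotDpi.
    have {1}-> : g = - (rot chi *m tau *m rot (- psi) *m tau *m rot (- phi)).
      rewrite -E -[_ *m rot psi *m _]mulmxA rotKN mulmx1 -[g *m rot phi *m _ *m _]mulmxA.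
      by rewrite (half_turnK tau_half) mulmxN mulmx1 mulNmx opprK -mulmxA rotKN mulmx1.
    by rewrite !mulmxN !mulmxA.
  apply: reachable_rot; apply: reachable_tau; last first.
    apply: reachable_rot; apply: reachable_tau; last exact: reachable_rot.
    exact: det_rotr.
  apply: det_rotr; apply: (det_taur tau_half); exact: det_rotr.
pose del := Num.sqrt (q - 2) / 2.
have q20 : 0 < q - 2 by rewrite subr_gt0.
have del0 : 0 < del by rewrite divr_gt0 // sqrtr_gt0.
have del2 : 4 * del ^+ 2 = q - 2.
  by rewrite /del expr_div_n sqr_sqrtr ?(ltW q20) // mulrC -natrX divfK.
have small s : 1 <= s <= 1 + del -> hs (stretch s) <= q.
  move=> /andP[s1 sd]; have s0 : 0 < s by apply: lt_le_trans s1.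
  rewrite hs_mx2 expr0n addr0 add0r.
  have -> : s ^+ 2 + s^-1 ^+ 2 = (s - s^-1) ^+ 2 + 2 by field; rewrite gt_eqF.
  rewrite -lerBrDr -del2.
  have -> : 4 * del ^+ 2 = (2 * del) ^+ 2 by ring.
  have sV : s^-1 <= 1 by rewrite invf_le1.
  have sV2 : 1 - del <= s^-1.
    rewrite -[s^-1]mul1r ler_pdivlMr //; nra.
  by rewrite lerXn2r ?nnegrE ?subr_ge0 ?mulr_ge0 ?(ltW del0) //; lra.
have pow n : forall r, 1 <= r <= (1 + del) ^+ n -> forall m', \det m' = 1 ->
    reachable m' -> reachable (m' *m stretch r).
  have d1 : 0 < 1 + del by rewrite addr_gt0.
  elim: n => [r'|n IH r' /andP[r1 rn] m' dm' rm'].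
    rewrite expr0 -eq_le => /eqP <- m' _.
    by rewrite /stretch invr1 -mx2_1 mulmx1.
  have r0 : 0 < r' by apply: lt_le_trans r1.
  have [rd|/ltW rd] := lerP r' (1 + del).
    by apply: reachM => //; [rewrite det_stretch ?gt_eqF|apply: small; rewrite r1].
  rewrite -[r'](@divfK _ (1 + del)) ?gt_eqF // stretchM mulmxA.
  have rr : 1 <= r' / (1 + del) by rewrite ler_pdivlMr // mul1r.
  apply: reachM; rewrite ?det_stretch ?gt_eqF //.
  - by rewrite det_mulmx dm' det_stretch ?mulr1 // gt_eqF // (lt_le_trans _ rr).
  - by apply: small; rewrite lexx andbT lerDl ltW.
  - by apply: IH => //; rewrite rr ler_pdivrMr // -exprSr.
move=> dm r1 rm; have [N rN] : exists N, r <= (1 + del) ^+ N.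
  exists (Num.trunc (r / del)).+1.
  have bern N : 1 + del * N%:R <= (1 + del) ^+ N.
    elim: N => [|N IH]; first by rewrite mulr0 addr0 expr0.
    rewrite exprS -natr1; apply: le_trans (_ : (1 + del) * (1 + del * N%:R) <= _).
      by have := mulr_ge0 (ltW del0) (ler0n R N); nra.
    by rewrite ler_pM2l // addr_gt0.
  apply: le_trans (bern _); rewrite ler_wpDl // mulrC -ler_pdivrMr // ltW //.
  exact: truncnS_gt.
by apply: (pow N) => //; rewrite r1.
Qed.

Variables (x0 : 'cV[R]_2) (b0 : R) (m0 : 'M[R]_2) (u0 : 'rV[R]_2).
Hypothesis start : state F x0 b0 m0 u0.

Let dm0 : \det m0 = 1. Proof. by case: start => [W []]. Qed.

Let reachable_start r : 1 <= r -> reachable (m0 *m stretch r).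
Proof.
move=> r1; apply: reachable_stretch => // nu nu0.
exists x0, b0, m0, u0, 0; split=> //.
by rewrite rot0 mulmx1 subrr nrm0 ltW.
Qed.

Let mm r := m0 *m stretch r.
Let peaks r := [set v | exists c psi, 0 < c /\
  (v = h (c *: (mm r *m rot psi)) \/ v = h (c *: (mm r *m rot psi *m tau)))].

Let det_mm r : 1 <= r -> \det (mm r) = 1.
Proof.
by move=> r1; rewrite det_mulmx dm0 det_stretch ?mulr1 // gt_eqF // (lt_le_trans _ r1).
Qed.

Let nt := nrm tau + 1.
Let rho r := nrm (mm r) * 4 * nt.

Let nt1 : 1 <= nt. Proof. by rewrite lerDr nrm_ge0. Qed.
Let nt0 : 0 < nt. Proof. exact: lt_le_trans nt1. Qed.

Let mm_rho r psi : nrm (mm r *m rot psi) <= rho r /\ nrm (mm r *m rot psi *m tau) <= rho r.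
Proof.
split; last by apply/nrm_taur/nrm_rotr.
apply: (@le_trans _ _ (nrm (mm r) * 4)); first exact: nrm_rotr.
by rewrite /rho ler_peMr // mulr_ge0 ?nrm_ge0.
Qed.

Let has_sup_peaks r : 1 <= r -> has_sup (peaks r).
Proof.
move=> r1; split; first by exists (h (1 *: (mm r *m rot 0))), 1, 0; split=> //; left.
have [M HM] := homoclinic_bounded F f_lat (rho r).
exists M => _ [c [psi [c0 [->|->]]]]; apply: le_trans (ler_norm _) _; apply: HM => //.
- exact/det_rotr/det_mm.
- by have [] := mm_rho r psi.
- exact/(det_taur tau_half)/det_rotr/det_mm.
- by have [] := mm_rho r psi.
Qed.

Let Psi r := sup (peaks r).

Let Psi_peak r : 1 <= r -> peak_level F f tau (mm r) (Psi r).
Proof.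
move=> r1; have hsr := has_sup_peaks r1; split=> [c psi c0|eps eps0].
  by split; apply: ub_le_sup; case: hsr => // _ _; exists c, psi; split=> //; [left|right].
have [v [c [psi [c0 vE]]] vl] := sup_adherent eps0 hsr.
exists c, psi; split=> //; rewrite le_max.
by case: vE => vE; rewrite -vE (ltW vl) ?orbT.
Qed.

Let Psi_continuous r : 1 <= r -> forall eps, 0 < eps -> exists2 d, 0 < d &
  forall s, 1 <= s -> `|s - r| <= d -> `|Psi s - Psi r| <= eps.
Proof.
move=> r1 eps eps0.
have rho_ge0 : 0 <= rho r by rewrite !mulr_ge0 ?nrm_ge0 // ltW.
have [eta eta0 near_h] := homoclinic_near F f_lat rho_ge0 eps0.
pose K := (nrm m0 + 1) * 2 * 4 * nt.
have nm0 : 0 < nrm m0 + 1 by rewrite ltr_wpDl ?nrm_ge0.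
have K0 : 0 < K by rewrite !mulr_gt0.
exists (eta / K) => [|s s1 sr]; first by rewrite divr_gt0.
have r0 : 0 < r by apply: lt_le_trans r1.
have s0 : 0 < s by apply: lt_le_trans s1.
have dist : nrm (mm s - mm r) <= (nrm m0 + 1) * 2 * `|s - r|.
  rewrite -mulmxBr; apply: le_trans (nrmM _ _) _; rewrite -mulrA ler_pM ?nrm_ge0 ?lerDl //.
  rewrite mx2N mx2D nrm_mx2 !subr0 normr0 addr0 add0r mulr_natl mulr2n lerD2l.
  have -> : s^-1 - r^-1 = (r - s) / (s * r) by field; rewrite !gt_eqF.
  rewrite normrM distrC ler_piMr // ger0_norm; last by rewrite invr_ge0 mulr_ge0 ?ltW.
  by rewrite invf_le1 ?mulr_gt0 // mulr_ege1.
have eta_nt : (nrm m0 + 1) * 2 * `|s - r| * 4 * nt <= eta.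
  by move: sr; rewrite ler_pdivlMr // /K; lra.
have hrot c psi : 0 < c -> `|h (c *: (mm s *m rot psi)) - h (c *: (mm r *m rot psi))| <= eps.
  move=> c0; apply: near_h => //; rewrite ?det_rotr ?det_mm //; first by have [] := mm_rho r psi.
  rewrite -mulmxBl; apply: le_trans (nrm_rotr _ dist) _; apply: le_trans eta_nt.
  by rewrite ler_peMr // !mulr_ge0 // ltW.
have htau c psi : 0 < c ->
    `|h (c *: (mm s *m rot psi *m tau)) - h (c *: (mm r *m rot psi *m tau))| <= eps.
  move=> c0; apply: near_h => //.
  - exact/(det_taur tau_half)/det_rotr/det_mm.
  - exact/(det_taur tau_half)/det_rotr/det_mm.
  - by have [] := mm_rho r psi.
  rewrite -!mulmxBl; apply: le_trans eta_nt; exact/nrm_taur/nrm_rotr.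
have [hr _] := Psi_peak r1; have [hs' _] := Psi_peak s1.
have h1 : Psi s <= Psi r + eps.
  apply: ge_sup; first by case: (has_sup_peaks s1).
  move=> _ [c [psi [c0 [->|->]]]].
    by apply: le_dist_trans (hr c psi c0).1; rewrite distrC hrot.
  by apply: le_dist_trans (hr c psi c0).2; rewrite distrC htau.
have h2 : Psi r <= Psi s + eps.
  apply: ge_sup; first by case: (has_sup_peaks r1).
  move=> _ [c [psi [c0 [->|->]]]].
    exact: le_dist_trans (hrot c psi c0) (hs' c psi c0).1.
  exact: le_dist_trans (htau c psi c0) (hs' c psi c0).2.
rewrite ler_distl lerBlDr; apply/andP; split; [exact: h2|exact: h1].
Qed.

(** By Mahler's criterion, tending to infinity at infinity in the space of lattices. *)
Definition diverging (k : 'M[R]_3 -> R) := forall A, exists2 d, 0 < d &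
  forall (g : 'M[R]_3) (v : 'cV[int]_3), \det g = 1 -> v != 0 ->
    nrm (g *m map_mx intr v) <= d -> A < k g.

(** A fixed vector of the lattice is made short by a suitable rotation, stretching
    and scale: the rotation puts its expanded part on the axis that the stretching
    contracts, and the scale contracts the first coordinate. *)
Let Psi_unbounded A : diverging f -> exists2 r, 1 <= r & A <= Psi r.
Proof.
move=> /(_ A)[d d0 Hd].
pose v : 'cV[int]_3 := delta_mx 0 0.
pose xi := Hr (wu F 0) *m g0 F *m map_mx intr v.
have v0 : v != 0.
  by apply/eqP => /matrixP/(_ 0 0); rewrite !mxE.
pose xi0 := @usubmx _ 1 2 1 xi 0 0; pose xi' := @dsubmx _ 1 2 1 xi.
have xiE : xi = @col_mx _ 1 2 1 xi0%:M xi'.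
  by rewrite -mx11_scalar; symmetry; exact: (@vsubmxK _ 1 2 1 xi).
clearbody xi0 xi'.
pose n := Num.sqrt (xi' 0 0 ^+ 2 + xi' 1 0 ^+ 2).
have [psi [p1 p2]] : exists psi, 0 = cos psi * xi' 0 0 - sin psi * xi' 1 0 /\
    n = cos psi * xi' 1 0 + sin psi * xi' 0 0.
  apply: rotate_vector; rewrite expr0n add0r sqr_sqrtr // addr_ge0 ?sqr_ge0 //.
have n0 : 0 <= n := sqrtr_ge0 _.
clearbody n; have rx : rot psi *m xi' = n *: delta_mx 1 0.
  apply/matrixP => i j; rewrite ord1 !mxE sum2E !mxE.
  case: (ord2P i) => -> /=; first by rewrite mulNr -p1 mulr0.
  by rewrite mulr1 addrC -p2.
pose c := 1 + 2 * `|xi0| / d.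
have c1 : 1 <= c by rewrite lerDl !mulr_ge0 // invr_ge0 ltW.
have c0 : 0 < c by apply: lt_le_trans c1.
pose r := 1 + 2 * (c * (nrm m0 * n)) / d.
have r1 : 1 <= r.
  by rewrite lerDl divr_ge0 ?(ltW d0) // !mulr_ge0 ?nrm_ge0 // ltW.
have r0 : 0 < r by apply: lt_le_trans r1.
have dmr : \det (mm r *m rot psi) = 1 by exact/det_rotr/det_mm.
exists r => //; have [Hp _] := Psi_peak r1; apply: le_trans (Hp c psi c0).1.
apply/ltW/(Hd _ v) => //; first exact: det_homoclinic.
rewrite -[Dg _ *m _ *m _]mulmxA -[Dg _ *m _ *m _]mulmxA -/xi xiE.
have -> : Dg (c *: (mm r *m rot psi)) *m (col_mx xi0%:M xi' : 'M[R]_(1 + 2, 1)) =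
    @col_mx _ 1 2 1 (c ^- 2 * xi0)%:M (c *: (mm r *m rot psi *m xi')).
  rewrite /Dg /bk; etransitivity; first exact: (@mul_block_col _ 1 2 1 2 1).
  by rewrite det_scale2 // !mul0mx addr0 add0r -scalemxAl -scalar_mxM.
rewrite [leLHS](@nrm_col R 1 2 1) nrm_scalar mulr1 (splitr d) lerD //.
  rewrite normrM ger0_norm ?invr_ge0 ?exprn_ge0 ?(ltW c0) //.
  rewrite mulrC ler_pdivrMr ?exprn_gt0 //.
  apply: (@le_trans _ _ (d / 2 * c)).
    by rewrite /c mulrDr mulr1 [d / 2 * _]mulrC mulrA divfK ?gt_eqF // mulrC mulKf // lerDr divr_ge0 // ltW.
  by rewrite ler_wpM2l ?divr_ge0 ?(ltW d0) // ler_eXnr.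
rewrite -[mm r *m _ *m _]mulmxA rx /mm -mulmxA.
have -> : stretch r *m (n *: delta_mx 1 0) = (n / r) *: delta_mx 1 0 :> 'cV[R]_2.
  apply/matrixP => i j; rewrite ord1 !mxE sum2E !mxE.
  by case: (ord2P i) => -> /=; ring.
rewrite nrmZ -scalemxAr nrmZ !ger0_norm ?divr_ge0 ?(ltW c0) ?(ltW r0) //.
have nd : nrm (delta_mx 1 0 : 'cV[R]_2) = 1.
  rewrite /nrm sum2E !big_ord1 !mxE /= normr0 normr1 add0r //.
apply: (@le_trans _ _ (c * (n / r * (nrm m0 * 1)))).
  rewrite ler_wpM2l ?(ltW c0) // ler_wpM2l ?divr_ge0 ?(ltW r0) // -nd; exact: nrmM.
have -> : c * (n / r * (nrm m0 * 1)) = c * (nrm m0 * n) / r by ring.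
rewrite ler_pdivrMr //.
have -> : d / 2 * r = d / 2 + c * (nrm m0 * n) by rewrite /r; field; rewrite gt_eqF.
by rewrite lerDr divr_ge0 // ltW.
Qed.

(** The supremum [Psi] is continuous along the connected path of stretchings and
    unbounded, so it takes every value above [Psi 1]; at a coordinate where it takes
    the value [A], loops with errors decreasing to 0 give orbits of upper limit [A]. *)
Lemma orbit_spectrum_ray : diverging f -> exists2 T, 0 < T &
  forall A, T < A -> forall zs : nat -> 'cV[R]_2, exists x,
    [/\ forall j, x != zs j,
        forall e, 0 < e -> exists t0, forall t, t0 <= t -> orbit_fun f x t <= A + e
      & forall e t0, 0 < e -> exists2 t, t0 <= t & A - e <= orbit_fun f x t].
Proof.
move=> div; exists (Num.max 1 (Psi 1)) => [|A]; first by rewrite lt_max ltr01.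
rewrite gt_max => /andP[_ PA] zs.
have [r2 r21 AP] := Psi_unbounded A div.
have [r [r1 PsirA]] : exists r, 1 <= r /\ Psi r = A.
  have cont : {within `[1, r2], continuous Psi}%classic.
    apply/subspace_continuousP => s /=; rewrite in_itv /= => /andP[s1 _].
    apply/cvgrPdist_le => eps eps0; have [d d0 Hd] := Psi_continuous s1 eps0.
    near=> s' => /=; rewrite distrC; apply: Hd.
      have : `[1, r2]%classic s' by near: s'; exact: withinT.
      by rewrite /= in_itv /= => /andP[].
    rewrite distrC; near: s'; apply: cvg_within.
    by apply/nbhs_ballP; exists d => //= y; rewrite /ball /= => /ltW.
  have [|r] := IVT r21 cont (v := A); last first.
    by rewrite in_itv /= => /andP[r1 _] PrA; exists r.
  apply/andP; split.
    by rewrite ge_min; apply/orP; left; exact: ltW PA.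
  by rewrite le_max; apply/orP; right; exact: AP.
have dm : \det (mm r) = 1 by exact: det_mm.
have peak := Psi_peak r1; rewrite PsirA in peak.
pose e j : R := j.+1%:R^-1.
have e0 j : 0 < e j by rewrite invr_gt0.
(* The precision required of loop j is the precision that loop j + 1 needs. *)
have loop j : {nu | 0 < nu & forall nu', 0 < nu' ->
    leads f (near_state F (mm r) nu) (near_state F (mm r) nu') (A - e j) (A + e j)}.
  by apply: cid2; apply: (loop_leads f_lat tauE tau_half tau_hyp dm peak (e0 j)).
apply: (leads_limit f_lat (P := fun j => near_state F (mm r) (s2val (loop j)))).
  move=> j; apply: (s2valP' (loop j)); exact: (s2valP (loop j.+1)).
exact: reachable_start (s2valP (loop 0%N)).
Unshelve. all: by end_near.
Qed.

End Ray.

(** * Irrationality of the rotation part *)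

Section CubicFrame.
Variable R : realType.

Definition rw (a b : R) : 'rV[R]_2 := \row_j if j == 0 then a else b.
Definition cl (a b : R) : 'cV[R]_2 := \col_i if i == 0 then a else b.

Lemma rwE (u : 'rV[R]_2) : u = rw (u 0 0) (u 0 1).
Proof. by apply/rowP => j; rewrite mxE; case: (ord2P j) => ->. Qed.

Lemma rw_mx2 a b p q r s : rw a b *m mx2 p q r s = rw (a * p + b * r) (a * q + b * s).
Proof. by apply/rowP => j; rewrite !mxE sum2E !mxE; case: (ord2P j) => ->. Qed.

Lemma rwZ c a b : c *: rw a b = rw (c * a) (c * b).
Proof. by apply/rowP => j; rewrite !mxE; case: (ord2P j) => ->. Qed.

Lemma rwD a b a' b' : rw a b + rw a' b' = rw (a + a') (b + b').
Proof. by apply/rowP => j; rewrite !mxE; case: (ord2P j) => ->. Qed.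

Lemma mx2_cl a b p q r s : mx2 p q r s *m cl a b = cl (p * a + q * b) (r * a + s * b).
Proof.
apply/matrixP => i j; rewrite !mxE sum2E !mxE.
by case: (ord2P i) => ->.
Qed.

Lemma clZ c a b : c *: cl a b = cl (c * a) (c * b).
Proof. by apply/colP => i; rewrite !mxE; case: (ord2P i) => ->. Qed.

Lemma clD a b a' b' : cl a b + cl a' b' = cl (a + a') (b + b').
Proof. by apply/colP => i; rewrite !mxE; case: (ord2P i) => ->. Qed.

Lemma rw_cl a b c d : (rw a b *m cl c d) 0 0 = a * c + b * d.
Proof. by rewrite !mxE sum2E !mxE. Qed.

Lemma cl_rw a b c d : cl a b *m rw c d = mx2 (a * c) (a * d) (b * c) (b * d).
Proof. by apply: eq_mx2; rewrite !mxE big_ord1 !mxE. Qed.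

Lemma cl0 : cl 0 0 = 0.
Proof. by apply/colP => i; rewrite !mxE; case: ifP. Qed.

Lemma mxtrace_bk a u v B : \tr (bk a u v B : 'M[R]_3) = a + \tr B.
Proof.
rewrite /bk; etransitivity; first exact: (@mxtrace_block _ 1 2).
by rewrite mxtrace_scalar mulr1n.
Qed.

(** If the complex conjugate eigenvalues of a power of the symmetry were real,
    its eigenvalues would be v^2, 1/v, 1/v for some large v, and the traces s, s'
    of that power and of its inverse would be integers with
    s'^2 - 4s = v^-4 - 4/v, which is strictly between -1 and 0. *)
Lemma symmetry_irrational (g : 'M[R]_3) (c : 'M[int]_3) (b t : R) :
  \det g = 1 -> \det c = 1 -> 1 < b ->
  g *m map_mx intr c = Dg (b^-1 *: rot t) *m g ->
  forall n, (0 < n)%N -> rot (n%:R * t) <> 1%:M.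
Proof.
move=> dg dc b1 cE n n0 rot1.
have rotk k : rot ((k * n)%:R * t) = 1%:M.
  elim: k => [|k IH]; first by rewrite mul0n mul0r rot0.
  by rewrite mulSn natrD mulrDl rotD rot1 IH mulmx1.
have b0 : 0 < b by apply: lt_trans b1.
have [N [N4 rotN]] : exists N, 4 < b ^+ N /\ rot (N%:R * t) = 1%:M.
  have bern N : 1 + (b - 1) * N%:R <= b ^+ N.
    elim: N => [|N IH]; first by rewrite mulr0 addr0 expr0.
    rewrite exprS -natr1; apply: le_trans (_ : b * (1 + (b - 1) * N%:R) <= _).
      have b10 : 0 <= b - 1 by rewrite subr_ge0 ltW.
      by have := mulr_ge0 b10 (ler0n R N); nra.
    by rewrite ler_pM2l.
  pose k := (Num.trunc (4 / (b - 1))).+1; exists (k * n)%N; split=> //.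
  have h : 4 < b ^+ k.
    apply: lt_le_trans (bern k); rewrite ltr_wpDl // mulrC -ltr_pdivrMr ?subr_gt0 //.
    exact: truncnS_gt.
  by apply: lt_le_trans h _; rewrite ler_eXn2l // leq_pmulr.
have [C C1 CE] := symmetry_pow dc cE N.
rewrite rotN in CE; set v := b ^+ N in N4 CE.
have v0 : 0 < v by apply: lt_trans N4.
have ug : g \in unitmx by rewrite unitmxE dg unitr1.
have uC : C \in unitmx by rewrite unitmxE C1 unitr1.
have dv : \det (v^-1 *: 1%:M : 'M[R]_2) = v ^- 2 by rewrite det_scale2 ?det1 // exprVn.
have trC : (\tr C)%:~R = v ^+ 2 + 2 / v.
  rewrite -[LHS](trace_map_mx (intr : int -> R)) -[map_mx intr C](mulKmx ug) CE.
  rewrite mxtrace_mulC -mulmxA mulmxV // mulmx1 mxtrace_bk dv invrK.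
  by rewrite scalemx1 mxtrace_scalar mulr2n mulr_natl mulr2n.
have CiE : g *m map_mx intr (invmx C) = Dg (v *: 1%:M) *m g.
  have E : Dg (v *: 1%:M) *m Dg (v^-1 *: 1%:M) = 1%:M :> 'M[R]_3.
    by rewrite -DgM -scalemxAl mul1mx scalerA mulfV ?gt_eqF // scale1r Dg1.
  rewrite -[g in LHS]mul1mx -E -!mulmxA [Dg (v^-1 *: _) *m (_ *m _)]mulmxA -CE -mulmxA.
  by rewrite -map_mxM mulmxV // map_mx1 mulmx1.
have trCi : (\tr (invmx C))%:~R = v ^- 2 + 2 * v.
  rewrite -[LHS](trace_map_mx (intr : int -> R)) -[map_mx intr _](mulKmx ug) CiE.
  rewrite mxtrace_mulC -mulmxA mulmxV // mulmx1 mxtrace_bk det_scale2 ?det1 //.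
  by rewrite scalemx1 mxtrace_scalar mulr2n mulr_natl mulr2n.
pose z : int := \tr (invmx C) ^+ 2 - 4 * \tr C.
have zE : z%:~R = v ^- 4 - 4 / v :> R.
  rewrite rmorphB rmorphXn rmorphM /= trC trCi.
  by field; rewrite gt_eqF.
have vi : v^-1 < 4^-1 by rewrite ltf_pV2 ?posrE.
have vi0 : 0 < v^-1 by rewrite invr_gt0.
have v4 : v ^- 4 = v^-1 * (v^-1 * (v^-1 * v^-1)) by rewrite -exprVn !exprS expr0; ring.
have {}zE : (-1 < (z%:~R : R)) && ((z%:~R : R) < 0).
  rewrite zE v4; move: (v^-1) vi vi0 => x x4 x0.
  have y1 : x * (x * (x * x)) < x.
    by rewrite gtr_pMr // -!expr2 -exprS exprn_ilt1 ?ltW //; lra.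
  have y0 : 0 < x * (x * (x * x)) by rewrite !mulr_gt0.
  by apply/andP; split; lra.
case/andP: zE => z1; rewrite ltrz0 => z0.
have : ((-1)%:~R : R) < z%:~R by rewrite mulrN1z.
by rewrite ltr_int; lia.
Qed.

End CubicFrame.

(** * The frame of a cubic field *)

Section FrameExistence.
Variable R : realType.

Lemma plastic_number : exists eta : R, [/\ eta ^+ 3 = eta + 1, 1 < eta & 4 < 3 * eta ^+ 2].
Proof.
pose p : {poly R} := 'X^3 - 'X - 1.
have pE x : p.[x] = x ^+ 3 - x - 1 by rewrite /p !hornerE.
have [|x /andP[x1 x2] /eqP] := @poly_ivt R p 1 2 (ler1n _ 2).
  by rewrite !pE; apply/andP; split; lra.
rewrite pE => xE; have x3 : x ^+ 3 = x + 1 by lra.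
exists x; split=> //.
  rewrite lt_neqAle x1 andbT; apply/eqP => x1E; move: x3; rewrite -x1E expr1n; lra.
have x30 : x * x * x = x + 1 by rewrite -x3; ring.
by rewrite expr2; nra.
Qed.

Lemma det_bk a u v B : a != 0 -> \det (bk a u v B : 'M[R]_3) =
  a * \det (B - a^-1 *: (v *m u)).
Proof.
move=> a0; rewrite -[LHS]mul1r -(det_Hr (a^-1 *: v)) -det_mulmx -(det_bk_ub a u).
congr determinant; rewrite HrE bkM !mul0mx !mul1mx mxE addr0 mul1r scale1r addr0.
congr bk; first by rewrite scalerN scalerA mulfV // scale1r addNr.
by rewrite mulNmx -scalemxAl addrC.
Qed.

(** The lattice of the cubic field generated by the plastic number, the real
    root of t^3 = t + 1: multiplication by that unit expands the real place and
    acts by a similarity on the complex one.  The second integer matrix is an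
    elementary one: it differs from the identity by a matrix of rank one, which
    is never conformal. *)
Lemma frame_exists : exists F : frame R, exists x b m u, state F x b m u.
Proof.
have [eta [e3 e1 e43]] := plastic_number.
have e0 : 0 < eta by apply: lt_trans e1.
pose p : R := - eta / 2; pose q : R := Num.sqrt (3 * eta ^+ 2 - 4) / 2.
have q0 : 0 < q by rewrite divr_gt0 // sqrtr_gt0 subr_gt0.
have q2 : q ^+ 2 = (3 * eta ^+ 2 - 4) / 4.
  by rewrite expr_div_n sqr_sqrtr ?subr_ge0 ?(ltW e43) // -natrX.
have p2 : p = - eta / 2 by [].
clearbody p q.
have pq : p ^+ 2 + q ^+ 2 = eta ^+ 2 - 1 by rewrite q2 p2; field.
have epq : eta * (p ^+ 2 + q ^+ 2) = 1.
  by rewrite pq mulrBr mulr1 -exprS e3; ring.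
pose Del := q * ((p - eta) ^+ 2 + q ^+ 2).
have Del0 : 0 < Del.
  by rewrite mulr_gt0 // ltr_wpDl ?sqr_ge0 // exprn_gt0.
pose B := mx2 p (p ^+ 2 - q ^+ 2) q (2 * p * q).
pose g : 'M[R]_3 := bk Del^-1 (rw (eta / Del) (eta ^+ 2 / Del)) (cl 1 0) B.
have dg : \det g = 1.
  rewrite det_bk ?invr_eq0 ?gt_eqF // invrK cl_rw mx2Z mx2N mx2D det_mx2.
  apply: (@mulfI _ Del); rewrite ?gt_eqF // mulVKf ?gt_eqF // mulr1.
  by rewrite !mul1r ![Del * (_ / Del)]mulrC !divfK ?gt_eqF // /Del; ring.
have ug : g \in unitmx by rewrite unitmxE dg unitr1.
(* The rows of [g] are the three embeddings, the complex one split into real and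
   imaginary parts, of the basis 1, t, t^2, up to the scaling of the real row that
   makes the determinant 1; [c] is multiplication by t in this basis. *)
pose c : 'M[int]_3 := block_mx (0 : 'M[int]_1) (\row_j (if j == 0 then 0 else 1) : 'rV[int]_2)
  (\col_i (if i == 0 then 1 else 0)) (\matrix_(i, j) (if (i == 0) && (j == 0) then 0 else
     if (i == 1) && (j == 1) then 0 else 1)).
have cE : map_mx intr c = bk 0 (rw 0 1) (cl 1 0) (mx2 0 1 1 0).
  rewrite /bk; etransitivity; first exact: (@map_block_mx _ _ _ 1 2 1 2).
  apply: f_equal4.
  - by apply/matrixP => i j; rewrite !mxE mul0rn.
  - by apply/rowP => j; rewrite !mxE; case: ifP.
  - by apply/colP => i; rewrite !mxE; case: ifP.
  - by apply: eq_mx2; rewrite !mxE.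
pose beta := Num.sqrt eta.
have beta2 : beta ^+ 2 = eta by rewrite sqr_sqrtr // ltW.
have beta1 : 1 < beta by rewrite -[1]sqrtr1 ltr_sqrt.
have beta0 : 0 < beta by apply: lt_trans beta1.
have [theta [ct st]] : exists t, cos t = beta * p /\ sin t = beta * q.
  by apply: angle_ex; rewrite !exprMn -mulrDr beta2.
have cycE : g *m map_mx intr c = Dg (beta^-1 *: rot theta) *m g.
  have -> : beta^-1 *: rot theta = mx2 p (- q) q p.
    by rewrite /rot ct st mx2Z; congr mx2; rewrite ?mulrN mulKf // gt_eqF.
  rewrite cE /Dg det_mx2 /g /B !bkM !mul0mx rw_cl !rw_mx2 !mx2_cl !rwZ !clZ cl_rw mx2M.
  rewrite ?mx2M mxE ?scale0r ?scaler0 ?addr0 ?add0r ?rwD ?clD ?mx2D.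
  have -> : (p * p - - q * q)^-1 = eta.
    have -> : p * p - - q * q = p ^+ 2 + q ^+ 2 by ring.
    by rewrite -[LHS]mul1r -{1}epq mulfK // pq gt_eqF // subr_gt0 exprn_egt1.
  have E3 : eta ^+ 2 * eta = eta + 1 by rewrite -exprSr.
  congr bk.
  - by ring.
  - congr rw; rewrite ?addr0; first by ring.
    have -> : eta * (eta ^+ 2 / Del) = (eta ^+ 2 * eta) / Del by ring.
    by rewrite E3; ring.
  - by congr cl; ring.
  - have P3 : p ^+ 3 - 3 * p * q ^+ 2 = 1 + p.
      by rewrite p2 q2; move: e3; rewrite !exprS expr0; lra.
    have Q3 : 3 * p ^+ 2 - q ^+ 2 = 1.
      by rewrite p2 q2; field.
    congr mx2; try by ring.
    + by rewrite -[RHS]addr0; move: P3; rewrite !exprS !expr0; lra.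
    + have -> : q * (p ^+ 2 - q ^+ 2) + p * (2 * p * q) = q * (3 * p ^+ 2 - q ^+ 2) by ring.
      by rewrite Q3; ring.
have c1 : \det c = 1.
  have := congr1 determinant cycE; rewrite !det_mulmx dg mulr1 mul1r det_map_mx.
  rewrite det_Dg; last by rewrite det_scale2 ?det_rot // exprn_gt0 ?invr_gt0.
  by move/eqP; rewrite -[1]/(1%:~R) eqr_int => /eqP.
pose kap := (1 + 2 * eta ^+ 3) / Del.
have kap0 : 0 < kap by rewrite divr_gt0 // addr_gt0 // mulr_gt0 // exprn_gt0.
(* The column (1, eta^2, eta) is proportional to the first column of the inverse of
   [g]; this is the dual basis at the real place. *)
have [a' [u' [v' [B' giE]]]] := bkP (invmx g).
have [a'E v'E] : a' * kap = 1 /\ kap *: v' = cl (eta ^+ 2) eta.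
  have gr : g *m bk 1 0 (cl (eta ^+ 2) eta) 0 = bk kap 0 0 0.
    rewrite /g bkM !mulmx0 rw_cl mx2_cl scaler0 !addr0 scale1r clD.
    rewrite [in RHS](_ : bk kap 0 0 0 = bk kap 0 (cl 0 0) 0); last by rewrite cl0.
    congr bk; first by rewrite /kap; field; rewrite gt_eqF.
    congr cl; last by rewrite p2; field.
    by rewrite q2 p2; move: e3; rewrite !exprS !expr0; lra.
  have := mulKmx ug (bk 1 0 (cl (eta ^+ 2) eta) 0); rewrite gr giE bkM !mulmx0 !scaler0.
  by move=> /bk_inj[+ _ + _]; rewrite mxE !addr0.
pose N : 'M[R]_3 := bk 0 (rw 1 0) 0 0.
pose gam : 'M[int]_3 := block_mx (1%:M : 'M[int]_1) (\row_j (if j == 0 then 1 else 0) : 'rV[int]_2)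
  0 1%:M.
have gamE : map_mx intr gam = 1%:M + N.
  rewrite bk1 bkD !addr0 add0r /bk; etransitivity; first exact: (@map_block_mx _ _ _ 1 2 1 2).
  apply: f_equal4; rewrite ?map_mx1 ?map_mx0 //.
  by apply/rowP => j; rewrite !mxE; case: ifP.
have gam1 : \det gam = 1.
  by rewrite /gam; etransitivity; [exact: (@det_ublock _ 1 2)|rewrite !det1 mulr1].
pose l0 := (rw 1 0 *m v') 0 0; pose l' := rw 1 0 *m B'.
have l00 : 0 < l0.
  have -> : l0 = eta ^+ 2 / kap.
    rewrite /l0.
    have -> : v' = kap^-1 *: cl (eta ^+ 2) eta by rewrite -v'E scalerA mulVf ?gt_eqF // scale1r.
    by rewrite clZ rw_cl mul0r addr0 mul1r mulrC.
  by rewrite divr_gt0 // exprn_gt0.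
have NE : N *m invmx g = bk l0 l' 0 0.
  by rewrite giE /N bkM !mul0mx mul0r scale0r scaler0 !addr0 !add0r.
have l'0 : l' 0 0 = - (l0 / Del).
  have := mulmxKV ug N; rewrite NE /g bkM => /bk_inj[+ _ _ _].
  by rewrite {1}[l']rwE rw_cl; lra.
pose dlt := 1%:M + g *m (N *m invmx g).
have gamgE : g *m map_mx intr gam = dlt *m g.
  by rewrite gamE mulmxDr mulmxDl mulmx1 mul1mx -!mulmxA mulVmx // mulmx1.
have dltE : dlt = bk (1 + l0 / Del) (Del^-1 *: l') (l0 *: cl 1 0) (1%:M + cl 1 0 *m l').
  rewrite /dlt NE bk1 /g bkM !mulmx0 !mxE !addr0 bkD !add0r.
  by rewrite [Del^-1 * l0]mulrC.
pose d := 1 + l0 / Del.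
have d0 : 0 < d by rewrite ltr_wpDr // divr_ge0 // ltW.
have v0 : l0 *: cl 1 0 != 0.
  rewrite scaler_eq0 gt_eqF //=; apply/eqP => /matrixP/(_ 0 0).
  by rewrite !mxE /=; apply/eqP; rewrite oner_eq0.
have SE : 1%:M + cl 1 0 *m l' - d^-1 *: (l0 *: cl 1 0 *m (Del^-1 *: l')) =
    mx2 (1 + l' 0 0 / d) (l' 0 1 / d) 0 1.
  rewrite {1 2}[l']rwE clZ rwZ !cl_rw mx2Z mx2_1 mx2N !mx2D.
  by rewrite /d; congr mx2; field; rewrite !gt_eqF // ltr_wpDr // ltW.
have nonconf : 2 * \det (1%:M + cl 1 0 *m l' - d^-1 *: (l0 *: cl 1 0 *m (Del^-1 *: l')))
   < hs (1%:M + cl 1 0 *m l' - d^-1 *: (l0 *: cl 1 0 *m (Del^-1 *: l'))).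
  rewrite SE det_mx2 hs_mx2 -subr_gt0.
  set X := l' 0 0 / d; set Y := l' 0 1 / d.
  have -> : (1 + X) ^+ 2 + Y ^+ 2 + (0 ^+ 2 + 1 ^+ 2) - 2 * ((1 + X) * 1 - Y * 0) =
    X ^+ 2 + Y ^+ 2 by ring.
  rewrite ltr_wpDr ?sqr_ge0 // exprn_even_gt0 //= /X l'0.
  by rewrite mulf_neq0 ?invr_eq0 ?oppr_eq0 ?mulf_neq0 ?invr_eq0 ?gt_eqF.
rewrite dltE in gamgE.
exists (Frame dg c1 beta1 (symmetry_irrational dg c1 beta1 cycE) cycE gam1 gamgE d0 v0 nonconf).
have a'0 : a' = kap^-1 by rewrite -[LHS](@mulfK _ kap) ?gt_eqF // a'E mul1r.
have HE : Hr (cl (eta ^+ 2) eta) *m invmx g = bk a' u' 0 (- cl (eta ^+ 2) eta *m u' + B').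
  rewrite giE HrE bkM !mul0mx !mul1mx mxE !addr0 mul1r scale1r; congr bk.
  by rewrite -v'E a'0 scalerN scalerA mulVf ?gt_eqF // scale1r addNr.
set B2 := - cl _ _ *m u' + B' in HE.
have dB2 : \det B2 = kap.
  have := congr1 determinant HE; rewrite det_mulmx det_Hr det_inv dg invr1 mulr1 det_bk_ub a'0.
  by move=> E; apply: (@mulfI _ kap^-1); rewrite ?invr_eq0 ?gt_eqF // -E mulVf ?gt_eqF.
have sk0 : 0 < Num.sqrt kap by rewrite sqrtr_gt0.
(* For this [x] the first column of [Hr x *m invmx g] ends in zeros, so the orbit of
   [x] is asymptotic to the frame from the start. *)
exists (cl (eta ^+ 2) eta), (Num.sqrt kap), ((Num.sqrt kap)^-1 *: B2), (kap *: u'), 1%:M.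
split; rewrite ?det1 //.
  by rewrite detZ dB2 exprVn sqr_sqrtr ?(ltW kap0) // mulVf ?gt_eqF.
rewrite map_mx1 mulmx1 scalerA mulfV ?gt_eqF // scale1r /=.
rewrite -[LHS]mulmx1 -(mulVmx ug) [LHS]mulmxA HE; congr (_ *m _).
rewrite /Dg /Ur bkM !mul0mx !mulmx0 mxE scaler0 !addr0 mulr1 mulmx1 add0r dB2 a'0.
by rewrite scalerA mulVf ?gt_eqF // scale1r.
Qed.

End FrameExistence.

(** * Upper limits, norms of the plane and lengths of vectors *)

Section Transfer.
Variable R : realType.

Lemma SL3_nbhsP (k : SL3 R -> R) : continuous k <->
  forall g e, 0 < e -> exists2 d, 0 < d &
    forall g', nrm (val g' - val g) <= d -> `|k g' - k g| <= e.
Proof.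
have mxle (A : 'M[R]_3) : `|A| <= nrm A.
  rewrite [leLHS]mx_normrE; apply/bigmax_leP; split; first exact: nrm_ge0.
  by move=> i _; exact: entry_le_nrm.
have nrmle (A : 'M[R]_3) : nrm A <= `|A| * 9.
  apply: nrm_le_entries => i j; rewrite [leRHS]mx_normrE.
  exact: le_trans (le_bigmax _ _ (i, j)).
have ballE (g g' : SL3 R) e : ball g e g' <-> `|val g - val g'| < e.
  have -> : ball g e g' = ball (val g) e (val g') by [].
  by rewrite -ball_normE.
split=> [kc g e e0|H g].
  have /cvgrPdist_le/(_ _ e0)/nbhs_ballP[d /= d0 Hd] := kc g.
  exists (d / 2) => [|g' gg']; first by rewrite divr_gt0.
  rewrite distrC; apply: Hd; apply/ballE; rewrite distrC.
  apply: le_lt_trans (mxle _) _; apply: le_lt_trans gg' _.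
  by rewrite ltr_pdivrMr // ltr_pMr ?ltr1n.
apply/(@cvgrPdist_le _ R (SL3 R) _ (nbhs_filter g)) => e e0.
have [d d0 Hd] := H g e e0.
apply/nbhs_ballP; exists (d / 9) => [|g' /ballE gg'] /=; first by rewrite divr_gt0.
rewrite distrC; apply: Hd; apply: le_trans (nrmle _) _.
by rewrite -ler_pdivlMr // distrC ltW.
Qed.

Lemma limf_esup_pinfty (k : R -> R) A :
  (forall e, 0 < e -> exists t0, forall t, t0 <= t -> k t <= A + e) ->
  (forall e t0, 0 < e -> exists2 t, t0 <= t & A - e <= k t) ->
  limf_esup (fun t => (k t)%:E) (pinfty_nbhs R) = A%:E.
Proof.
move=> Hup Hlo; apply/eqP; rewrite eq_le; apply/andP; split.
  apply/lee_addgt0Pr => e e0; have [t0 Ht0] := Hup e e0.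
  apply: (@le_trans _ _ (ereal_sup [set (k t)%:E | t in [set t | t0 < t]])).
    apply: ereal_inf_lbound; exists [set t | t0 < t] => //.
    by exists t0; split=> //; rewrite num_real.
  apply: ge_ereal_sup => _ [t /= t0t <-].
  by rewrite -EFinD lee_fin Ht0 // ltW.
apply: le_ereal_inf_tmp => _ [V [M [_ MV]] <-].
apply/lee_subgt0Pr => e e0; have [t tM kt] := Hlo e (M + 1) e0.
apply: le_ereal_sup_tmp; exists (k t)%:E; last by rewrite -EFinB lee_fin.
by exists t => //; apply: MV; apply: lt_le_trans tM; rewrite ltrDl.
Qed.

Lemma countable_enum (S : set 'cV[R]_2) : countable S ->
  exists zs : nat -> 'cV[R]_2, forall x, S x -> exists j, zs j = x.
Proof.
move=> /countable_injP[k kinj].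
exists (fun n => xget 0 [set x | S x /\ k x = n]) => x Sx; exists (k x).
have [Sy ky] := xgetPex (0 : 'cV[R]_2)
  (ex_intro (fun y => S y /\ k y = k x) x (conj Sx erefl)).
by apply: kinj => //; rewrite inE.
Qed.

End Transfer.

Section ShortestVector.
Variables (R : realType) (N : 'cV[R]_2 -> R).
Hypothesis N_norm : is_norm N.
Implicit Types (g : 'M[R]_3) (y : 'cV[R]_3) (w : 'cV[R]_2).

Let NZ (a : R) w : N (a *: w) = `|a| * N w. Proof. by case: N_norm. Qed.
Let ND w w' : N (w + w') <= N w + N w'. Proof. by case: N_norm. Qed.
Let N_eq0 w : N w = 0 -> w = 0. Proof. by case: N_norm => _ + _ _; apply. Qed.
Let N_ge0 w : 0 <= N w. Proof. by case: N_norm. Qed.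

Lemma norm_le_nrm : exists2 C, 0 < C & forall w, N w <= C * nrm w.
Proof.
exists (1 + N (delta_mx 0 0) + N (delta_mx 1 0)) => [|w].
  by rewrite -addrA ltr_pwDl // addr_ge0.
have wE : w = w 0 0 *: delta_mx 0 0 + w 1 0 *: delta_mx 1 0.
  apply/matrixP => i j; rewrite ord1 !mxE.
  by case: (ord2P i) => -> /=; ring.
rewrite {1}wE; apply: le_trans (ND _ _) _; rewrite !NZ.
have h3 := ler_wpM2r (N_ge0 (delta_mx 0 0)) (entry_le_nrm w 0 0).
have h4 := ler_wpM2r (N_ge0 (delta_mx 1 0)) (entry_le_nrm w 1 0).
have := nrm_ge0 w; lra.
Qed.

Lemma norm_dist w w' : `|N w - N w'| <= N (w - w').
Proof.
have h a b : N a <= N (a - b) + N b by rewrite -{1}[a](subrK b) ND.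
have := h w w'; have := h w' w.
rewrite -(opprB w w') -scaleN1r NZ normrN1 mul1r ler_norml => h1 h2.
by apply/andP; split; lra.
Qed.

(** All norms on the plane are equivalent, by compactness of the unit sphere. *)
Lemma nrm_le_norm : exists2 c, 0 < c & forall w, c * nrm w <= N w.
Proof.
have [C C0 NC] := norm_le_nrm.
pose k (phi : R) := N (rot phi *m cl 1 0).
have kc : continuous k.
  move=> phi; apply/cvgrPdist_le => e e0.
  have [d d0 Hd] := rot_near (divr_gt0 e0 C0).
  apply/nbhs_ballP; exists d => // psi /= /ltW phipsi.
  apply: le_trans (norm_dist _ _) _; apply: le_trans (NC _) _.
  rewrite -mulmxBl -(divfK (lt0r_neq0 C0) e) mulrC ler_wpM2r ?(ltW C0) //.
  apply: le_trans (nrmM _ _) _.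
  have -> : nrm (cl 1 0 : 'cV[R]_2) = 1.
    by rewrite /nrm sum2E !big_ord1 !mxE /= normr0 normr1 addr0.
  by rewrite mulr1 Hd.
have pp : - pi <= pi :> R by have := pi_ge0 R; lra.
have [phi0 _ kmin] := EVT_min pp (continuous_subspaceT kc).
have k0 : 0 < k phi0.
  rewrite lt_def N_ge0 andbT; apply/eqP => /N_eq0 k00.
  have := congr1 (mulmx (rot (- phi0))) k00; rewrite mulmxA rotNK mul1mx mulmx0.
  by move=> /matrixP/(_ 0 0); rewrite !mxE /=; apply/eqP; rewrite oner_eq0.
exists (k phi0 / 2) => [|w]; first by rewrite divr_gt0.
pose r := Num.sqrt (w 0 0 ^+ 2 + w 1 0 ^+ 2).
have r2 : r ^+ 2 = w 0 0 ^+ 2 + w 1 0 ^+ 2 by rewrite sqr_sqrtr // addr_ge0 ?sqr_ge0.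
have [r0|r0] := eqVneq r 0.
  move: r2; rewrite r0 expr0n /= => /esym/eqP.
  rewrite paddr_eq0 ?sqr_ge0 // !sqrf_eq0 => /andP[/eqP w0 /eqP w1].
  suff -> : w = 0 by rewrite nrm0 mulr0 N_ge0.
  by apply/colP => i; rewrite mxE; case: (ord2P i) => ->.
have rp : 0 < r by rewrite lt_def r0 sqrtr_ge0.
have [phi phi_pi [ca sa]] : exists2 phi, - pi <= phi <= pi &
    cos phi = w 0 0 / r /\ sin phi = w 1 0 / r.
  by apply: principal_angle_ex; rewrite !expr_div_n -mulrDl -r2 divff // expf_neq0.
have wE : w = r *: (rot phi *m cl 1 0).
  rewrite /rot mx2_cl clZ ca sa !mulr0 !mulr1 !addr0 ![r * _]mulrC !divfK //.
  by apply/colP => i; rewrite mxE; case: (ord2P i) => ->.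
have kr : k phi0 <= k phi by apply: kmin; rewrite in_itv.
rewrite wE NZ nrmZ ger0_norm ?(ltW rp) //.
have n2 : nrm (rot phi *m cl 1 0) <= 2.
  rewrite /rot mx2_cl /nrm sum2E !big_ord1 !mxE /= !mulr0 !mulr1 !addr0.
  have c1 : `|cos phi| <= 1 by rewrite ler_norml cos_geN1 cos_le1.
  have s1 : `|sin phi| <= 1 by rewrite ler_norml sin_geN1 sin_le1.
  by lra.
rewrite mulrCA ler_pM2l //; apply: le_trans kr.
by rewrite mulrAC ler_pdivrMr // ler_pM2l.
Qed.

(** With this gauge the orbit of the lattice of [x] makes the vector with components
    q and p - q x shortest when the two terms are equal, with minimal value
    (q N(p - q x)^2)^(1/3); this is the dictionary with Diophantine approximation. *)
Definition gauge y := Num.max `|@usubmx _ 1 2 1 y 0 0| (N (@dsubmx _ 1 2 1 y)).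

(** The infimum is used instead of the minimum, as approximating it is enough. *)
Definition shortest g := inf [set gauge (g *m map_mx intr v) | v in [set v : 'cV[int]_3 | v != 0]].

Lemma gauge_ge0 y : 0 <= gauge y.
Proof. by rewrite le_max normr_ge0. Qed.

Lemma gaugeD y y' : gauge (y + y') <= gauge y + gauge y'.
Proof.
rewrite ge_max; apply/andP; split.
  rewrite !mxE; apply: le_trans (ler_normD _ _) _.
  by rewrite lerD // le_max mxE lexx.
have -> : @dsubmx _ 1 2 1 (y + y') = @dsubmx _ 1 2 1 y + @dsubmx _ 1 2 1 y'.
  by apply/colP => i; rewrite !mxE.
by apply: le_trans (ND _ _) _; rewrite lerD // le_max lexx orbT.
Qed.

Lemma gaugeN y : gauge (- y) = gauge y.
Proof.
rewrite /gauge; have -> : @dsubmx _ 1 2 1 (- y) = -1 *: @dsubmx _ 1 2 1 y.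
  by apply/colP => i; rewrite !mxE mulN1r.
by rewrite NZ normrN1 mul1r !mxE normrN.
Qed.

Lemma gauge_nrm : exists2 C, 0 < C & forall y, gauge y <= C * nrm y.
Proof.
have [C C0 NC] := norm_le_nrm; exists (1 + C) => [|y]; first by rewrite addr_gt0.
have yE : nrm y = nrm (@usubmx _ 1 2 1 y) + nrm (@dsubmx _ 1 2 1 y).
  by rewrite -[in LHS](@vsubmxK _ 1 2 1 y) [LHS](@nrm_col R 1 2 1).
have u0 := nrm_ge0 (@usubmx _ 1 2 1 y); have d0 := nrm_ge0 (@dsubmx _ 1 2 1 y).
rewrite ge_max nrm_entry11 yE; apply/andP; split.
  by have := mulr_ge0 (ltW C0) u0; have := mulr_ge0 (ltW C0) d0; lra.
by apply: le_trans (NC _) _; have := mulr_ge0 (ltW C0) u0; lra.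
Qed.

Lemma nrm_gauge : exists2 c, 0 < c & forall y, c * nrm y <= gauge y.
Proof.
have [c c0 Nc] := nrm_le_norm.
exists (Num.min 1 c / 2) => [|y]; first by rewrite divr_gt0 // lt_min ltr01.
have yE : nrm y = nrm (@usubmx _ 1 2 1 y) + nrm (@dsubmx _ 1 2 1 y).
  by rewrite -[in LHS](@vsubmxK _ 1 2 1 y) [LHS](@nrm_col R 1 2 1).
have u0 := nrm_ge0 (@usubmx _ 1 2 1 y); have d0 := nrm_ge0 (@dsubmx _ 1 2 1 y).
have m1 : Num.min 1 c <= 1 by rewrite ge_min lexx.
have mc : Num.min 1 c <= c by rewrite ge_min lexx orbT.
have h1 : Num.min 1 c * nrm (@usubmx _ 1 2 1 y) <= gauge y.
  by rewrite le_max -nrm_entry11; apply/orP; left; rewrite nrm_entry11 ler_piMl.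
have h2 : Num.min 1 c * nrm (@dsubmx _ 1 2 1 y) <= gauge y.
  rewrite le_max; apply/orP; right; apply: le_trans (Nc _).
  by rewrite ler_wpM2r.
rewrite yE; move: h1 h2; lra.
Qed.

End ShortestVector.

(** * The length of the shortest vector *)

Section ShortestVectorFunction.
Variables (R : realType) (N : 'cV[R]_2 -> R).
Hypothesis N_norm : is_norm N.
Implicit Types (g : 'M[R]_3) (v : 'cV[int]_3).

Let lb g : has_lbound [set gauge N (g *m map_mx intr v) | v in [set v : 'cV[int]_3 | v != 0]].
Proof. by exists 0 => _ [v _ <-]; exact: gauge_ge0. Qed.

Let e0_neq0 : (delta_mx 0 0 : 'cV[int]_3) != 0.
Proof. by apply/eqP => /matrixP/(_ 0 0); rewrite !mxE. Qed.

Lemma shortest_le g v : v != 0 -> shortest N g <= gauge N (g *m map_mx intr v).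
Proof. by move=> v0; apply: ge_inf => //; exists v. Qed.

Lemma le_shortest g a : (forall v, v != 0 -> a <= gauge N (g *m map_mx intr v)) ->
  a <= shortest N g.
Proof.
move=> ag; apply: lb_le_inf; last by move=> _ [v v0 <-]; exact: ag.
by exists (gauge N (g *m map_mx intr (delta_mx 0 0))), (delta_mx 0 0).
Qed.

Lemma shortest_near g e : 0 < e ->
  exists2 v, v != 0 & gauge N (g *m map_mx intr v) < shortest N g + e.
Proof.
move=> e0; have hi : has_inf [set gauge N (g *m map_mx intr v) | v in [set v : 'cV[int]_3 | v != 0]].
  split=> //; exists (gauge N (g *m map_mx intr (delta_mx 0 0))), (delta_mx 0 0) => //.
by have [_ [v v0 <-] ve] := inf_adherent e0 hi; exists v.
Qed.

Lemma nrm_int_ge1 n (v : 'cV[int]_n) : v != 0 -> 1 <= nrm (map_mx intr v : 'cV[R]_n).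
Proof.
move=> v0; have /existsP[i vi] : [exists i, v i 0 != 0].
  apply: contraNT v0 => /existsPn v0; apply/eqP/colP => i.
  by rewrite mxE; apply/eqP; have := v0 i; rewrite negbK.
apply: le_trans (entry_le_nrm _ i 0); rewrite mxE -intr_norm.
by rewrite -[1]/(1%:~R) ler_int; move: vi; lia.
Qed.

(** A lattice is discrete, uniformly in all directions. *)
Lemma gauge_int_ge g : \det g = 1 -> exists2 a, 0 < a & forall v, v != 0 ->
  a * nrm (map_mx intr v : 'cV[R]_3) <= gauge N (g *m map_mx intr v).
Proof.
move=> dg; have [c c0 Nc] := nrm_gauge N_norm.
have ug : g \in unitmx by rewrite unitmxE dg unitr1.
pose n := nrm (invmx g) + 1; have n0 : 0 < n by rewrite ltr_wpDl ?nrm_ge0.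
exists (c / n) => [|v' v0]; first by rewrite divr_gt0.
apply: le_trans (Nc _); rewrite -mulrA ler_pM2l // mulrC ler_pdivrMr //.
rewrite -{1}(mulKmx ug (map_mx intr v')) mulrC; apply: le_trans (nrmM _ _) _.
by rewrite ler_wpM2r ?nrm_ge0 // lerDl.
Qed.

Lemma shortest_gt0 g : \det g = 1 -> 0 < shortest N g.
Proof.
move=> /gauge_int_ge[a a0 Ha]; apply: (lt_le_trans a0).
apply: le_shortest => v v0; apply: le_trans (Ha v v0).
by apply: ler_peMr; [exact: ltW|exact: nrm_int_ge1].
Qed.

Lemma shortest_lattice_function : lattice_function (fun g => (shortest N g)^-1).
Proof.
split=> [g W dg W1|g e dg e0].
  have uW : W \in unitmx by rewrite unitmxE W1 unitr1.
  congr (_^-1); apply/eqP; rewrite eq_le; apply/andP; split.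
    apply: le_shortest => v v0; rewrite -[v](mulKVmx uW) map_mxM mulmxA.
    apply: shortest_le; apply: contra_neq v0 => Wv.
    by rewrite -[v](mulKVmx uW) Wv mulmx0.
  apply: le_shortest => v v0; rewrite -mulmxA -map_mxM; apply: shortest_le.
  by apply: contra_neq v0 => Wv; rewrite -[v](mulKmx uW) Wv mulmx0.
have [C C0 NC] := gauge_nrm N_norm; have [a a0 Ha] := gauge_int_ge dg.
have s0 := shortest_gt0 dg; set s := shortest N g in s0 *.
pose K := C / a; have K0 : 0 < K by rewrite divr_gt0.
exists (Num.min (2^-1) (e * s / 2) / K) => [|g' dg' gg'].
  by rewrite divr_gt0 // lt_min invr_gt0 ltr0n divr_gt0 // mulr_gt0.
have s'0 := shortest_gt0 dg'; set s' := shortest N g' in s'0 *.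
pose k := K * nrm (g' - g); have k0 : 0 <= k by rewrite mulr_ge0 ?nrm_ge0 ?ltW.
have [k1 ke] : k <= 2^-1 /\ k <= e * s / 2.
  by move: gg'; rewrite ler_pdivlMr // mulrC -/k le_min => /andP.
(* Nearby lattices have all their vectors nearby in relative terms, hence also
   their infima. *)
have pert v : v != 0 -> gauge N ((g' - g) *m map_mx intr v) <= k * gauge N (g *m map_mx intr v).
  move=> v0; apply: le_trans (NC _) _; apply: le_trans (ler_wpM2l (ltW C0) (nrmM _ _)) _.
  have := ler_wpM2l k0 (Ha v v0); apply: le_trans.
  by rewrite le_eqVlt /k /K; apply/orP; left; apply/eqP; field; rewrite gt_eqF.
have up : s' <= (1 + k) * s.
  apply/ler_addgt0Pr => d d0; have [|v v0 vs] := @shortest_near g (d / (1 + k)).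
    by rewrite divr_gt0 // ltr_wpDr.
  apply: le_trans (shortest_le _ v0) _.
  rewrite -(subrK g g') addrC mulmxDl; apply: le_trans (gaugeD N_norm _ _) _.
  have := pert v v0; have h := vs; rewrite -/s in h.
  have k10 : 0 < 1 + k by rewrite ltr_wpDr.
  have : (1 + k) * gauge N (g *m map_mx intr v) <= (1 + k) * (s + d / (1 + k)).
    by rewrite ler_pM2l // ltW.
  have -> : (1 + k) * (s + d / (1 + k)) = (1 + k) * s + d by field; rewrite gt_eqF.
  move: (gauge N ((g' - g) *m _)) (gauge N (g *m _)) => y x; lra.
have lo : (1 - k) * s <= s'.
  apply: le_shortest => v v0.
  have : gauge N (g *m map_mx intr v) <= gauge N (g' *m map_mx intr v) +
      gauge N ((g' - g) *m map_mx intr v).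
    rewrite -[gauge N ((g' - g) *m _)]gaugeN // -mulNmx opprB.
    rewrite -{1}(subrK g' g) addrC mulmxDl; exact: gaugeD.
  have := pert v v0; have := shortest_le g v0; rewrite -/s.
  have k1' : 0 <= 1 - k by lra.
  move: (gauge N ((g' - g) *m _)) (gauge N (g' *m _)) (gauge N (g *m _)) => z y x h1 h2 h3.
  have := ler_wpM2l k1' h1; lra.
have -> : s'^-1 - s^-1 = (s - s') / (s' * s) by field; rewrite !gt_eqF.
rewrite normrM normfV [`|s' * s|]ger0_norm; last by rewrite mulr_ge0 ?ltW.
rewrite ler_pdivrMr ?mulr_gt0 //.
have d1 : `|s - s'| <= k * s by rewrite ler_norml; apply/andP; split; lra.
apply: le_trans d1 _; rewrite mulrA ler_wpM2r ?(ltW s0) //.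
apply: le_trans ke _; rewrite -mulrA ler_pM2l //.
by have : 2^-1 * s <= (1 - k) * s; [rewrite ler_pM2r //; lra|lra].
Qed.

Lemma shortest_diverging : diverging (fun g => (shortest N g)^-1).
Proof.
move=> A; have [C C0 NC] := gauge_nrm N_norm.
have A0 : 0 < `|A| + 1 by rewrite ltr_wpDl.
exists (C^-1 / (`|A| + 1)) => [|g v dg v0 gv]; first by rewrite divr_gt0 ?invr_gt0.
apply: (@lt_le_trans _ _ (`|A| + 1)); first by rewrite (le_lt_trans (ler_norm A)) // ltrDl.
rewrite -[leLHS]invrK lef_pV2 ?posrE ?invr_gt0 ?shortest_gt0 //.
apply: le_trans (shortest_le g v0) _; apply: le_trans (NC _) _.
by rewrite mulrC -ler_pdivlMr // mulrC.
Qed.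

End ShortestVectorFunction.

(** * Proper functions on the space of lattices *)

Section LatticeSpectrum.
Variable R : realType.

Lemma lattice_spectrum_ray (f : 'M[R]_3 -> R) : lattice_function f -> diverging f ->
  exists2 T, 0 < T & forall A, T < A -> forall zs : nat -> 'cV[R]_2, exists x,
    [/\ forall j, x != zs j,
        forall e, 0 < e -> exists t0, forall t, t0 <= t -> orbit_fun f x t <= A + e
      & forall e t0, 0 < e -> exists2 t, t0 <= t & A - e <= orbit_fun f x t].
Proof.
move=> f_lat; have [F [x [b [m [u start]]]]] := frame_exists R.
have SE : Su F 0 = DD F - (dd F)^-1 *: (vv F *m ee F).
  by rewrite /Su /wu au0 eu0 -scalemxAl.
have dS : \det (Su F 0) = (dd F)^-1 by rewrite det_Su au0 // gt_eqF ?dd_gt0.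
have [||beta0] := @half_turn_ex R (Su F 0).
- by rewrite dS invr_gt0 dd_gt0.
- by rewrite SE schur_nonconformal.
rewrite dS sqrtrV ?(ltW (dd_gt0 F)) // invrK => tau_half tau_hyp.
exact: (orbit_spectrum_ray f_lat erefl tau_half tau_hyp start).
Qed.

Lemma is_norm_nrm : is_norm (@nrm R 2 1).
Proof.
split; [exact: nrm_ge0| |exact: nrmZ|exact: nrmD].
by move=> x /eqP; rewrite nrm_eq0 => /eqP.
Qed.

Definition SL3_of (g : 'M[R]_3) (dg : \det g = 1) : SL3 R :=
  SigSub (mem_set dg : g \in SL3 R).

Definition of_bases (F : X3 R -> R) (g : 'M[R]_3) : R :=
  if pselect (\det g = 1) is left dg then F (lattice (SL3_of dg)) else 0.

Lemma of_basesE F (k : SL3 R) : of_bases F (val k) = F (lattice k).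
Proof.
rewrite /of_bases; case: pselect => [dk|]; last by case; exact: det_SL3.
by congr (F (lattice _)); apply: val_inj.
Qed.

Lemma of_bases_det F g (dg : \det g = 1) : of_bases F g = F (lattice (SL3_of dg)).
Proof. exact: of_basesE F (SL3_of dg). Qed.

Lemma orbit_of_bases F x t :
  orbit_fun (of_bases F) x t = F (SL3_act (flow t) (lattice (horo x))).
Proof. by rewrite SL3_actE -of_basesE. Qed.

Lemma lattice_mul_int (k k' : SL3 R) (W : 'M[int]_3) : \det W = 1 ->
  val k' = val k *m map_mx intr W -> lattice k = lattice k'.
Proof. by move=> W1 kE; apply/eqmodP/asboolP; exists W. Qed.

Lemma lattice_function_of_bases F : continuous F -> lattice_function (of_bases F).
Proof.
move=> Fc; split=> [g W dg W1|g e dg e0].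
  have dgW : \det (g *m map_mx intr W) = 1.
    by rewrite det_mulmx dg det_map_intr // mulr1.
  rewrite (of_bases_det F dg) (of_bases_det F dgW).
  by congr F; symmetry; apply: lattice_mul_int W1 _.
have /SL3_nbhsP/(_ (SL3_of dg) e e0)[d d0 Hd] : continuous (F \o @lattice R).
  by move=> k; apply: continuous_comp; [exact: pi_continuous|exact: Fc].
exists d => // g' dg' gg'.
rewrite (of_bases_det F dg) (of_bases_det F dg').
exact: Hd.
Qed.

(** The inverse of the length of the shortest vector is continuous on the space of
    lattices, hence bounded on the compact sublevel sets of [F]; so [F] is large
    where that length is small. *)
Lemma diverging_of_proper F : (forall L, 0 <= F L) -> proper_map F ->
  diverging (of_bases F).
Proof.
move=> F0 Fp A.
pose s (k : SL3 R) := (shortest (@nrm R 2 1) (val k))^-1.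
have [s_inv s_cont] := shortest_lattice_function is_norm_nrm.
have sc : continuous s.
  apply/SL3_nbhsP => k e e0; have [d d0 Hd] := s_cont _ _ (det_SL3 k) e0.
  by exists d => // k' kk'; apply: Hd; rewrite ?det_SL3.
have shomo (k k' : SL3 R) : lattice k = lattice k' -> s k = s k'.
  move=> /eqmodP/asboolP[W W1 kE].
  by rewrite /s kE (s_inv _ _ (det_SL3 k) W1).
have phic : continuous (s \o repr : X3 R -> R).
  by apply: (repr_comp_continuous sc) => k k' /eqP/shomo ->.
have sphi (k : SL3 R) : (s \o repr : X3 R -> R) (lattice k) = s k.
  by apply: shomo; exact: reprK.
have cK : compact (F @^-1` `[0, `|A|]%classic) by apply/Fp/segment_compact.
have [M [Mr HM]] : bounded_set ((s \o repr) @` (F @^-1` `[0, `|A|]%classic)).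
  apply: compact_bounded; apply: continuous_compact cK.
  exact: continuous_subspaceT.
have [d d0 Hd] := shortest_diverging is_norm_nrm (M + 1).
exists d => // g v dg v0 gv; have sM := Hd _ _ dg v0 gv.
rewrite (of_bases_det F dg) ltNge; apply/negP => FA.
have M1 : M < M + 1 by rewrite ltrDl.
have : `|(s \o repr : X3 R -> R) (lattice (SL3_of dg))| <= M + 1.
  apply: HM M1 _ _; exists (lattice (SL3_of dg)) => //=.
  by rewrite in_itv /= F0 (le_trans FA) // ler_norm.
by rewrite sphi => /ler_normlW; apply/negP; rewrite -ltNge.
Qed.

(** Cantor's argument: an enumeration of the set would be avoided by one of its
    members. *)
Lemma not_countable_of_avoiding (S : set 'cV[R]_2) :
  (forall zs : nat -> 'cV[R]_2, exists2 x, (forall j, x != zs j) & S x) -> ~ countable S.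
Proof.
move=> H /countable_enum[zs zsP]; have [x xzs Sx] := H zs.
by have [j jx] := zsP _ Sx; have := xzs j; rewrite jx eqxx.
Qed.

Lemma proper_spectrum_ray (F : X3 R -> R) : (forall L, 0 <= F L) -> continuous F ->
  proper_map F -> exists T : R,
    [/\ 0 < T, EFin @` `]T, +oo[ `<=` range (limsup_orbit F)
      & forall A : R, T < A -> ~ countable [set x : 'cV[R]_2 | limsup_orbit F x = A%:E]].
Proof.
move=> F0 Fc Fp.
have [T T0 ray] := lattice_spectrum_ray (lattice_function_of_bases Fc) (diverging_of_proper F0 Fp).
have key A : T < A -> forall zs : nat -> 'cV[R]_2,
    exists2 x, (forall j, x != zs j) & limsup_orbit F x = A%:E.
  move=> TA zs; have [x [xzs up lo]] := ray A TA zs; exists x => //.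
  apply: limf_esup_pinfty => [e /up[t0 H]|e t0 /(lo _ t0)[t tt0 H]].
    by exists t0 => t /H; rewrite orbit_of_bases.
  by exists t => //; rewrite -orbit_of_bases.
exists T; split=> // [_ [A /= TA <-]|A TA].
  rewrite in_itv /= andbT in TA.
  by have [x _ xA] := key A TA (fun=> 0); exists x.
exact/not_countable_of_avoiding/key.
Qed.

End LatticeSpectrum.

(** * Simultaneous approximation *)

Section SimultaneousApproximation.
Variables (R : realType) (N : 'cV[R]_2 -> R).
Hypothesis N_norm : is_norm N.
Implicit Types (x : 'cV[R]_2) (q : nat) (p : 'cV[int]_2).

Lemma N_ge0 w : 0 <= N w. Proof. by case: N_norm. Qed.

Lemma limn_einf_eq (k : nat -> R) rho :
  (forall e, 0 < e -> exists n0, forall n, (n0 <= n)%N -> rho - e <= k n) ->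
  (forall e n0, 0 < e -> exists2 n, (n0 <= n)%N & k n <= rho + e) ->
  limn_einf (fun n => (k n)%:E) = rho%:E.
Proof.
move=> Hlo Hup; rewrite /limn_einf /limn_esup.
suff -> : limf_esup (\- (fun n => (k n)%:E))%E \oo = (- rho)%:E by rewrite EFinN oppeK.
apply/eqP; rewrite eq_le; apply/andP; split.
  apply/lee_addgt0Pr => e e0; have [n0 Hn0] := Hlo e e0.
  apply: (@le_trans _ _ (ereal_sup [set (- (k n)%:E)%E | n in [set n | (n0 <= n)%N]])).
    by apply: ereal_inf_lbound; exists [set n | (n0 <= n)%N] => //; exists n0.
  apply: ge_ereal_sup => _ [n /= n0n <-].
  rewrite /= -EFinD lee_fin; have := Hn0 n n0n; lra.
apply: le_ereal_inf_tmp => _ [V [n0 _ n0V] <-].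
apply/lee_subgt0Pr => e e0; have [n n0n kn] := Hup e n0 e0.
apply: le_ereal_sup_tmp; exists (- (k n)%:E)%E; first by exists n => //; apply: n0V.
by rewrite /= -EFinB lee_fin; lra.
Qed.

Lemma torus_norm_le y p : torus_norm N y <= N (y - map_mx intr p).
Proof. by apply: ge_inf; [exists 0 => _ [p' _ <-]; exact: N_ge0|exists p]. Qed.

Lemma le_torus_norm y a : (forall p, a <= N (y - map_mx intr p)) -> a <= torus_norm N y.
Proof.
move=> H; apply: lb_le_inf; last by move=> _ [p _ <-].
by exists (N (y - map_mx intr 0)), 0.
Qed.

Lemma orbit_gauge x t (q : int) p :
  gauge N (flow_mx t *m Hr x *m map_mx intr (@col_mx _ 1 2 1 q%:M p : 'cV[int]_3)) =
  Num.max (expR (- (2 * t)) * `|q%:~R|) (expR t * N (q%:~R *: x - map_mx intr p)).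
Proof.
have -> : map_mx intr (@col_mx _ 1 2 1 q%:M p : 'cV[int]_3) =
    @col_mx _ 1 2 1 (q%:~R)%:M (map_mx intr p) :> 'cV[R]_3.
  etransitivity; first exact: (@map_col_mx _ _ _ 1 2 1).
  by rewrite map_scalar_mx.
have -> : flow_mx t *m Hr x *m (@col_mx _ 1 2 1 (q%:~R)%:M (map_mx intr p) : 'cV[R]_3) =
    @col_mx _ 1 2 1 (expR (- (2 * t)) * q%:~R)%:M
     (expR t *: (map_mx intr p - q%:~R *: x)) :> 'cV[R]_3.
  rewrite -mulmxA flow_mxE /Dg HrE /bk.
  rewrite [X in _ *m X](@mul_block_col _ 1 2 1 2 1) !mul1mx mul0mx addr0.
  rewrite [LHS](@mul_block_col _ 1 2 1 2 1) !mul0mx addr0 add0r.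
  rewrite mulNmx !mul_mx_scalar addrC mul_scalar_mx scale_scalar_mx mulrC.
  by rewrite det_scalar expRN expRM_natl.
rewrite /gauge [@usubmx _ _ _ _ _](@col_mxKu _ 1 2 1) [@dsubmx _ _ _ _ _](@col_mxKd _ 1 2 1).
rewrite mxE eqxx mulr1n normrM ger0_norm ?expR_ge0 //; congr Num.max.
have [_ _ NZ _] := N_norm.
rewrite NZ ger0_norm ?expR_ge0 // -opprB -scaleN1r NZ normrN1 mul1r //.
Qed.

Lemma cube_root (y : R) : 0 < y -> exists2 a, 0 < a & a ^+ 3 = y.
Proof.
move=> y0; exists (expR (ln y / 3)); first exact: expR_gt0.
by rewrite -expRM_natl mulrC divfK // lnK.
Qed.

(** A level [A] of the inverse shortest length and the constant [rho] of Diophantine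
    approximation correspond to each other by A^3 rho^2 = 1. *)
Lemma dual_level (rho : R) : 0 < rho -> exists2 a, 0 < a & a ^+ 3 * rho ^+ 2 = 1.
Proof.
move=> r0; have [a a0 aE] := @cube_root (rho ^- 2) (ltac:(by rewrite invr_gt0 exprn_gt0)).
by exists a => //; rewrite aE mulVf // expf_neq0 // gt_eqF.
Qed.

Lemma dual_level_lt (a b r s : R) : 0 < a -> 0 < b -> 0 < r -> 0 < s ->
  a ^+ 3 * r ^+ 2 = 1 -> b ^+ 3 * s ^+ 2 = 1 -> r < s -> b < a.
Proof.
move=> a0 b0 r0 s0 aE bE rs.
rewrite -(@ltr_pXn2r _ 3) ?nnegrE ?(ltW a0) ?(ltW b0) //.
rewrite -(@ltr_pM2r _ (r ^+ 2)) ?exprn_gt0 // aE -bE ltr_pM2l ?exprn_gt0 //.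
by rewrite ltr_pXn2r ?nnegrE ?ltW.
Qed.

Lemma sqrt_scale_le (rho d : R) q : 0 <= rho -> 0 <= d ->
  rho ^+ 2 <= q%:R * d ^+ 2 -> rho <= Num.sqrt q%:R * d.
Proof.
move=> r0 d0 H; rewrite -(@ler_pXn2r _ 2) ?nnegrE ?mulr_ge0 ?sqrtr_ge0 //.
by rewrite exprMn sqr_sqrtr.
Qed.

Lemma sqrt_scale_ge (rho d : R) q : 0 <= rho -> 0 <= d ->
  q%:R * d ^+ 2 <= rho ^+ 2 -> Num.sqrt q%:R * d <= rho.
Proof.
move=> r0 d0 H; rewrite -(@ler_pXn2r _ 2) ?nnegrE ?mulr_ge0 ?sqrtr_ge0 //.
by rewrite exprMn sqr_sqrtr.
Qed.

Let f (g : 'M[R]_3) := (shortest N g)^-1.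

Let det_orbit x t : \det (flow_mx t *m Hr x) = 1.
Proof. by rewrite det_mulmx det_flow det_Hr mulr1. Qed.

(** An upper bound for the observable along the orbit forbids good rational
    approximations: test it at the time when the vector attached to the
    approximation has equal components. *)
Lemma approx_lower x (A rho rho' : R) : 0 < A -> 0 < rho' -> rho' < rho ->
  A ^+ 3 * rho ^+ 2 = 1 ->
  (forall e, 0 < e -> exists t0, forall t, t0 <= t -> orbit_fun f x t <= A + e) ->
  exists Q, forall q, (Q <= q)%N -> forall p,
    rho' <= Num.sqrt q%:R * N (q%:R *: x - map_mx intr p).
Proof.
move=> A0 r'0 r'r AE up; have [A' A'0 A'E] := dual_level r'0.
have AA' : A < A' by apply: (dual_level_lt _ _ _ _ A'E AE r'r) => //; exact: lt_trans r'r.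
have [|t0 Ht0] := up (A' - A); first by rewrite subr_gt0.
have Hg t (q : nat) p : t0 <= t -> (0 < q)%N ->
    A'^-1 <= Num.max (expR (- (2 * t)) * q%:R) (expR t * N (q%:R *: x - map_mx intr p)).
  move=> /Ht0; rewrite addrC subrK /orbit_fun /f => H q0.
  have -> : q%:R = (q%:Z)%:~R :> R by [].
  have := orbit_gauge x t q p; rewrite ger0_norm ?ler0n // => <-.
  apply: le_trans (shortest_le _ _ _); last first.
    apply: contraTneq q0 => /(congr1 (@usubmx _ 1 2 1))/matrixP/(_ 0 0).
    by rewrite col_mxKu !mxE eqxx mulr1n => -[->].
  by rewrite -[leRHS]invrK lef_pV2 ?posrE ?invr_gt0 ?shortest_gt0.
pose E := expR (3 * t0); have E0 : 0 < E := expR_gt0 _.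
exists (Num.trunc (rho' * E)).+1 => q Qq p.
have q0 : (0 < q)%N by apply: leq_trans Qq.
have qR : 0 < q%:R :> R by rewrite ltr0n.
have qE : rho' * E <= q%:R.
  by rewrite ltW // (lt_le_trans (truncnS_gt _)) // ler_nat.
set d := N _; have d0 : 0 <= d := N_ge0 _.
have [dE|dn0] := eqVneq d 0.
  pose t := Num.max t0 (A' * q%:R).
  have t1 : A' * q%:R <= t by rewrite le_max lexx orbT.
  have := Hg t q p _ q0; rewrite le_max lexx -/d dE mulr0 => /(_ isT).
  have Aq : 0 < A' * q%:R by rewrite mulr_gt0.
  have e2 : A' * q%:R < expR (2 * t).
    by apply: lt_le_trans (expR_ge1Dx _); lra.
  rewrite le_max (leNgt _ 0) invr_gt0 A'0 orbF expRN mulrC ler_pdivlMr ?expR_gt0 //.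
  move=> h; have := ler_wpM2l (ltW A'0) h.
  by rewrite mulrA mulfV ?gt_eqF // mul1r leNgt e2.
have dp : 0 < d by rewrite lt_def dn0.
(* The time at which both components of the vector have the same size. *)
pose t := ln (q%:R / d) / 3.
have e3 : expR t ^+ 3 = q%:R / d.
  by rewrite -expRM_natl mulrC divfK // lnK // posrE divr_gt0.
have [tt0|/ltW tt0] := lerP t0 t; last first.
  have qd : q%:R / d <= E by rewrite -e3 /E -expRM_natl ler_expR ler_pM2l.
  have qdE : q%:R / E <= d by rewrite ler_pdivrMr // mulrC -ler_pdivrMr.
  apply: (@le_trans _ _ (1 * (q%:R / E))); first by rewrite mul1r ler_pdivlMr.
  rewrite ler_pM // ?divr_ge0 ?(ltW E0) ?(ltW qR) //.
  by rewrite -{1}sqrtr1; apply: ler_wsqrtr; rewrite ler1n.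
apply: sqrt_scale_le => //; first exact: ltW.
have ed : expR (- (2 * t)) * q%:R = expR t * d.
  rewrite expRN expRM_natl; apply: (@mulfI _ (expR t ^+ 2)).
    by rewrite expf_neq0 // gt_eqF // expR_gt0.
  rewrite mulVKf ?expf_neq0 ?gt_eqF ?expR_gt0 // mulrA -exprSr e3 divfK //.
have := Hg t q p tt0 q0; rewrite -/d ed maxxx => H.
have H3 : A'^-1 ^+ 3 <= (expR t * d) ^+ 3.
  by rewrite lerXn2r ?nnegrE ?invr_ge0 ?(ltW A'0) ?mulr_ge0 ?expR_ge0.
have <- : A'^-1 ^+ 3 = rho' ^+ 2.
  by rewrite exprVn; apply: (@mulfI _ (A' ^+ 3)); rewrite ?A'E ?mulfV // expf_neq0 // gt_eqF.
apply: le_trans H3 _; rewrite exprMn e3 exprS mulrA divfK //.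
Qed.

(** Conversely a large value of the observable comes from a short vector, that
    is a good approximation; its denominator is large because a multiple of a
    small one would contradict the preceding bound. *)
Lemma approx_upper x (A rho rho' : R) Q : 0 < A -> 0 < rho -> rho < rho' ->
  A ^+ 3 * rho ^+ 2 = 1 ->
  (exists Q0, forall q, (Q0 <= q)%N -> forall p,
    rho / 2 <= Num.sqrt q%:R * N (q%:R *: x - map_mx intr p)) ->
  (forall e t0, 0 < e -> exists2 t, t0 <= t & A - e <= orbit_fun f x t) ->
  exists q, (Q <= q)%N /\
    exists p, Num.sqrt q%:R * N (q%:R *: x - map_mx intr p) <= rho'.
Proof.
move=> A0 r0 rr' AE [Q0 HQ0] lo.
have r'0 : 0 < rho' by apply: lt_trans rr'.
have [A' A'0 A'E] := dual_level r'0.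
have A'A : A' < A by exact: (dual_level_lt _ _ _ _ AE A'E rr').
have [c c0 Nc] := nrm_le_norm N_norm.
have [_ _ NZ _] := N_norm.
pose mu := A'^-1; have mu0 : 0 < mu by rewrite invr_gt0.
pose n : R := Q0.+1%:R; have n1 : 1 <= n by rewrite ler1n.
have n0 : 0 < n by apply: lt_le_trans n1.
pose t1 := mu / c + 2 * (n * Q%:R * n * mu) / rho.
have t10 : 0 <= mu / c by rewrite divr_ge0 // ltW.
have t11 : 0 <= 2 * (n * Q%:R * n * mu) / rho by rewrite divr_ge0 ?(ltW r0) // !mulr_ge0 // ltW.
have [|t tt1 ft] := lo ((A - A') / 2) t1; first by rewrite divr_gt0 // subr_gt0.
have et : t1 < expR t by apply: lt_le_trans (expR_ge1Dx _); rewrite /t1 in tt1 *; lra.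
have sh : shortest N (flow_mx t *m Hr x) < mu.
  rewrite -[ltLHS]invrK ltf_pV2 ?posrE ?invr_gt0 ?shortest_gt0 //.
  by move: ft; rewrite /orbit_fun /f; lra.
have sh0 : 0 < mu - shortest N (flow_mx t *m Hr x) by rewrite subr_gt0.
have [v v0] := shortest_near N (flow_mx t *m Hr x) sh0.
pose q0 := @usubmx _ 1 2 1 v 0 0; pose p0 := @dsubmx _ 1 2 1 v.
have vE : v = @col_mx _ 1 2 1 q0%:M p0.
  by rewrite -mx11_scalar; symmetry; exact: (@vsubmxK _ 1 2 1 v).
rewrite addrC subrK vE orbit_gauge gt_max => /andP[g1 g2].
have [q [p [qq0 g3]]] : exists (q : nat) p, `|q0%:~R| = q%:R :> R /\
    N (q0%:~R *: x - map_mx intr p0) = N (q%:R *: x - map_mx intr p).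
  case: (intP q0) => [|k|k]; first by exists 0%N, p0; rewrite normr0.
    by exists k.+1, p0; rewrite ger0_norm // ler0n.
  exists k.+1, (- p0); rewrite mulrNz normrN ger0_norm ?ler0n //; split=> //.
  have -> : k.+1%:R *: x - map_mx intr (- p0) = -1 *: (- k.+1%:R *: x - map_mx intr p0).
    by rewrite map_mxN scalerBr scalerA mulrNN mul1r scaleN1r.
  by rewrite NZ normrN1 mul1r.
rewrite qq0 in g1; rewrite g3 in g2.
have qn0 : (0 < q)%N.
  rewrite lt0n; apply/eqP => q00.
  have q0E : q0 = 0 by apply/eqP; rewrite -(intr_eq0 R) -normr_eq0 qq0 q00.
  have p0n : p0 != 0.
    apply: contra_neq v0 => p00; rewrite vE q0E p00 raddf0.
    exact: (@col_mx0 _ 1 2 1).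
  move: g2; rewrite -g3 q0E scale0r sub0r -scaleN1r NZ normrN1 mul1r.
  apply/negP; rewrite -leNgt.
  have Np : c <= N (map_mx intr p0).
    by apply: le_trans (Nc _); rewrite ler_peMr ?(ltW c0) // nrm_int_ge1.
  apply: (@le_trans _ _ (expR t * c)); last by rewrite ler_wpM2l ?expR_ge0.
  by rewrite -ler_pdivrMr // ltW // (le_lt_trans _ et) // lerDl.
set d := N (q%:R *: x - _) in g2; have d0 : 0 <= d := N_ge0 _.
exists q; split; last first.
  exists p; apply: sqrt_scale_ge => //; first exact: ltW.
  have -> : rho' ^+ 2 = mu * (mu * mu).
    by rewrite -!expr2 -exprS exprVn; apply: (@mulfI _ (A' ^+ 3)); rewrite ?A'E ?mulfV // expf_neq0 // gt_eqF.
  have -> : q%:R * d ^+ 2 = (expR (- (2 * t)) * q%:R) * ((expR t * d) * (expR t * d)).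
    by rewrite expRN expRM_natl; field; rewrite gt_eqF // expR_gt0.
  have td0 : 0 <= expR t * d by rewrite mulr_ge0 ?expR_ge0.
  apply: ler_pM; [by rewrite mulr_ge0 ?expR_ge0|exact: mulr_ge0|exact: ltW|].
  by apply: ler_pM => //; exact: ltW.
rewrite leqNgt; apply/negP => qQ.
have := HQ0 (Q0.+1 * q)%N _ (Q0.+1%:Z *: p).
rewrite (leq_trans (leqnSn Q0)) ?leq_pmulr // => /(_ isT).
have -> : (Q0.+1 * q)%:R *: x - map_mx intr (Q0.+1%:Z *: p) = n *: (q%:R *: x - map_mx intr p).
  rewrite natrM -scalerA scalerBr; congr (_ - _).
  by apply/colP => i; rewrite !mxE intrM.
rewrite NZ -/d (ger0_norm (ltW n0)); apply/negP; rewrite -ltNge.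
have y1 : 1 <= (Q0.+1 * q)%:R :> R by rewrite ler1n muln_gt0.
have sy : Num.sqrt (Q0.+1 * q)%:R <= n * Q%:R.
  apply: (@le_trans _ _ (Q0.+1 * q)%:R).
    rewrite -{2}[(Q0.+1 * q)%:R]sqr_sqrtr // expr2 ler_peMl ?sqrtr_ge0 //.
    by rewrite -{1}sqrtr1; apply: ler_wsqrtr.
  by rewrite natrM ler_pM2l // ler_nat ltnW.
apply: (@le_lt_trans _ _ (n * Q%:R * (n * d))).
  by rewrite ler_wpM2r // mulr_ge0 // ltW.
rewrite -(ltr_pM2l (expR_gt0 t)).
apply: (@le_lt_trans _ _ (n * Q%:R * n * mu)).
  have -> : expR t * (n * Q%:R * (n * d)) = n * Q%:R * n * (expR t * d) by ring.
  by rewrite ler_wpM2l ?(ltW g2) // !mulr_ge0 // ltW.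
rewrite mulrA ltr_pdivlMr // mulrC -ltr_pdivrMr //.
by apply: le_lt_trans et; rewrite /t1 lerDr.
Qed.

Lemma approximation_spectrum_ray : exists rho0 : R, 0 < rho0 /\
  forall rho : R, 0 < rho < rho0 -> ~ countable [set x : 'cV[R]_2 |
    ~ rational_points x /\ liminf_approx N x = rho%:E].
Proof.
have [T T0 ray] := lattice_spectrum_ray (shortest_lattice_function N_norm)
  (shortest_diverging N_norm).
pose rho0 := Num.sqrt (T ^- 3).
have rho00 : 0 < rho0 by rewrite sqrtr_gt0 invr_gt0 exprn_gt0.
have TE : T ^+ 3 * rho0 ^+ 2 = 1.
  by rewrite sqr_sqrtr ?invr_ge0 ?exprn_ge0 ?(ltW T0) // mulfV // expf_neq0 // gt_eqF.
exists rho0; split=> // rho /andP[r0 rr0].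
have [A A0 AE] := dual_level r0.
have TA : T < A by exact: (dual_level_lt _ _ _ _ AE TE rr0).
apply: not_countable_of_avoiding => zs.
have [rs rsP] : exists rs : nat -> 'cV[R]_2, forall x, rational_points x -> exists j, rs j = x.
  apply: countable_enum; rewrite /rational_points.
  apply: sub_countable (card_image_le _ _) _; exact: countableP.
(* Avoiding the rational points as well makes [x] irrational. *)
pose zr j := if odd j then rs j./2 else zs j./2.
have [x [xz up lo]] := ray A TA zr; exists x.
  by move=> j; have := xz j.*2; rewrite /zr odd_double doubleK.
split.
  move=> /rsP[j jx]; have := xz j.*2.+1.
  by rewrite /zr /= odd_double /= uphalf_double jx eqxx.
apply: limn_einf_eq => [e e0|e n0 e0].
  pose rho' := Num.max (rho / 2) (rho - e).
  have r'0 : 0 < rho' by rewrite lt_max divr_gt0.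
  have r'r : rho' < rho by rewrite gt_max; apply/andP; split; lra.
  have [Q HQ] := approx_lower A0 r'0 r'r AE up.
  exists (maxn Q 1) => q; rewrite geq_max => /andP[/HQ {}HQ q1].
  have q0 : 0 < Num.sqrt q%:R :> R by rewrite sqrtr_gt0 ltr0n.
  apply: (@le_trans _ _ rho'); first by rewrite le_max lexx orbT.
  rewrite mulrC -ler_pdivrMr //; apply: le_torus_norm => p.
  by rewrite ler_pdivrMr // mulrC.
have r2 : rho / 2 < rho by lra.
have [q [nq [p Hp]]] := approx_upper n0 A0 r0 (ltac:(rewrite ltrDl; exact: e0) : rho < rho + e) AE
  (approx_lower A0 (divr_gt0 r0 (ltr0n _ 2)) r2 AE up) lo.
exists q => //; apply: le_trans Hp; rewrite ler_wpM2l ?sqrtr_ge0 //.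
exact: torus_norm_le.
Qed.

End SimultaneousApproximation.

Unset Implicit Arguments.

Theorem proposition6p1 (R : realType) :
  (forall F : X3 R -> R,
     (forall L, 0 <= F L) -> continuous F -> proper_map F ->
     exists T : R,
       [/\ 0 < T,
           EFin @` `]T, +oo[ `<=` range (limsup_orbit F)
         & forall A : R, T < A ->
             ~ countable [set x : 'cV[R]_2 | limsup_orbit F x = A%:E]]) /\
  (forall N : 'cV[R]_2 -> R, is_norm N ->
     exists rho0 : R, 0 < rho0 /\
       forall rho : R, 0 < rho < rho0 ->
         ~ countable [set x : 'cV[R]_2 |
             ~ rational_points x /\ liminf_approx N x = rho%:E]).
Proof.
split=> [F F_ge0 F_cont F_proper|N N_norm].
  exact: proper_spectrum_ray.
exact: approximation_spectrum_ray.
Qed.
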